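(* Let $g_1,g_2$ be positive integers and let $\theta_1,\theta_2\in k^\times$ be elements of finite order. The following statements are equivalent (where $\simeq$ denotes isomorphism of $k$-algebras): (a) $\mathfrak{sl}_{g_1}(Q(\theta_1))\simeq\mathfrak{sl}_{g_2}(Q(\theta_2))$. (b) $g_1=g_2$ and $\theta_1=\theta_2^{\pm1}$. (c) $M_{g_1}(Q(\theta_1))\simeq M_{g_2}(Q(\theta_2))$.
   Context: $k$ is an algebraically closed field of characteristic $0$. For $\theta\in k^\times$, the quantum torus $Q(\theta)$ is the unital associative $k$-algebra generated by $x_1,x_2,x_1^{-1},x_2^{-1}$ subject to the inverse relations and $x_1x_2=\theta x_2x_1$. For a unital associative algebra $\mathcal A$, $M_g(\mathcal A)$ is the associative algebra of $g\times g$ matrices over $\mathcal A$, $\mathfrak{gl}_g(\mathcal A)$ is $M_g(\mathcal A)$ regarded as a Lie algebra under the commutator, and $\mathfrak{sl}_g(\mathcal A)=[\mathfrak{gl}_g(\mathcal A),\mathfrak{gl}_g(\mathcal A)]$. *)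

(* Defs.v *)
From HB Require Import structures.
From mathcomp Require Import all_boot all_order all_algebra.
From mathcomp Require Import boolp.

Set Implicit Arguments.
Unset Strict Implicit.
Unset Printing Implicit Defensive.

Import GRing.Theory.
Local Open Scope ring_scope.
Local Open Scope quotient_scope.

Section QuantumTorus.
Variable K : fieldType.

Inductive qterm : Type :=
  | QX1 | QX2 | QX1inv | QX2inv
  | QZero | QOne
  | QOpp of qterm
  | QAdd of qterm & qterm
  | QMul of qterm & qterm
  | QScale of K & qterm.

HB.instance Definition _ := gen_eqMixin qterm.
HB.instance Definition _ := gen_choiceMixin qterm.

Variable theta : K.

(* The least congruence on the expressions above that contains the axioms of
   unital associative K-algebras and the defining relations; the quotient is
   therefore the K-algebra presented by these generators and relations. *)
Inductive qrel : qterm -> qterm -> Prop :=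
  | qrel_refl t : qrel t t
  | qrel_sym t u : qrel t u -> qrel u t
  | qrel_trans u t v : qrel t u -> qrel u v -> qrel t v
  | qrel_opp t t' : qrel t t' -> qrel (QOpp t) (QOpp t')
  | qrel_add t t' u u' : qrel t t' -> qrel u u' -> qrel (QAdd t u) (QAdd t' u')
  | qrel_mul t t' u u' : qrel t t' -> qrel u u' -> qrel (QMul t u) (QMul t' u')
  | qrel_scale c t t' : qrel t t' -> qrel (QScale c t) (QScale c t')
  | qrel_addA t u v : qrel (QAdd t (QAdd u v)) (QAdd (QAdd t u) v)
  | qrel_addC t u : qrel (QAdd t u) (QAdd u t)
  | qrel_add0 t : qrel (QAdd QZero t) t
  | qrel_addN t : qrel (QAdd (QOpp t) t) QZero
  | qrel_mulA t u v : qrel (QMul t (QMul u v)) (QMul (QMul t u) v)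
  | qrel_mul1l t : qrel (QMul QOne t) t
  | qrel_mul1r t : qrel (QMul t QOne) t
  | qrel_mulDl t u v : qrel (QMul (QAdd t u) v) (QAdd (QMul t v) (QMul u v))
  | qrel_mulDr t u v : qrel (QMul t (QAdd u v)) (QAdd (QMul t u) (QMul t v))
  | qrel_scaleA a b t : qrel (QScale a (QScale b t)) (QScale (a * b) t)
  | qrel_scale1 t : qrel (QScale 1 t) t
  | qrel_scaleDr a t u :
      qrel (QScale a (QAdd t u)) (QAdd (QScale a t) (QScale a u))
  | qrel_scaleDl a b t :
      qrel (QScale (a + b) t) (QAdd (QScale a t) (QScale b t))
  | qrel_scaleAl a t u : qrel (QScale a (QMul t u)) (QMul (QScale a t) u)
  | qrel_scaleAr a t u : qrel (QScale a (QMul t u)) (QMul t (QScale a u))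
  | qrel_X1V : qrel (QMul QX1 QX1inv) QOne
  | qrel_VX1 : qrel (QMul QX1inv QX1) QOne
  | qrel_X2V : qrel (QMul QX2 QX2inv) QOne
  | qrel_VX2 : qrel (QMul QX2inv QX2) QOne
  | qrel_comm : qrel (QMul QX1 QX2) (QScale theta (QMul QX2 QX1)).

Definition qrelb (t u : qterm) : bool := `[< qrel t u >].

Lemma qrelb_refl : reflexive qrelb.
Proof. by move=> t; apply/asboolP; exact: qrel_refl. Qed.

Lemma qrelb_sym : symmetric qrelb.
Proof. by move=> t u; apply/asboolP/asboolP; exact: qrel_sym. Qed.

Lemma qrelb_trans : transitive qrelb.
Proof.
by move=> u t v /asboolP tu /asboolP uv; apply/asboolP; exact: qrel_trans tu uv.
Qed.

Canonical qrelb_equiv := EquivRel qrelb qrelb_refl qrelb_sym qrelb_trans.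

Hypothesis theta_neq0 : theta != 0.

(* The proof that theta is nonzero is an argument of the type because the
   library's algebras satisfy 1 != 0, which fails for theta = 0. *)
Definition qtorus of theta != 0 : Type := {eq_quot qrelb_equiv}.

Local Notation Q := (qtorus theta_neq0).

HB.instance Definition _ := Choice.copy Q {eq_quot qrelb_equiv}.

Definition qclass (t : qterm) : Q := \pi_{eq_quot qrelb_equiv} t.
Definition qrepr (x : Q) : qterm := repr (x : {eq_quot qrelb_equiv}).

Lemma qreprK : cancel qrepr qclass.
Proof. by move=> x; rewrite /qclass /qrepr reprK. Qed.

Lemma qclassP t u : qclass t = qclass u <-> qrel t u.
Proof.
rewrite /qclass; split.
  by move/eqmodP => /= /asboolP.
by move=> tu; apply/eqmodP => /=; apply/asboolP.
Qed.

Lemma qreprP t : qrel (qrepr (qclass t)) t.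
Proof. by apply/qclassP; rewrite qreprK. Qed.

Definition qopp (x : Q) : Q := qclass (QOpp (qrepr x)).
Definition qadd (x y : Q) : Q := qclass (QAdd (qrepr x) (qrepr y)).
Definition qmul (x y : Q) : Q := qclass (QMul (qrepr x) (qrepr y)).
Definition qscale (c : K) (x : Q) : Q := qclass (QScale c (qrepr x)).

Lemma qoppE t : qopp (qclass t) = qclass (QOpp t).
Proof. by apply/qclassP/qrel_opp/qreprP. Qed.

Lemma qaddE t u : qadd (qclass t) (qclass u) = qclass (QAdd t u).
Proof. by apply/qclassP/qrel_add; exact: qreprP. Qed.

Lemma qmulE t u : qmul (qclass t) (qclass u) = qclass (QMul t u).
Proof. by apply/qclassP/qrel_mul; exact: qreprP. Qed.

Lemma qscaleE c t : qscale c (qclass t) = qclass (QScale c t).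
Proof. by apply/qclassP/qrel_scale/qreprP. Qed.

Let qE := (qoppE, qaddE, qmulE, qscaleE).

Lemma qclass_ind (P : Q -> Prop) : (forall t, P (qclass t)) -> forall x, P x.
Proof. by move=> PQ x; rewrite -[x]qreprK. Qed.

Fact qaddA : associative qadd.
Proof.
elim/qclass_ind=> t; elim/qclass_ind=> u; elim/qclass_ind=> v.
by rewrite !qE; apply/qclassP/qrel_addA.
Qed.

Fact qaddC : commutative qadd.
Proof.
elim/qclass_ind=> t; elim/qclass_ind=> u.
by rewrite !qE; apply/qclassP/qrel_addC.
Qed.

Fact qadd0 : left_id (qclass QZero) qadd.
Proof. by elim/qclass_ind=> t; rewrite !qE; apply/qclassP/qrel_add0. Qed.

Fact qaddN : left_inverse (qclass QZero) qopp qadd.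
Proof. by elim/qclass_ind=> t; rewrite !qE; apply/qclassP/qrel_addN. Qed.

HB.instance Definition _ := GRing.isZmodule.Build Q qaddA qaddC qadd0 qaddN.

Fact qmulA : associative qmul.
Proof.
elim/qclass_ind=> t; elim/qclass_ind=> u; elim/qclass_ind=> v.
by rewrite !qE; apply/qclassP/qrel_mulA.
Qed.

Fact qmul1l : left_id (qclass QOne) qmul.
Proof. by elim/qclass_ind=> t; rewrite !qE; apply/qclassP/qrel_mul1l. Qed.

Fact qmul1r : right_id (qclass QOne) qmul.
Proof. by elim/qclass_ind=> t; rewrite !qE; apply/qclassP/qrel_mul1r. Qed.

Fact qmulDl : left_distributive qmul +%R.
Proof.
elim/qclass_ind=> t; elim/qclass_ind=> u; elim/qclass_ind=> v.
by rewrite [LHS]/= /GRing.add /= !qE; apply/qclassP/qrel_mulDl.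
Qed.

Fact qmulDr : right_distributive qmul +%R.
Proof.
elim/qclass_ind=> t; elim/qclass_ind=> u; elim/qclass_ind=> v.
by rewrite [LHS]/= /GRing.add /= !qE; apply/qclassP/qrel_mulDr.
Qed.

(* Nontriviality is witnessed by the representation on functions int -> K in
   which x1 multiplies by theta ^ i and x2 shifts the argument. *)
Fixpoint qact (t : qterm) (f : int -> K) : int -> K :=
  match t with
  | QX1 => fun i => theta ^ i * f i
  | QX2 => fun i => f (i - 1)
  | QX1inv => fun i => (theta ^ i)^-1 * f i
  | QX2inv => fun i => f (i + 1)
  | QZero => fun=> 0
  | QOne => f
  | QOpp u => fun i => - qact u f i
  | QAdd u v => fun i => qact u f i + qact v f i
  | QMul u v => qact u (qact v f)
  | QScale c u => fun i => c * qact u f i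
  end.

Lemma qactD t f g : qact t (fun i => f i + g i) = fun i => qact t f i + qact t g i.
Proof.
elim: t f g => [||||||u IH|u IHu v IHv|u IHu v IHv|c u IH] f g //=;
  apply/funext => i.
- by rewrite mulrDr.
- by rewrite mulrDr.
- by rewrite addr0.
- by rewrite IH opprD.
- by rewrite IHu IHv addrACA.
- by rewrite IHv IHu.
- by rewrite IH mulrDr.
Qed.

Lemma qactZ t c f : qact t (fun i => c * f i) = fun i => c * qact t f i.
Proof.
elim: t f => [||||||u IH|u IHu v IHv|u IHu v IHv|d u IH] f //=;
  apply/funext => i.
- by rewrite mulrCA.
- by rewrite mulrCA.
- by rewrite mulr0.
- by rewrite IH mulrN.
- by rewrite IHu IHv mulrDr.
- by rewrite IHv IHu.
- by rewrite IH mulrCA.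
Qed.

Lemma qact_rel t u : qrel t u -> qact t = qact u.
Proof.
have thetaX i : theta ^ i != 0 by rewrite expfz_neq0.
elim=> {t u} //=.
- by move=> u t v _ -> _ ->.
- by move=> t t' _ ->.
- by move=> t t' u u' _ -> _ ->.
- by move=> t t' u u' _ -> _ ->.
- by move=> c t t' _ ->.
- by move=> t u v; apply/funext=> f; apply/funext=> i; rewrite addrA.
- by move=> t u; apply/funext=> f; apply/funext=> i; rewrite addrC.
- by move=> t; apply/funext=> f; apply/funext=> i; rewrite add0r.
- by move=> t; apply/funext=> f; apply/funext=> i; rewrite addNr.
- by move=> t u v; apply/funext=> f; rewrite qactD.
- by move=> a b t; apply/funext=> f; apply/funext=> i; rewrite mulrA.
- by move=> t; apply/funext=> f; apply/funext=> i; rewrite mul1r.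
- by move=> a t u; apply/funext=> f; apply/funext=> i; rewrite mulrDr.
- by move=> a b t; apply/funext=> f; apply/funext=> i; rewrite mulrDl.
- by move=> a t u; apply/funext=> f; rewrite qactZ.
- by apply/funext=> f; apply/funext=> i; rewrite mulVKf.
- by apply/funext=> f; apply/funext=> i; rewrite mulKf.
- by apply/funext=> f; apply/funext=> i; rewrite subrK.
- by apply/funext=> f; apply/funext=> i; rewrite addrK.
- apply/funext=> f; apply/funext=> i; rewrite mulrA; congr (_ * _).
  by rewrite -{1}[i](subrKC 1) (expfzDr 1 (i - 1) theta_neq0).
Qed.

Fact qone_neq0 : qclass QOne != 0.
Proof.
apply/eqP => /qclassP /qact_rel /(congr1 (fun F => F (fun=> 1) 0)) /= /eqP.
by rewrite oner_eq0.
Qed.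

HB.instance Definition _ :=
  GRing.Zmodule_isNzRing.Build Q qmulA qmul1l qmul1r qmulDl qmulDr qone_neq0.

Fact qscaleA a b x : qscale a (qscale b x) = qscale (a * b) x.
Proof.
by elim/qclass_ind: x => t; rewrite !qE; apply/qclassP/qrel_scaleA.
Qed.

Fact qscale1 : left_id 1 qscale.
Proof. by elim/qclass_ind=> t; rewrite !qE; apply/qclassP/qrel_scale1. Qed.

Fact qscaleDr : right_distributive qscale +%R.
Proof.
move=> a; elim/qclass_ind=> t; elim/qclass_ind=> u.
by rewrite [LHS]/= /GRing.add /= !qE; apply/qclassP/qrel_scaleDr.
Qed.

Fact qscaleDl x : {morph qscale^~ x : a b / a + b}.
Proof.
move=> a b; elim/qclass_ind: x => t.
by rewrite [X in _ = X]/GRing.add /= !qE; apply/qclassP/qrel_scaleDl.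
Qed.

HB.instance Definition _ :=
  GRing.Zmodule_isLmodule.Build K Q qscaleA qscale1 qscaleDr qscaleDl.

Fact qscaleAl (a : K) (x y : Q) : a *: (x * y) = (a *: x) * y.
Proof.
elim/qclass_ind: x => t; elim/qclass_ind: y => u.
by rewrite /GRing.scale /GRing.mul /= !qE; apply/qclassP/qrel_scaleAl.
Qed.

HB.instance Definition _ := GRing.Lmodule_isLalgebra.Build K Q qscaleAl.

Fact qscaleAr (a : K) (x y : Q) : a *: (x * y) = x * (a *: y).
Proof.
elim/qclass_ind: x => t; elim/qclass_ind: y => u.
by rewrite /GRing.scale /GRing.mul /= !qE; apply/qclassP/qrel_scaleAr.
Qed.

HB.instance Definition _ := GRing.Lalgebra_isAlgebra.Build K Q qscaleAr.

End QuantumTorus.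

(* 'M[A]_g with scalars in K; the library's own module structure on 'M[A]_g
   has scalars in A. *)
Section MatrixAlgebra.
Variables (K : fieldType) (g : nat) (A : algType K).

Definition mxalg : Type := 'M[A]_g.

HB.instance Definition _ := GRing.PzRing.copy mxalg 'M[A]_g.

Definition mxalg_scale (c : K) (M : mxalg) : mxalg := map_mx ( *:%R c) M.

Fact mxalg_scaleA a b M :
  mxalg_scale a (mxalg_scale b M) = mxalg_scale (a * b) M.
Proof. by apply/matrixP=> i j; rewrite !mxE scalerA. Qed.

Fact mxalg_scale1 : left_id 1 mxalg_scale.
Proof. by move=> M; apply/matrixP=> i j; rewrite !mxE scale1r. Qed.

Fact mxalg_scaleDr : right_distributive mxalg_scale +%R.
Proof. by move=> a M N; apply/matrixP=> i j; rewrite !mxE scalerDr. Qed.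

Fact mxalg_scaleDl M : {morph mxalg_scale^~ M : a b / a + b}.
Proof. by move=> a b; apply/matrixP=> i j; rewrite !mxE scalerDl. Qed.

HB.instance Definition _ := GRing.Zmodule_isLmodule.Build K mxalg
  mxalg_scaleA mxalg_scale1 mxalg_scaleDr mxalg_scaleDl.

Lemma mxalg_scaleAl (c : K) (M N : mxalg) : c *: (M * N) = (c *: M) * N.
Proof.
apply/matrixP=> i j; rewrite !mxE scaler_sumr.
by apply: eq_bigr => l _; rewrite !mxE scalerAl.
Qed.

Lemma mxalg_scaleAr (c : K) (M N : mxalg) : c *: (M * N) = M * (c *: N).
Proof.
apply/matrixP=> i j; rewrite !mxE scaler_sumr.
by apply: eq_bigr => l _; rewrite !mxE scalerAr.
Qed.

End MatrixAlgebra.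

Definition mxalg_isomorphic (K : fieldType) (g1 g2 : nat) (A1 A2 : algType K)
    : Prop :=
  exists f : {rmorphism mxalg g1 A1 -> mxalg g2 A2}, scalable f /\ bijective f.

HB.mixin Record Lmodule_isLieAlgebra (K : fieldType) L of GRing.Lmodule K L := {
  lie : L -> L -> L;
  lie_linearl : forall y, linear (lie^~ y);
  lie_linearr : forall x, linear (lie x);
  liexx : forall x, lie x x = 0;
  lie_jacobi : forall x y z,
    lie x (lie y z) + lie y (lie z x) + lie z (lie x y) = 0
}.

#[short(type="lieAlgType")]
HB.structure Definition LieAlgebra (K : fieldType) :=
  {L of GRing.Lmodule K L & Lmodule_isLieAlgebra K L}.

Definition lie_isomorphic (K : fieldType) (L1 L2 : lieAlgType K) : Prop :=
  exists f : {linear L1 -> L2}, {morph f : x y / lie x y} /\ bijective f.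

Section DerivedAlgebra.
Variables (K : fieldType) (L : lieAlgType K).

Definition derived_mem : {pred L} := fun x =>
  `[< exists n (c : 'I_n -> K) (a b : 'I_n -> L),
        x = \sum_(i < n) c i *: lie (a i) (b i) >].

Lemma derived_memP x :
  reflect (exists n (c : 'I_n -> K) (a b : 'I_n -> L),
             x = \sum_(i < n) c i *: lie (a i) (b i))
          (x \in derived_mem).
Proof. exact: asboolP. Qed.

Lemma lie_derived_mem (x y : L) : lie x y \in derived_mem.
Proof.
apply/derived_memP; exists 1, (fun=> 1), (fun=> x), (fun=> y).
by rewrite big_ord1 scale1r.
Qed.

Fact derived_submod_closed : submod_closed derived_mem.
Proof.
split=> [|d x y /derived_memP[m [c [a [b ->]]]] /derived_memP[n [e [a' [b' ->]]]]].
  by apply/derived_memP; exists 0, (fun=> 0), (fun=> 0), (fun=> 0); rewrite big_ord0.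
apply/derived_memP; exists (m + n)%N.
pose join T (u : 'I_m -> T) (v : 'I_n -> T) (i : 'I_(m + n)) : T :=
  match split i with inl j => u j | inr j => v j end.
exists (join _ (fun i => d * c i) e), (join _ a a'), (join _ b b').
rewrite big_split_ord scaler_sumr /=; congr (_ + _); apply: eq_bigr => i _.
  by rewrite /join (unsplitK (inl i)) scalerA.
by rewrite /join (unsplitK (inr i)).
Qed.

HB.instance Definition _ :=
  GRing.isSubmodClosed.Build K L derived_mem derived_submod_closed.

Record derived := Derived {
  derived_val :> L;
  _ : derived_val \in derived_mem
}.

HB.instance Definition _ := [isSub for derived_val].
HB.instance Definition _ := [Choice of derived by <:].
HB.instance Definition _ := [SubChoice_isSubLmodule of derived by <:].

Definition derived_lie (x y : derived) : derived :=
  Derived (lie_derived_mem (derived_val x) (derived_val y)).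

Fact derived_lie_linearl y : linear (derived_lie^~ y).
Proof. by move=> c x z; apply: val_inj; rewrite /= lie_linearl. Qed.

Fact derived_lie_linearr x : linear (derived_lie x).
Proof. by move=> c y z; apply: val_inj; rewrite /= lie_linearr. Qed.

Fact derived_liexx x : derived_lie x x = 0.
Proof. by apply: val_inj; rewrite /= liexx. Qed.

Fact derived_lie_jacobi x y z :
  derived_lie x (derived_lie y z) + derived_lie y (derived_lie z x)
    + derived_lie z (derived_lie x y) = 0.
Proof. by apply: val_inj; rewrite /= lie_jacobi. Qed.

HB.instance Definition _ := Lmodule_isLieAlgebra.Build K derived
  derived_lie_linearl derived_lie_linearr derived_liexx derived_lie_jacobi.

End DerivedAlgebra.

Section GeneralLinear.
Variables (K : fieldType) (g : nat) (A : algType K).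

Definition gl : Type := mxalg g A.

HB.instance Definition _ := GRing.Lmodule.copy gl (mxalg g A).

Definition gl_lie (M N : gl) : gl :=
  (M : mxalg g A) * (N : mxalg g A) - (N : mxalg g A) * (M : mxalg g A).

Fact gl_lie_linearl N : linear (gl_lie^~ N).
Proof.
move=> c M P; rewrite /gl_lie mulrDl mulrDr -mxalg_scaleAl -mxalg_scaleAr.
by rewrite scalerBr opprD addrACA.
Qed.

Fact gl_lie_linearr M : linear (gl_lie M).
Proof.
move=> c N P; rewrite /gl_lie mulrDl mulrDr -mxalg_scaleAl -mxalg_scaleAr.
by rewrite scalerBr opprD addrACA.
Qed.

Fact gl_liexx M : gl_lie M M = 0.
Proof. exact: subrr. Qed.

Fact gl_lie_jacobi M N P :
  gl_lie M (gl_lie N P) + gl_lie N (gl_lie P M) + gl_lie P (gl_lie M N) = 0.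
Proof.
rewrite /gl_lie !mulrBl !mulrBr !mulrA !opprB.
rewrite !addrA.
rewrite [LHS](ACl ((1*12)*(2*7)*(3*10)*(4*5)*(6*11)*(8*9)))/=.
by rewrite !(subrr, addNr, addr0).
Qed.

HB.instance Definition _ := Lmodule_isLieAlgebra.Build K gl
  gl_lie_linearl gl_lie_linearr gl_liexx gl_lie_jacobi.

End GeneralLinear.

Definition sl (K : fieldType) (g : nat) (A : algType K) : lieAlgType K :=
  derived (gl g A).

(* Main.v *)
(* (b) => (c) holds because Q(theta) and Q(theta^-1) are isomorphic by exchanging x1 and
   x2, and (c) => (a) by restricting an isomorphism of associative algebras to the derived
   Lie algebras. For (a) => (b) let n be the order of theta and N = g n. Sending x1, x2 to
   s^m, t^m times the clock and shift matrices identifies sl_g(Q(theta)) with a twisted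
   loop algebra inside sl_N(k(s, t)): the traceless matrices whose coefficient of s^(m c)
   t^(m d) is homogeneous of degree (c, d) for the (Z/n)^2-grading given by conjugation by
   clock and shift. Taking m = n2 for the first algebra and m = n1 for the second, both
   centroids consist of the Laurent polynomials in s^(n1 n2), t^(n1 n2), so a Lie
   isomorphism induces a monomial substitution there, with matrix in GL_2(Z). Dividing by
   n1-th roots of these monomials untwists the isomorphism into a Lie homomorphism sl_N1(k)
   -> sl_N2(k(s, t)) with spanning image, and following root vectors produces a matrix C
   intertwining it with X -> X or X -> -X^T; hence N1 <= N2, and N1 = N2 by symmetry. The
   untwisted map is twisted-equivariant for the substitutions s -> eta s and t -> t / eta;
   taking determinants and leading coefficients of the resulting relations for C shows
   theta1^(+-1) = theta2^(q^2). Exchanging the algebras gives n1 = n2, so g1 = g2, and then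
   theta1 = theta2^q yields theta1 = theta2^(+-1). *)
From HB Require Import structures.
Require Import Defs.
From mathcomp Require Import all_boot all_order all_algebra.
From mathcomp Require Import boolp ring zify mxtens.
Set Implicit Arguments.
Unset Strict Implicit.
Unset Printing Implicit Defensive.
Import Order.TTheory GRing.Theory Num.Theory.
Local Open Scope ring_scope.

(** * Traceless matrices *)

(** The obstacle is that a Lie isomorphism is only semilinear over the centroid, so it has no direct
    extension to matrices over k(s, t). Cutting it into graded components and dividing each by a
    character that extends its action on the centroid leaves a map on constant matrices in which
    nothing is twisted any more. The parameters survive as commutation constants: a substitution in
    s or t is implemented on the second algebra by B2^q or A2^q, and on the first by monomials in A1
    and B1. The constants are theta2^(-q^2) and theta1^(b c - a d), the latter exponent being up to
    sign the determinant of the substitution on the centroid. The intertwiner C carries one pair to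
    the other up to scalars of k(s, t); determinants show that these have degree 0, so no
    substitution changes their leading coefficients, and the two commutation constants must agree,
    up to an inversion in the case of -X^T. The number q appears because eta with eta^n2 = theta1
    makes eta^n1 merely some power of theta2. For g = 1 and theta = 1 the Lie algebra is zero and
    has no root vectors to follow, so this case is treated apart. *)

Definition mxbr (R : pzRingType) n (X Y : 'M[R]_n) := X *m Y - Y *m X.

Section Traceless.
Variables (F : fieldType) (n : nat).
Implicit Types (X Y : 'M[F]_n.+1) (P : 'M[F]_n.+1 -> Prop).

Lemma mxbr_trace X Y : \tr (mxbr X Y) = 0.
Proof. by rewrite /mxbr raddfB /= mxtrace_mulC subrr. Qed.

Lemma mxbr_delta (a b c d : 'I_n.+1) :
  mxbr (delta_mx a b) (delta_mx c d) =
  delta_mx a d *+ (b == c) - delta_mx c b *+ (d == a) :> 'M[F]_n.+1.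
Proof. by rewrite /mxbr !mul_delta_mx_cond. Qed.

(** Subspaces are handled throughout as predicates closed under [a *: X + Y], so that spanning
    statements become induction principles. Subtracting the vanishing [\tr X *: delta_mx 0 0] turns
    the diagonal part into multiples of [delta_mx i i - delta_mx 0 0]. *)
Lemma traceless_ind P :
  (forall a X Y, P X -> P Y -> P (a *: X + Y)) ->
  P 0 ->
  (forall i j, i != j -> P (delta_mx i j)) ->
  (forall i, P (delta_mx i i - delta_mx 0 0)) ->
  forall X, \tr X = 0 -> P X.
Proof.
move=> Plin P0 Poff Pdiag X trX.
have PS (I : Type) (r : seq I) (Q : pred I) (f : I -> 'M[F]_n.+1) :
    (forall i, Q i -> P (f i)) -> P (\sum_(i <- r | Q i) f i).
  move=> Pf; apply: big_ind => // Y Z PY PZ.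
  by rewrite -[Y]scale1r; apply: Plin.
have PZ a Y : P Y -> P (a *: Y).
  by move=> PY; rewrite -[_ *: _]addr0; apply: Plin.
have -> : X = \sum_i \sum_j (if i == j then X i i *: (delta_mx i i - delta_mx 0 0)
                             else X i j *: delta_mx i j).
  transitivity (X - \tr X *: delta_mx 0 0); first by rewrite trX scale0r subr0.
  rewrite {1}[X]matrix_sum_delta /mxtrace scaler_suml -sumrB; apply: eq_bigr => i _.
  rewrite (bigD1 i) //= [RHS](bigD1 i) //= eqxx scalerBr addrAC; congr (_ + _).
  by apply: eq_bigr => j /negPf; rewrite eq_sym => ->.
apply: (PS) => i _; apply: PS => j _; case: eqP => [_ | /eqP ij]; apply: PZ.
  exact: Pdiag.
exact: Poff.
Qed.

(** Simplicity of sl in the form used below. The double bracket of E_ab with E_ba is -2 E_ba, which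
    reverses a root and uses that 2 is invertible; single brackets move either index. *)
Lemma traceless_ideal P (i j : 'I_n.+1) : (2%:R : F) != 0 ->
  (forall a X Y, P X -> P Y -> P (a *: X + Y)) ->
  P 0 ->
  (forall X a b, P X -> a != b -> P (mxbr X (delta_mx a b))) ->
  i != j -> P (delta_mx i j) ->
  forall X, \tr X = 0 -> P X.
Proof.
move=> two0 Plin P0 Pbr ij Pij.
have PZ a Y : P Y -> P (a *: Y).
  by move=> PY; rewrite -[_ *: _]addr0; apply: Plin.
have PN Y : P (- Y) -> P Y by move/(PZ (-1)); rewrite scaleN1r opprK.
have flip a b : a != b -> P (delta_mx a b) -> P (delta_mx b a).
  move=> ab Pab; have ba: b != a by rewrite eq_sym.
  have := Pbr _ b a (Pbr _ b a Pab ba) ba.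
  rewrite mxbr_delta !eqxx !mulr1n /mxbr mulmxBl mulmxBr !mul_delta_mx_cond.
  rewrite (negPf ab) !eqxx !mulr1n !mulr0n.
  rewrite sub0r subr0 -opprD => /PN; rewrite -mulr2n -scaler_nat.
  by move/(PZ 2%:R^-1); rewrite scalerA mulVf // scale1r.
have rowP b : i != b -> P (delta_mx i b).
  move=> ib; case: (eqVneq j b) => [<- // | jb].
  by have := Pbr _ j b Pij jb; rewrite mxbr_delta eqxx eq_sym (negPf ib) subr0.
have offP a b : a != b -> P (delta_mx a b).
  move=> ab; case: (eqVneq i b) => [ib | ib].
    by apply: flip; rewrite 1?eq_sym // -ib; apply: rowP; rewrite ib eq_sym.
  case: (eqVneq a i) => [-> | ai]; first exact: rowP.
  have := Pbr _ a i (rowP _ ib) ai.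
  by rewrite mxbr_delta eqxx eq_sym (negPf ab) mulr0n sub0r => /PN.
apply: traceless_ind => // l; case: (eqVneq l 0) => [-> | l0].
  by rewrite subrr.
have := Pbr _ 0 l (offP _ _ l0); rewrite eq_sym => /(_ l0).
by rewrite mxbr_delta !eqxx !mulr1n.
Qed.

(** Schur's lemma for the adjoint module, stated for a linear relation because the operator it
    serves is known only on a spanning set, and its linear extension must first be shown
    single-valued. The unit E_ij spans its weight space for h = E_ii - E_jj, so its image is a
    multiple of itself, and brackets propagate the factor. *)
Lemma traceless_schur (G : 'M[F]_n.+1 -> 'M[F]_n.+1 -> Prop) (i j : 'I_n.+1) :
  [pchar F] =i pred0 -> i != j ->
  (forall a X X' Y Y', G X X' -> G Y Y' -> G (a *: X + Y) (a *: X' + Y')) ->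
  (forall X', G 0 X' -> X' = 0) ->
  (forall X X' Y, G X X' -> \tr Y = 0 -> G (mxbr X Y) (mxbr X' Y)) ->
  (forall X, \tr X = 0 -> exists X', G X X') ->
  exists c, forall X X', \tr X = 0 -> G X X' -> X' = c *: X.
Proof.
move=> /pcharf0P charF ij Glin Gfun Gbr Gtot.
have Guniq X X' X'' : G X X' -> G X X'' -> X' = X''.
  move=> GX' GX''; have := Glin (-1) _ _ _ _ GX' GX''.
  by rewrite !scaleN1r addNr => /Gfun /eqP; rewrite addrC subr_eq0 eq_sym => /eqP.
have G00 : G 0 0.
  have [X' GX'] := Gtot 0 (mxtrace0 _ _).
  by have X'0 := Gfun _ GX'; rewrite X'0 in GX'.
have tr_delta a b : a != b -> \tr (delta_mx a b : 'M[F]_n.+1) = 0.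
  move=> ab; rewrite /mxtrace big1 // => l _; rewrite mxE.
  by case: eqP => //= ->; rewrite (negPf ab).
have [D GD] := Gtot _ (tr_delta _ _ ij).
pose h : 'M[F]_n.+1 := delta_mx i i - delta_mx j j.
have trh : \tr h = 0.
  by rewrite /h -[X in X - _](mul_delta_mx j) -[X in _ - X](mul_delta_mx i) mxbr_trace.
have ji : j != i by rewrite eq_sym.
have hD : mxbr D h = - 2%:R *: D.
  apply: Guniq (Gbr _ _ _ GD trh) _.
  have -> : mxbr (delta_mx i j) h = - 2%:R *: delta_mx i j + 0.
    rewrite /mxbr /h mulmxBl mulmxBr !mul_delta_mx_cond !eqxx (negPf ji).
    by rewrite !mulr0n !mulr1n subr0 sub0r -opprD addr0 -mulr2n scaleNr scaler_nat.
  by rewrite -[- _ *: D]addr0; apply: Glin.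
have [c Dc] : exists c, D = c *: delta_mx i j.
  exists (D i j); apply/matrixP => a b; rewrite !mxE.
  have hE (l m : 'I_n.+1) : h l m = ((l == i)%:R - (l == j)%:R) * (l == m)%:R.
    rewrite /h !mxE; case: (eqVneq l i) => [-> | li] /=.
      rewrite (negPf ij) /= !subr0 mul1r [m == i]eq_sym.
      by case: eqP => // <-; rewrite (negPf ij).
    rewrite !sub0r; case: (eqVneq l j) => [-> | lj] /=; last by rewrite oppr0 mul0r.
    by rewrite mulN1r [m == j]eq_sym.
  have := congr1 (fun M : 'M_n.+1 => M a b) hD; rewrite /mxbr !mxE.
  rewrite (bigD1 b) //= big1 => [|l lb]; last by rewrite hE (negPf lb) !mulr0.
  rewrite (bigD1 a) //= big1 => [|l la]; last by rewrite hE [a == l]eq_sym (negPf la) mulr0 mul0r.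
  rewrite !hE !eqxx !addr0 !mulr1 => /eqP.
  rewrite -subr_eq0 [_ * D a b]mulrC [- _ * D a b]mulrC -!mulrBr mulf_eq0.
  (* The factor of the entry (a, b) is a sum of four indicators: a natural number that vanishes only
     at (i, j). *)
  have coefE (p q r u : bool) :
      p%:R - q%:R - (r%:R - u%:R) - - 2%:R = (p + u + ~~ q + ~~ r)%:R :> F.
    by rewrite !natrD; case: p q r u => [] [] [] [] /=; ring.
  rewrite coefE charF; case: (eqVneq a i) => [-> | ai]; case: (eqVneq b j) => [-> | bj];
    rewrite ?mulr1 //= ?mulr0 ?addn1 ?addnS ?orbF; by move/eqP.
exists c.
suff GP X : \tr X = 0 -> G X (c *: X).
  by move=> X X' trX GX; apply: Guniq GX (GP _ trX).
apply: (@traceless_ideal (fun X => G X (c *: X)) i j) => //.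
- by rewrite charF.
- move=> a Y Z GY GZ; have := Glin a _ _ _ _ GY GZ.
  by rewrite scalerDr !scalerA mulrC.
- by rewrite scaler0.
- move=> Y a b GY ab; have := Gbr _ _ _ GY (tr_delta _ _ ab).
  by rewrite /mxbr -scalemxAl -scalemxAr -scalerBr.
by rewrite -Dc.
Qed.

End Traceless.

Lemma mxbr_linr (R : comPzRingType) p (X Y Z : 'M[R]_p) a :
  mxbr X (a *: Y + Z) = a *: mxbr X Y + mxbr X Z.
Proof.
by rewrite /mxbr mulmxDr mulmxDl -scalemxAr -scalemxAl scalerBr opprD addrACA.
Qed.

Lemma mxbrC (R : pzRingType) p (X Y : 'M[R]_p) : mxbr X Y = - mxbr Y X.
Proof. by rewrite /mxbr opprB. Qed.

Lemma mxbr_linl (R : comPzRingType) p (X Y Z : 'M[R]_p) a :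
  mxbr (a *: Y + Z) X = a *: mxbr Y X + mxbr Z X.
Proof. by rewrite mxbrC mxbr_linr opprD -scalerN -!(mxbrC _ X). Qed.

(** * Lie homomorphisms with spanning image *)

Section RankOne.
Variables (F : fieldType) (n : nat).

(** If u and u' are not parallel, two of their coordinates give a nonzero minor d, and row vectors
    supported there annihilate one of u, u' but not the other. They exhibit w and w' as multiples of
    the same row b. *)
Lemma outer_sum (u u' a : 'cV[F]_n) (w w' b : 'rV[F]_n) :
  u != 0 -> w != 0 -> u *m w + u' *m w' = a *m b ->
  (exists c, u' = c *: u) \/ (exists c, w' = c *: w).
Proof.
move=> u0 w0 Euw.
have [i ui0] : exists i, u i 0 != 0.
  by case/cV0Pn: u0 => i; exists i.
case: (pselect (forall l, u' l 0 * u i 0 = u' i 0 * u l 0)) => [par | npar].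
  left; exists (u' i 0 / u i 0); apply/matrixP => l m; rewrite ord1 !mxE.
  by rewrite mulrAC -par mulfK.
right; have [l Hl] : exists l, u' l 0 * u i 0 != u' i 0 * u l 0.
  by apply: contrapT => H; apply: npar => l; apply/eqP/negPn/negP => Hl; apply: H; exists l.
pose d := u' l 0 * u i 0 - u' i 0 * u l 0.
have d0 : d != 0 by rewrite subr_eq0.
have evl (r : 'rV[F]_n) (v : 'cV[F]_n) : r *m v = (r *m v) 0 0 *: 1%:M.
  by rewrite scalemx1 -mx11_scalar.
pose comb (x y : F) : 'rV[F]_n := x *: delta_mx 0 i - y *: delta_mx 0 l.
have combE x y (v : 'cV[F]_n) : comb x y *m v = (x * v i 0 - y * v l 0) *: 1%:M.
  rewrite /comb mulmxBl -!scalemxAl -!rowE; apply/matrixP => p q.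
  by rewrite !ord1 !mxE mulr1n mulr1.
have H x y : (x * u i 0 - y * u l 0) *: w + (x * u' i 0 - y * u' l 0) *: w' =
    (x * a i 0 - y * a l 0) *: b.
  have := congr1 (mulmx (comb x y)) Euw.
  by rewrite mulmxDr !mulmxA !combE -!scalemxAl !mul1mx.
have Hw := H (u' l 0) (u' i 0).
have Hw' := H (- u l 0) (- u i 0).
move: Hw; rewrite [X in _ + X *: _](_ : _ = 0); last by ring.
rewrite scale0r addr0 => Hw.
move: Hw'; rewrite [X in X *: w + _](_ : _ = 0); last by ring.
rewrite scale0r add0r => Hw'.
set x := (X in _ = X *: b) in Hw; set y := (X in _ = X *: b) in Hw'.
have dw : d *: w = x *: b by rewrite -Hw.
have dw' : d *: w' = y *: b by rewrite -Hw'; congr (_ *: _); rewrite /d; ring.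
have x0 : x != 0.
  apply/eqP => x0; move: dw; rewrite x0 scale0r => /eqP.
  by rewrite scaler_eq0 (negPf d0) (negPf w0).
exists (y / x); apply: (scalerI d0); rewrite dw' scalerA mulrC -scalerA dw scalerA.
by rewrite divfK.
Qed.

(** For a nonzero entry e_ij, the choice Z = E_ji makes e Z e the product of a column and a row of
    e, and the factor c cannot be 0. *)
Lemma outer_sandwich (e : 'M[F]_n) :
  (forall Z, exists c, e *m Z *m e = c *: e) ->
  exists (u : 'cV_n) (w : 'rV_n), e = u *m w.
Proof.
move=> He; case: (eqVneq e 0) => [-> | /matrix0Pn[i [j eij]]].
  by exists 0, 0; rewrite mul0mx.
have [c Hc] := He (delta_mx j i).
have ec : c *: e = col j e *m row i e.
  by rewrite -Hc -(mul_delta_mx (0 : 'I_1)) mulmxA -colE -mulmxA -rowE.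
have c0 : c != 0.
  apply/eqP => c0; move: ec; rewrite c0 scale0r => /matrixP /(_ i j).
  by rewrite !mxE big_ord1 !mxE => /esym/eqP; rewrite mulf_eq0 orbb (negPf eij).
by exists (c^-1 *: col j e), (row i e); rewrite -scalemxAl -ec scalerA mulVf ?scale1r.
Qed.

End RankOne.

Section Classification.
Variables (k E : fieldType) (iota : {rmorphism k -> E}) (n m : nat).
Variable Phi : 'M[k]_n.+1 -> 'M[E]_m.+1.
Hypothesis char_k : [pchar k] =i pred0.
Hypothesis Phi_lin : forall a X Y, Phi (a *: X + Y) = iota a *: Phi X + Phi Y.
Hypothesis Phi_br : forall X Y, Phi (mxbr X Y) = mxbr (Phi X) (Phi Y).
Hypothesis Phi_span : forall P : 'M[E]_m.+1 -> Prop,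
  (forall e X Y, P Y -> P (e *: Phi X + Y)) -> P 0 -> forall Z, \tr Z = 0 -> P Z.

Let charF j : (j%:R == 0 :> E) = (j == 0%N).
Proof. by have /pcharf0P <- := char_k; rewrite -(rmorph_nat iota) fmorph_eq0. Qed.

Lemma Phi0 : Phi 0 = 0.
Proof.
have /eqP := Phi_lin 1 0 0; rewrite scale1r addr0 rmorph1 scale1r.
by rewrite -subr_eq0 opprD addNKr oppr_eq0 => /eqP.
Qed.

Lemma PhiD X Y : Phi (X + Y) = Phi X + Phi Y.
Proof. by rewrite -[X]scale1r Phi_lin rmorph1 !scale1r. Qed.

Lemma PhiZ a X : Phi (a *: X) = iota a *: Phi X.
Proof. by rewrite -[_ *: X]addr0 Phi_lin Phi0 addr0. Qed.

Lemma mxbr2_sandwich (R : comPzRingType) p (X Z : 'M[R]_p) :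
  X *m X = 0 -> mxbr X (mxbr X Z) = - 2%:R *: (X *m Z *m X).
Proof.
move=> XX; rewrite /mxbr mulmxBr mulmxBl !mulmxA XX mul0mx sub0r.
by rewrite -!mulmxA XX mulmx0 subr0 scaleNr scaler_nat -opprD mulr2n.
Qed.

(* [X, [X, _]] takes values in the line of X; since the image of Phi spans, the same holds for
   e = Phi X, and this identity forces e to have rank at most one. *)
Lemma Phi_outer X Y : X *m X = 0 -> X *m Y *m X = X ->
  (forall Z, exists c, X *m Z *m X = c *: X) ->
  exists (u : 'cV_m.+1) (w : 'rV_m.+1),
    [/\ Phi X = u *m w, Phi X *m Phi X = 0 & Phi X = 0 \/ w *m u = 0].
Proof.
move=> XX XYX Xsand; set e := Phi X.
have e2 Z : exists c, mxbr e (mxbr e Z) = c *: e.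
  suff tr0Z : forall Z, \tr Z = 0 -> exists c, mxbr e (mxbr e Z) = c *: e.
    have trZ : \tr (Z - (\tr Z / m.+1%:R)%:M) = 0.
      by rewrite raddfB /= mxtrace_scalar -[(_ / _) *+ _]mulr_natr divfK ?subrr // charF.
    have [c Hc] := tr0Z _ trZ; exists c; rewrite -Hc; congr mxbr.
    by rewrite /mxbr mulmxBr mulmxBl scalar_mxC opprB addrA subrK.
  apply: Phi_span => [d W W' [c Hc]|].
    have [c' Hc'] := Xsand W.
    exists (d * iota (- 2%:R * c') + c).
    rewrite !mxbr_linr Hc -!Phi_br mxbr2_sandwich // Hc' scalerA PhiZ scalerA -/e.
    by rewrite scalerDl.
  by exists 0; rewrite /mxbr !(mulmx0, mul0mx) !subr0 mulmx0 mul0mx subr0 scale0r.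
have two0 : (2%:R : E) != 0 by rewrite charF.
have he : mxbr (Phi (X *m Y)) e = e.
  by rewrite -Phi_br /mxbr XYX mulmxA XX mul0mx subr0.
have ef : mxbr e (mxbr e (Phi Y)) = - 2%:R *: e.
  by rewrite -!Phi_br mxbr2_sandwich // XYX PhiZ rmorphN rmorph_nat.
(* For Z = (Phi Y) e the double bracket is [e, [e, Phi Y]] e = -2 e^2, and it lies on the line of
   e. *)
have [mu emu] : exists mu, e *m e = mu *: e.
  have [c Hc] := e2 (Phi Y *m e); exists (- (2%:R^-1 * c)).
  apply: (scalerI two0); rewrite scalerA mulrN mulVKf // scaleNr -Hc -[LHS]opprK.
  congr (- _); rewrite -scaleNr [LHS]scalemxAl -ef /mxbr.
  by rewrite !(mulmxBr, mulmxBl) !mulmxA.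
(* Under bracketing with [Phi (X *m Y)] the matrix e has weight 1 and e^2 has weight 2; being also a
   multiple of e, the square vanishes. *)
have ee : e *m e = 0.
  have: mxbr (Phi (X *m Y)) (e *m e) = 2%:R *: (e *m e).
    rewrite scaler_nat mulr2n -{3}he -{6}he /mxbr mulmxBr mulmxBl !mulmxA.
    by rewrite addrA subrK.
  rewrite emu -[mu *: e]addr0 mxbr_linr he /mxbr mulmx0 mul0mx subrr addr0.
  rewrite scaler_nat mulr2n => /eqP; rewrite -subr_eq0 opprD addNKr oppr_eq0.
  by move/eqP.
have [c'|u [w euw]] := @outer_sandwich _ _ e.
  have [c Hc] := e2 c'; exists (- (2%:R^-1 * c)).
  apply: (scalerI two0); rewrite scalerA mulrN mulVKf // scaleNr -Hc.
  by rewrite mxbr2_sandwich // scaleNr opprK.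
exists u, w; split=> //; case: (eqVneq e 0) => [-> | e0]; [by left | right].
have wuE := mx11_scalar (w *m u); move: ee; rewrite {1}euw {1}euw mulmxA -(mulmxA u) wuE.
rewrite mul_mx_scalar -scalemxAl -euw => /eqP; rewrite scaler_eq0 (negPf e0) orbF.
by move=> /eqP ->; rewrite raddf0.
Qed.
End Classification.

(** * Root vectors with a common column *)

Section SharedColumn.
Variables (k E : fieldType) (iota : {rmorphism k -> E}) (n m : nat).
Variable Psi : 'M[k]_n.+1 -> 'M[E]_m.+1.
Hypothesis two0 : (2%:R : E) != 0.
Hypothesis Psi_lin : forall a X Y, Psi (a *: X + Y) = iota a *: Psi X + Psi Y.
Hypothesis Psi_br : forall X Y, Psi (mxbr X Y) = mxbr (Psi X) (Psi Y).
Variables (j0 : 'I_n.+1) (u : 'cV[E]_m.+1) (w v' : 'I_n.+1 -> 'rV[E]_m.+1).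
Variable c' : 'I_n.+1 -> 'cV[E]_m.+1.
Let e j := Psi (delta_mx 0 j).
Let f j := Psi (delta_mx j 0).
Hypotheses (j00 : j0 != 0) (e_neq0 : forall j, j != 0 -> e j != 0).
Hypotheses (eE : forall j, j != 0 -> e j = u *m w j).
Hypotheses (wu : forall j, j != 0 -> w j *m u = 0).
Hypotheses (fE : forall j, j != 0 -> f j = c' j *m v' j).
Hypotheses (ff : forall j, j != 0 -> f j *m f j = 0).

Let Psi0 : Psi 0 = 0. Proof. exact: Phi0 Psi_lin. Qed.
Let PsiZ a X : Psi (a *: X) = iota a *: Psi X. Proof. exact: PhiZ Psi_lin _ _. Qed.

(** Only brackets are preserved by [Psi], but for square-zero matrices the double bracket is -2
    times the sandwich product, so this triple product is transported as well. *)
Lemma shared_efe i j : i != 0 -> j != 0 ->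
  e i *m f j *m e i = (i == j)%:R *: e i.
Proof.
move=> i0 j0'; have ee : e i *m e i = 0.
  by rewrite eE // mulmxA -(mulmxA u) wu // mulmx0 mul0mx.
have EE : delta_mx 0 i *m delta_mx 0 i = 0 :> 'M[k]_n.+1.
  by rewrite mul_delta_mx_cond (negPf i0).
have := mxbr2_sandwich (f j) ee; rewrite -!Psi_br mxbr2_sandwich // PsiZ.
rewrite rmorphN rmorph_nat => /(scalerI _) <-; last by rewrite oppr_eq0.
rewrite mul_delta_mx_cond; case: eqP => _; last by rewrite mul0mx Psi0 scale0r.
by rewrite mul_delta_mx scale1r.
Qed.

Let c j := f j *m u.

Lemma shared_wc i j : i != 0 -> j != 0 -> w i *m c j = (i == j)%:R%:M.
Proof.
move=> i0 j0'.
have H : u *m (w i *m c j) *m w i = (i == j)%:R *: e i.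
  by rewrite -shared_efe // eE // /c !mulmxA.
rewrite (mx11_scalar (w i *m c j)); congr (_%:M).
move: H; rewrite {1}(mx11_scalar (w i *m c j)) mul_mx_scalar -scalemxAl -eE // => /eqP.
by rewrite -subr_eq0 -scalerBl scaler_eq0 (negPf (e_neq0 i0)) orbF subr_eq0 => /eqP.
Qed.

(** The factorisation of [f j] is unique only up to a scalar; dividing the row by [s j] makes [c j]
    the matching column. *)
Let s j : E := (v' j *m u) 0 0.
Let v j : 'rV[E]_m.+1 := (s j)^-1 *: v' j.

Lemma shared_vu_neq0 j : j != 0 -> s j != 0.
Proof.
move=> jn0; apply/eqP => H; have := shared_wc jn0 jn0.
rewrite /c fE // -mulmxA (mx11_scalar (v' j *m u)) -/(s j) H raddf0 !mulmx0 eqxx.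
by move=> /matrixP /(_ 0 0); rewrite !mxE => /esym/eqP; rewrite mulr1n oner_eq0.
Qed.

Lemma shared_vu j : j != 0 -> v j *m u = 1%:M.
Proof.
move=> jn0; rewrite /v -scalemxAl (mx11_scalar (v' j *m u)) -/(s j) scale_scalar_mx.
by rewrite mulVf // shared_vu_neq0.
Qed.

Lemma shared_fE j : j != 0 -> f j = c j *m v j.
Proof.
move=> jn0; rewrite /c {2}fE // -(mulmxA (c' j)) (mx11_scalar (v' j *m u)) -/(s j).
rewrite mul_mx_scalar /v -scalemxAl -scalemxAr scalerA mulfV ?shared_vu_neq0 //.
by rewrite scale1r -fE.
Qed.

(** The product equals w_i f_i f_j u. For i = j the square of f_j vanishes; otherwise f_i and f_j
    commute, and w_i f_j f_i = 0 because w_i annihilates the column of f_j. *)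
Lemma shared_vc i j : i != 0 -> j != 0 -> v i *m c j = 0.
Proof.
move=> i0 jn0.
have -> : v i *m c j = w i *m (f i *m f j) *m u.
  rewrite -!mulmxA -/(c j) (mulmxA (w i)) (shared_fE i0) (mulmxA (w i)) shared_wc //.
  by rewrite eqxx mul1mx.
case: (eqVneq i j) => [-> | ij]; first by rewrite ff // mulmx0 mul0mx.
have : mxbr (f i) (f j) = 0.
  by rewrite -Psi_br mxbr_delta [0 == j]eq_sym [0 == i]eq_sym (negPf i0) (negPf jn0) subrr.
move/eqP; rewrite subr_eq0 => /eqP ->.
by rewrite -!mulmxA -/(c i) (shared_fE jn0) -mulmxA (mulmxA (w i)) shared_wc // (negPf ij)
  raddf0 mul0mx.
Qed.

(** The columns of C are the images of the standard basis: u for the index 0 and f_j u for the index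
    j. The rows w_j and one v_j form the dual system W. Equivariance is checked on E_0j and E_j0,
    which generate all traceless matrices. *)
Lemma shared_column_classification :
  exists (C : 'M[E]_(m.+1, n.+1)) (W : 'M[E]_(n.+1, m.+1)), W *m C = 1%:M /\
    forall X, \tr X = 0 -> Psi X *m C = C *m map_mx iota X.
Proof.
pose cc j := if j == 0 then u else c j; pose ww j := if j == 0 then v j0 else w j.
pose C := \matrix_(a, b) cc b a 0; pose W := \matrix_(a, b) ww a 0 b.
have colC b : col b C = cc b by apply/matrixP => x y; rewrite ord1 !mxE.
have rowW a : row a W = ww a by apply/matrixP => x y; rewrite ord1 !mxE.
have WC : W *m C = 1%:M.
  apply/matrixP => a b; transitivity ((ww a *m cc b) 0 0).
    by rewrite !mxE; apply: eq_bigr => l _; rewrite !mxE.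
  rewrite /ww /cc; case: (eqVneq a 0) => [-> | a0]; case: (eqVneq b 0) => [-> | b0].
  - by rewrite shared_vu // !mxE.
  - by rewrite shared_vc // !mxE eq_sym (negPf b0).
  - by rewrite wu // !mxE (negPf a0).
  by rewrite shared_wc // !mxE eqxx mulr1n.
exists C, W; split=> //.
have wC j : j != 0 -> w j *m C = delta_mx 0 j.
  move=> jn0; have -> : w j = row j W by rewrite rowW /ww (negPf jn0).
  by rewrite -row_mul WC row1.
have vC j : j != 0 -> v j *m C = delta_mx 0 0.
  move=> jn0; apply/matrixP => x b; rewrite ord1.
  transitivity ((v j *m cc b) 0 0).
    by rewrite -colC [LHS]mxE [RHS]mxE; apply: eq_bigr => l _; rewrite !mxE.
  rewrite /cc; case: (eqVneq b 0) => [-> | b0]; first by rewrite shared_vu // !mxE.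
  by rewrite shared_vc // !mxE (negPf b0) andbF.
have Pe j : j != 0 -> e j *m C = C *m map_mx iota (delta_mx 0 j).
  move=> jn0; rewrite eE // -mulmxA wC // map_delta_mx -[in RHS](mul_delta_mx (0 : 'I_1)).
  by rewrite mulmxA -colE colC.
have Pf j : j != 0 -> f j *m C = C *m map_mx iota (delta_mx j 0).
  move=> jn0; rewrite shared_fE // -mulmxA vC // map_delta_mx -[in RHS](mul_delta_mx (0 : 'I_1)).
  by rewrite mulmxA -colE colC /cc (negPf jn0).
have Pbr X Y : Psi X *m C = C *m map_mx iota X -> Psi Y *m C = C *m map_mx iota Y ->
    Psi (mxbr X Y) *m C = C *m map_mx iota (mxbr X Y).
  move=> PX PY; rewrite Psi_br /mxbr map_mxB !map_mxM mulmxBl mulmxBr.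
  by rewrite -!mulmxA PX PY !mulmxA PX PY.
have Pd j : j != 0 ->
    Psi (delta_mx j j - delta_mx 0 0) *m C = C *m map_mx iota (delta_mx j j - delta_mx 0 0).
  by move=> jn0; have := Pbr _ _ (Pf _ jn0) (Pe _ jn0); rewrite mxbr_delta !eqxx.
apply: traceless_ind => [a X Y PX PY | | i j ij | i].
- by rewrite Psi_lin mulmxDl -scalemxAl PX PY map_mxD map_mxZ mulmxDr -scalemxAr.
- by rewrite Psi0 map_mx0 mul0mx mulmx0.
- case: (eqVneq i 0) => [i0 | i0]; first by rewrite i0; apply: Pe; rewrite -i0 eq_sym.
  case: (eqVneq j 0) => [-> | jn0]; first exact: Pf.
  have := Pbr _ _ (Pf _ i0) (Pe _ jn0).
  by rewrite mxbr_delta eqxx [j == i]eq_sym (negPf ij) subr0.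
case: (eqVneq i 0) => [-> | i0]; last exact: Pd.
by rewrite subrr Psi0 map_mx0 mul0mx mulmx0.
Qed.

End SharedColumn.

Lemma outer_self_sandwich (F : comPzRingType) p (a : 'cV[F]_p) (b : 'rV[F]_p) (Z : 'M[F]_p) :
  (a *m b) *m Z *m (a *m b) = (b *m Z *m a) 0 0 *: (a *m b).
Proof.
have -> : a *m b *m Z *m (a *m b) = a *m (b *m Z *m a) *m b by rewrite !mulmxA.
by rewrite {1}(mx11_scalar (b *m Z *m a)) mul_mx_scalar -scalemxAl.
Qed.

Section LieHomClassification.
Variables (k E : fieldType) (iota : {rmorphism k -> E}) (n m : nat).
Variable Phi : 'M[k]_n.+1 -> 'M[E]_m.+1.
Hypothesis char_k : [pchar k] =i pred0.
Hypothesis Phi_lin : forall a X Y, Phi (a *: X + Y) = iota a *: Phi X + Phi Y.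
Hypothesis Phi_br : forall X Y, Phi (mxbr X Y) = mxbr (Phi X) (Phi Y).
Hypothesis Phi_span : forall P : 'M[E]_m.+1 -> Prop,
  (forall e X Y, P Y -> P (e *: Phi X + Y)) -> P 0 -> forall Z, \tr Z = 0 -> P Z.
Hypothesis Phi_neq0 : exists X, \tr X = 0 /\ Phi X != 0.
Let e j := Phi (delta_mx 0 j).
Let f j := Phi (delta_mx j 0).

(** The kernel is an ideal, so a single vanishing root vector would kill every traceless matrix. *)
Lemma Phi_delta_neq0 (i j : 'I_n.+1) : i != j -> Phi (delta_mx i j) != 0.
Proof.
move=> ij; apply/eqP => Pij; have [X [trX]] := Phi_neq0; apply/negP/negPn/eqP.
have Phi00 := Phi0 Phi_lin.
apply: (@traceless_ideal k n (fun X => Phi X = 0) i j) => //.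
- by have /pcharf0P -> := char_k.
- by move=> a Y Z PY PZ; rewrite Phi_lin PY PZ scaler0 addr0.
by move=> Y a b PY _; rewrite Phi_br PY /mxbr mul0mx mulmx0 subrr.
Qed.

Lemma Phi_delta_outer (i j : 'I_n.+1) : i != j ->
  exists (u : 'cV_m.+1) (w : 'rV_m.+1),
    [/\ Phi (delta_mx i j) = u *m w, Phi (delta_mx i j) *m Phi (delta_mx i j) = 0
      & w *m u = 0].
Proof.
move=> ij.
have [||Z|u [w [uw ee wu]]] := @Phi_outer _ _ _ _ _ _ char_k Phi_lin Phi_br Phi_span
  (delta_mx i j) (delta_mx j i).
- by rewrite mul_delta_mx_cond eq_sym (negPf ij).
- by rewrite !mul_delta_mx.
- by rewrite -(mul_delta_mx (0 : 'I_1)) outer_self_sandwich; eexists.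
exists u, w; split=> //; case: wu => // H.
by have := Phi_delta_neq0 ij; rewrite H eqxx.
Qed.

(** E_0j + E_0l is again square-zero of rank one, hence so behaves its image. Through [outer_sum]
    this forces e_j and e_l to share their column or their row. *)
Lemma Phi_delta_sum (j l : 'I_n.+1) : j != 0 -> l != 0 -> j != l ->
  exists (a : 'cV_m.+1) (b : 'rV_m.+1), e j + e l = a *m b.
Proof.
move=> j0 l0 jl.
have [||Z|u [w [uw _ _]]] := @Phi_outer _ _ _ _ _ _ char_k Phi_lin Phi_br Phi_span
  (delta_mx 0 j + delta_mx 0 l) (delta_mx j 0).
- by rewrite mulmxDl !mulmxDr !mul_delta_mx_cond (negPf j0) (negPf l0) !mulr0n !addr0.
- by rewrite mulmxDl !mul_delta_mx_cond eqxx [l == j]eq_sym (negPf jl) addr0 mulmxDr !mul_delta_mx.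
- have -> : delta_mx 0 j + delta_mx 0 l = delta_mx 0 0 *m (delta_mx (0 : 'I_1) j + delta_mx 0 l) :> 'M[k]_n.+1
    by rewrite mulmxDr !mul_delta_mx.
  by rewrite outer_self_sandwich; eexists.
by exists u, w; rewrite -uw (PhiD Phi_lin).
Qed.

(** Any two of the vectors [e j] share a column or a row up to scalars; the alternative can be
    chosen uniformly in j, and it decides between X -> X and X -> -X^T. *)
Theorem Lie_hom_classification : (0 < n)%N ->
  exists (C : 'M[E]_(m.+1, n.+1)) (W : 'M[E]_(n.+1, m.+1)), W *m C = 1%:M /\
   ((forall X, \tr X = 0 -> Phi X *m C = C *m map_mx iota X) \/
    (forall X, \tr X = 0 -> - (Phi X)^T *m C = C *m map_mx iota X)).
Proof.
move=> n_gt0; pose j0 : 'I_n.+1 := inord 1.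
have j00 : j0 != 0 by rewrite -val_eqE /= inordK.
have two0 : (2%:R : E) != 0.
  by rewrite -(rmorph_nat iota) fmorph_eq0; have /pcharf0P -> := char_k.
have e_neq0 j : j != 0 -> e j != 0 by move=> jn0; apply: Phi_delta_neq0; rewrite eq_sym.
have : forall j, exists uw : 'cV[E]_m.+1 * 'rV[E]_m.+1, j != 0 ->
    e j = uw.1 *m uw.2 /\ uw.2 *m uw.1 = 0.
  move=> j; case: (eqVneq j 0) => [_ | jn0]; first by exists (0, 0).
  have [|u [w [euw _ wu]]] := @Phi_delta_outer 0 j; first by rewrite eq_sym.
  by exists (u, w).
move=> /choice[uw Huw].
have : forall j, exists cv : 'cV[E]_m.+1 * 'rV[E]_m.+1, j != 0 ->
    f j = cv.1 *m cv.2 /\ f j *m f j = 0.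
  move=> j; case: (eqVneq j 0) => [_ | jn0]; first by exists (0, 0).
  by have [u [w [euw ff wu]]] := Phi_delta_outer jn0; exists (u, w).
move=> /choice[cv Hcv].
pose U j := (uw j).1; pose V j := (uw j).2.
have eE j : j != 0 -> e j = U j *m V j by case/Huw.
have VU j : j != 0 -> V j *m U j = 0 by case/Huw.
have U0 j : j != 0 -> U j != 0.
  by move=> jn0; have := e_neq0 _ jn0; rewrite eE //; apply: contraNneq => ->; rewrite mul0mx.
have V0 j : j != 0 -> V j != 0.
  by move=> jn0; have := e_neq0 _ jn0; rewrite eE //; apply: contraNneq => ->; rewrite mulmx0.
have par j l : j != 0 -> l != 0 -> (exists c, U l = c *: U j) \/ (exists c, V l = c *: V j).
  move=> jn0 ln0; case: (eqVneq j l) => [-> | jl]; first by left; exists 1; rewrite scale1r.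
  have [a [b]] := Phi_delta_sum jn0 ln0 jl; rewrite !eE //.
  by apply: outer_sum; [exact: U0 | exact: V0].
case: (pselect (forall l, l != 0 -> exists c, U l = c *: U j0)) => [shU | nshU].
  have : forall l, exists c, l != 0 -> U l = c *: U j0.
    move=> l; case: (eqVneq l 0) => [_ | /shU [c Hc]]; first by exists 0.
    by exists c.
  move=> /choice[c Hc].
  have [||||||C [W [WC PC]]] := @shared_column_classification k E iota n m Phi two0 Phi_lin Phi_br j0 (U j0) (fun j => c j *: V j) (fun j => (cv j).2) (fun j => (cv j).1).
  - by [].
  - by [].
  - by move=> j jn0; rewrite -/(e j) eE // {1}Hc // -scalemxAl -scalemxAr.
  - by move=> j jn0; rewrite -scalemxAl scalemxAr -Hc // VU.
  - by move=> j /Hcv [].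
  - by move=> j /Hcv [].
  by exists C, W; split=> //; left.
have [l0 [l00 Hl0]] : exists l, l != 0 /\ ~ exists c, U l = c *: U j0.
  apply: contrapT => H; apply: nshU => l ln0; apply: contrapT => H'.
  by apply: H; exists l.
have [c0 Hc0] : exists c, V l0 = c *: V j0 by case: (par j0 l0).
(* The row of [l0] is parallel to that of [j0], its column is not. So if the column of [l] is
   parallel to that of [j0], it cannot also determine the column of [l0], and the row of [l] must be
   shared with [l0]. *)
have shV l : l != 0 -> exists c, V l = c *: V j0.
  move=> ln0; case: (par j0 l) => // -[c Uc]; case: (par l l0) => // -[d Hd].
    by case: Hl0; exists (d * c); rewrite Hd Uc scalerA.
  have d0 : d != 0 by apply: contraNneq (V0 _ l00) => d0; rewrite Hd d0 scale0r.
  by exists (d^-1 * c0); rewrite -scalerA -Hc0 Hd scalerA mulVf ?scale1r.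
have : forall l, exists c, l != 0 -> V l = c *: V j0.
  move=> l; case: (eqVneq l 0) => [_ | /shV [c Hc]]; first by exists 0.
  by exists c.
move=> /choice[c Hc].
(* The contragredient map exchanges columns and rows, which reduces this case to the previous
   one. *)
have [||||||||C [W [WC PC]]] := @shared_column_classification k E iota n m (fun X => - (Phi X)^T) two0 _ _ j0 (V j0)^T (fun j => - (c j *: (U j)^T)) (fun j => - (cv j).1^T) (fun j => (cv j).2^T).
- by move=> a X Y; rewrite Phi_lin linearP opprD scalerN.
- move=> X Y; rewrite Phi_br /mxbr mulNmx mulmxN opprK mulNmx mulmxN opprK -!trmx_mul.
  by rewrite raddfB opprB.
- by [].
- by move=> j jn0; rewrite oppr_eq0 trmx_eq0; apply: e_neq0.
- by move=> j jn0; rewrite -/(e j) eE // {1}Hc // -scalemxAr linearZ /= trmx_mul mulmxN -scalemxAr.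
- by move=> j jn0; rewrite mulNmx -scalemxAl scalemxAr -linearZ /= -Hc // -trmx_mul VU // trmx0 oppr0.
- by move=> j /Hcv [fE _]; rewrite -/(f j) fE trmx_mul mulmxN.
- by move=> j /Hcv [_ ff]; rewrite mulNmx mulmxN opprK -trmx_mul ff trmx0.
by exists C, W; split=> //; right.
Qed.

End LieHomClassification.

(** * The field of rational functions in two variables *)

Section FractionLift.
Variable R : idomainType.
Local Notation "x %:F" := (@FracField.tofrac R x).

Lemma fraction_repr (x : {fraction R}) : exists nd : R * R, nd.2 != 0 /\ x = nd.1%:F / nd.2%:F.
Proof.
pose r := repr x; exists (\n_r, \d_r); split; first exact: denom_ratioP.
rewrite -[LHS]reprK; apply/(canRL (mulfK _)); first by rewrite tofrac_eq0 denom_ratioP.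
rewrite !piE; apply/eqmodP; rewrite /= FracField.equivfE /FracField.mulf.
rewrite !numden_Ratio ?mulf_neq0 ?denom_ratioP ?oner_eq0 //.
by rewrite !mulr1 mulrC.
Qed.

(** Some representative, not a reduced one; [frac_cross] makes what is built from it independent of
    the choice. *)
Definition frac_num (x : {fraction R}) := (sval (cid (fraction_repr x))).1.
Definition frac_den (x : {fraction R}) := (sval (cid (fraction_repr x))).2.

Lemma frac_den_neq0 x : frac_den x != 0.
Proof. by rewrite /frac_den; case: cid => ? []. Qed.

Lemma fracE x : x = (frac_num x)%:F / (frac_den x)%:F.
Proof. by rewrite /frac_den /frac_num; case: cid => ? []. Qed.

Lemma frac_cross (n d n' d' : R) : d != 0 -> d' != 0 ->
  n%:F / d%:F = n'%:F / d'%:F -> n * d' = n' * d.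
Proof.
move=> d0 d'0 /eqP; rewrite eqr_div ?tofrac_eq0 // -!tofracM tofrac_eq => /eqP ->.
by [].
Qed.

Variable F : fieldType.

Definition frac_lift (f : {rmorphism R -> F}) of injective f :=
  fun x => f (frac_num x) / f (frac_den x).

Variables (f : {rmorphism R -> F}) (f_inj : injective f).

Let f_neq0 x : x != 0 -> f x != 0.
Proof. by rewrite -(inj_eq f_inj) rmorph0. Qed.

Lemma frac_liftE n d : d != 0 -> frac_lift f_inj (n%:F / d%:F) = f n / f d.
Proof.
move=> d0; rewrite /frac_lift; set x := _ / _.
apply/eqP; rewrite eqr_div ?f_neq0 ?frac_den_neq0 // -!rmorphM; apply/eqP; congr (f _).
by apply: frac_cross => //; [exact: frac_den_neq0 | rewrite -fracE].
Qed.

Lemma frac_lift_tofrac x : frac_lift f_inj x%:F = f x.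
Proof. by rewrite -[x%:F]divr1 -tofrac1 frac_liftE ?oner_eq0 // rmorph1 divr1. Qed.

Fact frac_lift_zmod : zmod_morphism (frac_lift f_inj).
Proof.
move=> x y; rewrite [x]fracE [y]fracE.
set n := frac_num x; set d := frac_den x; set n' := frac_num y; set d' := frac_den y.
have d0 : d != 0 by exact: frac_den_neq0.
have d'0 : d' != 0 by exact: frac_den_neq0.
have -> : n%:F / d%:F - n'%:F / d'%:F = (n * d' - n' * d)%:F / (d * d')%:F.
  rewrite -mulNr -tofracN addf_div ?tofrac_eq0 // -!tofracM -tofracD.
  by rewrite mulNr.
rewrite !frac_liftE ?mulf_neq0 // rmorphB !rmorphM /=.
by field; rewrite !f_neq0.
Qed.

Fact frac_lift_monoid : monoid_morphism (frac_lift f_inj).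
Proof.
split; first by rewrite -tofrac1 frac_lift_tofrac rmorph1.
move=> x y; rewrite [x]fracE [y]fracE.
have d0 := frac_den_neq0 x; have d'0 := frac_den_neq0 y.
by rewrite mulf_div -!tofracM !frac_liftE ?mulf_neq0 // mulf_div -!rmorphM.
Qed.

HB.instance Definition _ :=
  GRing.isZmodMorphism.Build {fraction R} F (frac_lift f_inj) frac_lift_zmod.
HB.instance Definition _ :=
  GRing.isMonoidMorphism.Build {fraction R} F (frac_lift f_inj) frac_lift_monoid.

End FractionLift.

(** Evaluation at 0 shows that X divides one of the two factors, and the exponent drops. Stated over
    a domain so that it applies first in t over k[s] and then in s over k. *)
Lemma poly_monomial_factor (D : idomainType) (p q : {poly D}) (c : D) N :
  c != 0 -> p * q = c%:P * 'X^N ->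
  exists a b i j, [/\ p = a%:P * 'X^i, q = b%:P * 'X^j & a * b = c].
Proof.
elim: N p q => [|N IH] p q c0.
  rewrite expr0 mulr1 => pq.
  have sz : (size p * size q != 0)%N /\ ((size p + size q).-1 = 1)%N.
    have p0 : p != 0 by apply: contra_neq c0 => p0; apply/polyC_inj; rewrite -pq p0 mul0r.
    have q0 : q != 0 by apply: contra_neq c0 => q0; apply/polyC_inj; rewrite -pq q0 mulr0.
    by rewrite muln_eq0 !size_poly_eq0 negb_or p0 q0 -size_mul // pq size_polyC c0.
  have [sp sq] : (size p <= 1)%N /\ (size q <= 1)%N by move: sz; split; lia.
  exists p`_0, q`_0, 0, 0; rewrite !expr0 !mulr1 -!size1_polyC //; split=> //.
  by move/(congr1 (horner^~ 0)): pq; rewrite hornerM hornerC !horner_coef0.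
move=> pq; have : p.[0] * q.[0] = 0 by rewrite -hornerM pq !hornerE expr0n /= mulr0.
have factor (r : {poly D}) : r.[0] = 0 -> exists r', r = r' * 'X.
  by move/eqP/factor_theorem => [r' ->]; exists r'; rewrite subr0.
move/eqP; rewrite mulf_eq0 => /orP[] /eqP /factor [r rE].
  have [|a [b [i [j [rM qM ab]]]]] := IH r q c0.
    by apply: (mulIf (negbT (polyX_eq0 D))); rewrite mulrAC -rE pq exprSr mulrA.
  by exists a, b, i.+1, j; split=> //; rewrite rE rM -mulrA -exprSr.
have [|a [b [i [j [pM rM ab]]]]] := IH p r c0.
  by apply: (mulIf (negbT (polyX_eq0 D))); rewrite -mulrA -rE pq exprSr mulrA.
by exists a, b, i, j.+1; split=> //; rewrite rE rM -mulrA -exprSr.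
Qed.

Lemma monomial_clear (F : fieldType) (c s t : F) (i j : int) (M : nat) :
  s != 0 -> t != 0 -> 0 <= i + M%:Z -> 0 <= j + M%:Z ->
  c * (s ^ i * t ^ j) * (s * t) ^+ M =
  c * s ^+ `|(i + M%:Z)%R|%N * t ^+ `|(j + M%:Z)%R|%N.
Proof.
have shift z (l : int) : z != 0 -> 0 <= l + M%:Z -> z ^ l * z ^+ M = z ^+ `|(l + M%:Z)%R|%N :> F.
  by move=> z0 lM; rewrite !exprnP -expfzDr // gez0_abs.
by move=> s0 t0 iM jM; rewrite exprMn -mulrA mulrACA !shift // mulrA.
Qed.

Lemma monomial_unclear (F : fieldType) (x c s t : F) (i j N : nat) :
  s != 0 -> t != 0 -> x * (s * t) ^+ N = c * s ^+ i * t ^+ j ->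
  x = c * (s ^ (i%:Z - N%:Z) * t ^ (j%:Z - N%:Z)).
Proof.
move=> s0 t0 Hx; have st0 : (s * t) ^+ N != 0 by rewrite expf_neq0 // mulf_neq0.
apply: (mulIf st0); rewrite Hx !expfzDr // -!exprnP -!exprnN exprMn.
by field; rewrite !expf_neq0.
Qed.

Definition laurent (k E : fieldType) (iota : k -> E) (s t : E) (x : E) :=
  exists r : seq (k * (int * int)), x = \sum_(q <- r) iota q.1 * (s ^ q.2.1 * t ^ q.2.2).

(* The properties of k(s, t) that matter: tf_twist a b is the substitution s -> a s, t -> b t
   (unspecified if a or b is 0), and tf_lc, tf_ds, tf_dt are the leading coefficient and the
   exponents of the leading monomial for a lexicographic order. *)
Record torus_field (k : fieldType) := TorusField {
  tf_field :> fieldType;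
  tf_const : {rmorphism k -> tf_field};
  tf_s : tf_field;
  tf_t : tf_field;
  tf_twist : k -> k -> {rmorphism tf_field -> tf_field};
  tf_lc : tf_field -> k;
  tf_ds : tf_field -> int;
  tf_dt : tf_field -> int;
  tf_s_neq0 : tf_s != 0;
  tf_t_neq0 : tf_t != 0;
  tf_twist_const : forall a b c, a != 0 -> b != 0 -> tf_twist a b (tf_const c) = tf_const c;
  tf_twist_s : forall a b, a != 0 -> b != 0 -> tf_twist a b tf_s = tf_const a * tf_s;
  tf_twist_t : forall a b, a != 0 -> b != 0 -> tf_twist a b tf_t = tf_const b * tf_t;
  tf_twistC : forall a b a' b' x, a != 0 -> b != 0 -> a' != 0 -> b' != 0 ->
    tf_twist a b (tf_twist a' b' x) = tf_twist a' b' (tf_twist a b x);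
  tf_lcM : forall x y, tf_lc (x * y) = tf_lc x * tf_lc y;
  tf_lc_const : forall c, tf_lc (tf_const c) = c;
  tf_lc_neq0 : forall x, x != 0 -> tf_lc x != 0;
  tf_lc_twist : forall a b x, a != 0 -> b != 0 ->
    tf_lc (tf_twist a b x) = a ^ tf_ds x * b ^ tf_dt x * tf_lc x;
  tf_dsM : forall x y, x != 0 -> y != 0 -> tf_ds (x * y) = tf_ds x + tf_ds y;
  tf_dtM : forall x y, x != 0 -> y != 0 -> tf_dt (x * y) = tf_dt x + tf_dt y;
  tf_ds_const : forall c, c != 0 -> tf_ds (tf_const c) = 0;
  tf_dt_const : forall c, c != 0 -> tf_dt (tf_const c) = 0;
  tf_ds_twist : forall a b x, a != 0 -> b != 0 -> tf_ds (tf_twist a b x) = tf_ds x;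
  tf_dt_twist : forall a b x, a != 0 -> b != 0 -> tf_dt (tf_twist a b x) = tf_dt x;
  tf_laurent_unit : forall x y,
    laurent tf_const tf_s tf_t x -> laurent tf_const tf_s tf_t y -> x * y = 1 ->
    exists c i j, c != 0 /\ x = tf_const c * (tf_s ^ i * tf_t ^ j)
}.

Section RationalFunctions.
Variable k : fieldType.
Local Notation P := {poly {poly k}}.
Local Notation E := {fraction P}.
Local Notation "x %:F" := (@FracField.tofrac P x).

Lemma coef_scale_var (D : comNzRingType) (c : D) p i :
  (p \Po (c%:P * 'X))`_i = p`_i * c ^+ i.
Proof.
elim/poly_ind: p i => [|p d IH] i; first by rewrite comp_poly0 coef0 mul0r.
rewrite comp_polyD comp_polyM comp_polyX comp_polyC !coefD !coefC mulrCA coefCM !coefMX.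
by case: i => [|i] /=; [rewrite mulr0 mulr1 | rewrite IH !addr0 exprS mulrCA].
Qed.

Section ScaleVar.
Variables (D : idomainType) (c : D).
Hypothesis c0 : c != 0.
Let q := c%:P * 'X.
Let sq : size q = 2.
Proof. by rewrite size_Cmul // size_polyX. Qed.

Lemma size_scale_var p : size (p \Po q) = size p.
Proof.
have := size_comp_poly p q; rewrite sq muln1 => H.
case: (eqVneq p 0) => [-> | p0]; first by rewrite comp_poly0.
have lq : lead_coef (p \Po q) != 0.
  rewrite lead_coef_comp ?sq // mulf_neq0 ?lead_coef_eq0 // expf_neq0 //.
  by rewrite lead_coef_eq0 -size_poly_eq0 sq.
rewrite lead_coef_eq0 -size_poly_gt0 in lq; rewrite -size_poly_gt0 in p0.
by rewrite -(prednK lq) H prednK.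
Qed.

Lemma lead_coef_scale_var p : lead_coef (p \Po q) = lead_coef p * c ^+ (size p).-1.
Proof. by rewrite lead_coef_comp ?sq // /q lead_coefM lead_coefC lead_coefX mulr1. Qed.

Lemma scale_var_inj : injective (fun p => p \Po q).
Proof.
apply: raddf_inj => p /eqP; rewrite -size_poly_eq0 size_scale_var size_poly_eq0.
by move/eqP.
Qed.
End ScaleVar.

(** In [P] the outer variable is t and the inner one is s: [a] rescales inside the coefficients and
    [b] rescales the outer variable. *)
Definition twist_poly (a b : k) : {rmorphism P -> E} :=
  @FracField.tofrac P \o comp_poly ((b%:P)%:P * 'X) \o map_poly (comp_poly (a%:P * 'X)).

Definition twist_poly' a b (p : P) := map_poly (comp_poly (a%:P * 'X)) p \Po ((b%:P)%:P * 'X).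

(** The leading term for the lexicographic order that compares exponents of t before exponents of
    s. *)
Definition lcP (p : P) := lead_coef (lead_coef p).
Definition dsP (p : P) := (size (lead_coef p)).-1.
Definition dtP (p : P) := (size p).-1.

Lemma lcP_eq0 p : (lcP p == 0) = (p == 0).
Proof. by rewrite /lcP !lead_coef_eq0. Qed.

Lemma lcPM p q : lcP (p * q) = lcP p * lcP q.
Proof. by rewrite /lcP !lead_coefM. Qed.

Lemma dsPM p q : p != 0 -> q != 0 -> dsP (p * q) = (dsP p + dsP q)%N.
Proof.
move=> p0 q0; rewrite /dsP lead_coefM size_mul ?lead_coef_eq0 //.
have : (0 < size (lead_coef p))%N by rewrite size_poly_gt0 lead_coef_eq0.
have : (0 < size (lead_coef q))%N by rewrite size_poly_gt0 lead_coef_eq0.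
move: (size (lead_coef p)) (size (lead_coef q)); lia.
Qed.

Lemma dtPM p q : p != 0 -> q != 0 -> dtP (p * q) = (dtP p + dtP q)%N.
Proof.
move=> p0 q0; rewrite /dtP size_mul //.
have : (0 < size p)%N by rewrite size_poly_gt0.
have : (0 < size q)%N by rewrite size_poly_gt0.
move: (size p) (size q); lia.
Qed.

Section TwistPoly.
Variables a b : k.
Hypotheses (a0 : a != 0) (b0 : b != 0).

Lemma lead_coef_twist_map p :
  lead_coef (map_poly (comp_poly (a%:P * 'X)) p) = lead_coef p \Po (a%:P * 'X).
Proof. by apply: lead_coef_map_inj; [exact: scale_var_inj | rewrite comp_poly0]. Qed.

Lemma lcP_twist p : lcP (twist_poly' a b p) = a ^+ dsP p * b ^+ dtP p * lcP p.
Proof.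
have b0' : b%:P != 0 :> {poly k} by rewrite polyC_eq0.
rewrite /lcP /twist_poly' (lead_coef_scale_var b0') lead_coefM lead_coef_twist_map.
rewrite lead_coef_scale_var // lead_coef_exp lead_coefC size_map_inj_poly ?comp_poly0 //.
  by rewrite /dsP /dtP; ring.
exact: scale_var_inj.
Qed.

Lemma dtP_twist p : dtP (twist_poly' a b p) = dtP p.
Proof.
have b0' : b%:P != 0 :> {poly k} by rewrite polyC_eq0.
rewrite /dtP /twist_poly' (size_scale_var b0') size_map_inj_poly ?comp_poly0 //.
exact: scale_var_inj.
Qed.

Lemma dsP_twist p : dsP (twist_poly' a b p) = dsP p.
Proof.
have b0' : b%:P != 0 :> {poly k} by rewrite polyC_eq0.
rewrite /dsP /twist_poly' (lead_coef_scale_var b0') lead_coef_twist_map -polyC_exp.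
by rewrite mulrC size_Cmul ?expf_neq0 // size_scale_var.
Qed.

Lemma twist_poly_inj : injective (twist_poly a b).
Proof.
apply: raddf_inj => p /eqP; rewrite /= tofrac_eq0 -/(twist_poly' a b p) -lcP_eq0 lcP_twist.
by rewrite !mulf_eq0 lcP_eq0 !expf_eq0 (negPf a0) (negPf b0) !andbF => /eqP.
Qed.

End TwistPoly.

(** The extension to fractions rests on injectivity, which fails when a scaling factor is 0; the
    identity is the default there. *)
Definition rat_twist (a b : k) : {rmorphism E -> E} :=
  match pselect (a != 0 /\ b != 0) with
  | left h => frac_lift (twist_poly_inj (proj1 h) (proj2 h))
  | right _ => idfun
  end.

Lemma rat_twistE a b n d : a != 0 -> b != 0 -> d != 0 ->
  rat_twist a b (n%:F / d%:F) = (twist_poly' a b n)%:F / (twist_poly' a b d)%:F.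
Proof.
move=> a0 b0 d0; rewrite /rat_twist; case: pselect => [h|[]//].
by rewrite [LHS]frac_liftE.
Qed.

Lemma rat_twist_tofrac a b n : a != 0 -> b != 0 ->
  rat_twist a b n%:F = (twist_poly' a b n)%:F.
Proof.
move=> a0 b0; rewrite /rat_twist; case: pselect => [h|[]//].
by rewrite [LHS]frac_lift_tofrac.
Qed.
Definition rat_lc (x : E) : k := lcP (frac_num x) / lcP (frac_den x).
Definition rat_ds (x : E) : int := (dsP (frac_num x))%:Z - (dsP (frac_den x))%:Z.
Definition rat_dt (x : E) : int := (dtP (frac_num x))%:Z - (dtP (frac_den x))%:Z.

Lemma rat_lcE n d : d != 0 -> rat_lc (n%:F / d%:F) = lcP n / lcP d.
Proof.
move=> d0; set x := n%:F / d%:F; rewrite /rat_lc; have xd0 := frac_den_neq0 x.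
apply/eqP; rewrite eqr_div ?lcP_eq0 // -!lcPM; apply/eqP; congr lcP.
by apply: frac_cross => //; rewrite -fracE.
Qed.

Lemma rat_degE (deg : P -> nat) n d :
  (forall p q, p != 0 -> q != 0 -> deg (p * q) = (deg p + deg q)%N) ->
  n != 0 -> d != 0 -> let x := n%:F / d%:F in
  (deg (frac_num x))%:Z - (deg (frac_den x))%:Z = (deg n)%:Z - (deg d)%:Z.
Proof.
move=> degM n0 d0 x; have xd0 := frac_den_neq0 x.
have xn0 : frac_num x != 0.
  have : x != 0 by rewrite mulf_neq0 ?invr_eq0 ?tofrac_eq0.
  by apply: contra_neq => H; rewrite [x]fracE H tofrac0 mul0r.
have := frac_cross xd0 d0 (esym (fracE x)).
move/(congr1 deg); rewrite !degM //; move: (deg _) (deg _) (deg _) (deg _) => *; lia.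
Qed.

Lemma rat_dsE n d : n != 0 -> d != 0 -> rat_ds (n%:F / d%:F) = (dsP n)%:Z - (dsP d)%:Z.
Proof. exact: rat_degE dsPM. Qed.

Lemma rat_dtE n d : n != 0 -> d != 0 -> rat_dt (n%:F / d%:F) = (dtP n)%:Z - (dtP d)%:Z.
Proof. exact: rat_degE dtPM. Qed.

Definition rat_const (c : k) : E := (c%:P)%:P%:F.
Fact rat_const_zmod : zmod_morphism rat_const.
Proof. by move=> x y; rewrite /rat_const !polyCB tofracB. Qed.
Fact rat_const_monoid : monoid_morphism rat_const.
Proof. by split=> [|x y]; rewrite /rat_const ?polyC1 ?tofrac1 // !polyCM tofracM. Qed.
HB.instance Definition _ := GRing.isZmodMorphism.Build k E rat_const rat_const_zmod.
HB.instance Definition _ := GRing.isMonoidMorphism.Build k E rat_const rat_const_monoid.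

Definition rat_s : E := ('X : {poly k})%:P%:F.
Definition rat_t : E := ('X : P)%:F.

Lemma rat_s_neq0 : rat_s != 0. Proof. by rewrite tofrac_eq0 polyC_eq0 polyX_eq0. Qed.
Lemma rat_t_neq0 : rat_t != 0. Proof. by rewrite tofrac_eq0 polyX_eq0. Qed.

Lemma laurent_clear x : laurent rat_const rat_s rat_t x ->
  exists N p, x * (rat_s * rat_t) ^+ N = p%:F.
Proof.
move=> [r ->]; elim: r => [|[c [i j]] r [N [p IH]]].
  by exists 0, 0; rewrite big_nil mul0r tofrac0.
have [M [q Hq]] : exists M q, rat_const c * (rat_s ^ i * rat_t ^ j) * (rat_s * rat_t) ^+ M = q%:F.
  pose M := (`|i| + `|j|)%N; exists M.
  exists (c%:P%:P * ('X ^+ `|(i + M%:Z)%R|)%:P * 'X ^+ `|(j + M%:Z)%R|).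
  have [iM jM] : 0 <= i + M%:Z /\ 0 <= j + M%:Z by rewrite /M; split; lia.
  apply: etrans (monomial_clear (rat_const c) rat_s_neq0 rat_t_neq0 iM jM) _.
  by rewrite !tofracM polyC_exp !tofracXn.
exists (N + M)%N, (q * ('X%:P * 'X) ^+ N + p * ('X%:P * 'X) ^+ M).
rewrite big_cons /= mulrDl tofracD !tofracM !tofracXn -Hq -IH !tofracM exprD.
by congr (_ + _); rewrite ?mulrA // mulrAC.
Qed.

(** After multiplication by powers of s t, both factors are polynomials whose product is a power of
    s t; its divisors are monomials, first in t and then in s. *)
Lemma rat_laurent_unit x y :
    laurent rat_const rat_s rat_t x -> laurent rat_const rat_s rat_t y -> x * y = 1 ->
    exists c i j, c != 0 /\ x = rat_const c * (rat_s ^ i * rat_t ^ j).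
Proof.
move=> /laurent_clear[N [p Hp]] /laurent_clear[M [q Hq]] xy.
have pq : p * q = ('X ^+ (N + M))%:P * 'X ^+ (N + M).
  apply/eqP; rewrite -tofrac_eq; apply/eqP; rewrite tofracM -Hp -Hq.
  by rewrite mulrACA xy mul1r -exprD tofracM polyC_exp !tofracXn exprMn.
have [|a [b [i [j [pE qE ab]]]]] := poly_monomial_factor _ pq; first by rewrite expf_neq0 ?polyX_eq0.
have [||al [be [i' [j' [aE bE albe]]]]] := @poly_monomial_factor _ a b 1 (N + M).
- exact: oner_neq0.
- by rewrite ab mul1r.
exists al, (i'%:Z - N%:Z), (i%:Z - N%:Z); split.
  by apply/eqP => al0; move/eqP: albe; rewrite al0 mul0r eq_sym oner_eq0.
apply: monomial_unclear rat_s_neq0 rat_t_neq0 _; rewrite Hp pE aE.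
by rewrite !polyCM polyC_exp !tofracM !tofracXn.
Qed.

Lemma coef_twist_poly a b p i j :
  (twist_poly' a b p)`_j`_i = p`_j`_i * (a ^+ i * b ^+ j).
Proof.
rewrite /twist_poly' coef_scale_var coef_map_id0 ?comp_poly0 // -polyC_exp coefMC.
by rewrite coef_scale_var mulrA.
Qed.

Lemma twist_poly_neq0 a b p : a != 0 -> b != 0 -> p != 0 -> twist_poly' a b p != 0.
Proof.
by move=> a0 b0 p0; rewrite -lcP_eq0 lcP_twist // !mulf_neq0 ?expf_neq0 // lcP_eq0.
Qed.

Lemma frac_num_neq0 (x : E) : x != 0 -> frac_num x != 0.
Proof. by apply: contra_neq => H; rewrite [x]fracE H tofrac0 mul0r. Qed.

Lemma rat_lc0 : rat_lc 0 = 0.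
Proof.
have -> : 0 = 0%:F / 1%:F :> E by rewrite tofrac0 mul0r.
by rewrite rat_lcE ?oner_eq0 // /lcP !lead_coef0 mul0r.
Qed.

Lemma rat_constE c : rat_const c = c%:P%:P%:F / 1%:F.
Proof. by rewrite tofrac1 divr1. Qed.

Lemma rat_lc_const c : rat_lc (rat_const c) = c.
Proof. by rewrite rat_constE rat_lcE ?oner_eq0 // /lcP !lead_coefC divr1. Qed.

Lemma rat_degM (deg : P -> nat) (rdeg : E -> int) (x y : E) :
  (forall p q, p != 0 -> q != 0 -> deg (p * q) = (deg p + deg q)%N) ->
  (forall n d, n != 0 -> d != 0 -> rdeg (n%:F / d%:F) = (deg n)%:Z - (deg d)%:Z) ->
  x != 0 -> y != 0 -> rdeg (x * y) = rdeg x + rdeg y.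
Proof.
move=> degM rdegE /frac_num_neq0 nx /frac_num_neq0 ny.
have dx := frac_den_neq0 x; have dy := frac_den_neq0 y.
rewrite [x]fracE [y]fracE mulf_div -!tofracM !rdegE ?mulf_neq0 // !degM //.
by rewrite !PoszD; ring.
Qed.

Lemma exp_frac_twist (F : fieldType) (a b x y : F) (i j i' j' : nat) :
  a != 0 -> b != 0 -> (a ^+ i * b ^+ j * x) / (a ^+ i' * b ^+ j' * y) =
  a ^ (i%:Z - i'%:Z) * b ^ (j%:Z - j'%:Z) * (x / y).
Proof.
move=> a0 b0; rewrite !expfzDr // -!exprnP -!exprnN.
by rewrite !mulf_div.
Qed.

Lemma rat_lc_twist a b x : a != 0 -> b != 0 ->
  rat_lc (rat_twist a b x) = a ^ rat_ds x * b ^ rat_dt x * rat_lc x.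
Proof.
move=> a0 b0; case: (eqVneq x 0) => [-> | x0]; first by rewrite rmorph0 rat_lc0 mulr0.
have d0 := frac_den_neq0 x; rewrite {1}[x]fracE rat_twistE // rat_lcE ?twist_poly_neq0 //.
by rewrite !lcP_twist // exp_frac_twist.
Qed.

Lemma rat_deg_twist (deg : P -> nat) (rdeg : E -> int) (a b : k) x :
  (forall p, deg (twist_poly' a b p) = deg p) ->
  (forall n d, n != 0 -> d != 0 -> rdeg (n%:F / d%:F) = (deg n)%:Z - (deg d)%:Z) ->
  a != 0 -> b != 0 -> rdeg (rat_twist a b x) = rdeg x.
Proof.
move=> degT rdegE a0 b0; case: (eqVneq x 0) => [-> | x0]; first by rewrite rmorph0.
have d0 := frac_den_neq0 x; have n0 := frac_num_neq0 x0.
by rewrite [x]fracE rat_twistE // !rdegE ?twist_poly_neq0 // !degT.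
Qed.

Lemma rat_deg_const (deg : P -> nat) (rdeg : E -> int) c :
  (forall c : k, deg c%:P%:P = 0) ->
  (forall n d, n != 0 -> d != 0 -> rdeg (n%:F / d%:F) = (deg n)%:Z - (deg d)%:Z) ->
  c != 0 -> rdeg (rat_const c) = 0.
Proof.
move=> degC rdegE c0; rewrite rat_constE rdegE ?oner_eq0 ?polyC_eq0 //.
by rewrite -[1]/(1%:P%:P) !degC.
Qed.

Definition rational_torus_field : torus_field k.
Proof.
refine (@TorusField k E rat_const rat_s rat_t rat_twist rat_lc rat_ds rat_dt
  rat_s_neq0 rat_t_neq0 _ _ _ _ _ _ _ rat_lc_twist _ _ _ _ _ _ rat_laurent_unit).
- move=> a b c a0 b0; rewrite [LHS]rat_twist_tofrac //; congr (_%:F).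
  by rewrite /twist_poly' map_polyC /= !comp_polyC.
- move=> a b a0 b0; rewrite [LHS]rat_twist_tofrac // -tofracM; congr (_%:F).
  by rewrite /twist_poly' map_polyC /= comp_polyX comp_polyC polyCM.
- move=> a b a0 b0; rewrite [LHS]rat_twist_tofrac // -tofracM; congr (_%:F).
  by rewrite /twist_poly' map_polyX comp_polyX.
- move=> a b a' b' x a0 b0 a'0 b'0.
  have twC p : twist_poly' a b (twist_poly' a' b' p) = twist_poly' a' b' (twist_poly' a b p).
    by apply/polyP => j; apply/polyP => i; rewrite !coef_twist_poly mulrAC.
  have d0 := frac_den_neq0 x.
  by rewrite [x]fracE !rat_twistE ?twist_poly_neq0 // !twC.
- move=> x y; have dx := frac_den_neq0 x; have dy := frac_den_neq0 y.
  by rewrite [x in LHS]fracE [y in LHS]fracE mulf_div -!tofracM rat_lcE ?mulf_neq0 // !lcPM -mulf_div.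
- exact: rat_lc_const.
- by move=> x x0; rewrite mulf_neq0 ?invr_eq0 ?lcP_eq0 ?frac_den_neq0 ?frac_num_neq0.
- by move=> x y; apply: rat_degM dsPM rat_dsE.
- by move=> x y; apply: rat_degM dtPM rat_dtE.
- move=> c; apply: rat_deg_const rat_dsE => d.
  by rewrite /dsP lead_coefC size_polyC; case: eqP.
- move=> c; apply: rat_deg_const rat_dtE => d.
  by rewrite /dtP size_polyC; case: eqP.
- by move=> a b x a0 b0; apply: rat_deg_twist (dsP_twist a0 b0) rat_dsE a0 b0.
- by move=> a b x a0 b0; apply: rat_deg_twist (dtP_twist a0 b0) rat_dtE a0 b0.
Defined.

End RationalFunctions.

(** * Twisted loop algebras *)

Section Monomials.
Variables (k : fieldType) (T : torus_field k).
Hypothesis char_k : [pchar k] =i pred0.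
Local Notation iota := (tf_const T).

Definition mono (i j : int) : T := tf_s T ^ i * tf_t T ^ j.

Lemma mono_neq0 i j : mono i j != 0.
Proof. by rewrite mulf_neq0 // expfz_neq0 // (tf_s_neq0, tf_t_neq0). Qed.

Lemma monoD i j i' j' : mono (i + i') (j + j') = mono i j * mono i' j'.
Proof. by rewrite /mono !expfzDr ?tf_s_neq0 ?tf_t_neq0 // mulrACA. Qed.

Lemma mono0 : mono 0 0 = 1.
Proof. by rewrite /mono !expr0z mulr1. Qed.

Lemma monoX i j z : mono i j ^ z = mono (i * z) (j * z).
Proof. by rewrite /mono expfzMl -!exprz_exp. Qed.

Lemma monoV i j : (mono i j)^-1 = mono (- i) (- j).
Proof. by rewrite -exprN1 monoX !mulrN1. Qed.

Lemma twist_mono a b i j : a != 0 -> b != 0 ->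
  tf_twist T a b (mono i j) = iota (a ^ i * b ^ j) * mono i j.
Proof.
move=> a0 b0; rewrite /mono rmorphM !fmorphXz tf_twist_s // tf_twist_t //.
by rewrite !expfzMl rmorphM !fmorphXz mulrACA.
Qed.

Lemma twoX_inj : injective (fun z : int => (2%:R : k) ^ z).
Proof.
have /pcharf0P char0 := char_k.
have two0 : (2%:R : k) != 0 by rewrite char0.
have H (n : nat) : (2%:R : k) ^+ n = 1 -> n = 0.
  rewrite -natrX => /eqP; rewrite -[1]/(1%:R) -subr_eq0 -natrB ?expn_gt0 // char0.
  by case: n => // n; rewrite subn_eq0 expnS; have := expn_gt0 2 n; lia.
move=> x y /= xy; apply/eqP; rewrite -subr_eq0; apply/eqP.
have : (2%:R : k) ^ (x - y) = 1 by rewrite expfzDr // -invr_expz xy mulfV ?expfz_neq0.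
case: (x - y) => n; first by move/H => ->.
by rewrite NegzE -invr_expz => /(congr1 (fun z => z^-1)); rewrite invrK invr1 => /H.
Qed.

(** Independence of characters: monomials are eigenvectors of the twists, with distinct characters
    since 2 has infinite order in characteristic 0. The list L holds the exponents other than e0
    still to be eliminated. *)
Lemma mono_coef (e0 : int * int) (r : seq (k * (int * int))) :
  \sum_(q <- r) iota q.1 * mono q.2.1 q.2.2 = 0 -> \sum_(q <- r | q.2 == e0) q.1 = 0.
Proof.
have : {subset [seq q.2 | q <- r] <= e0 :: [seq q.2 | q <- r]}.
  by move=> x xr; rewrite inE xr orbT.
move: {2}[seq q.2 | q <- r] => L; elim: L r => [|e1 L IH] r sub sum0.
  move/eqP: sum0; rewrite (eq_big_seq (fun q => iota q.1 * mono e0.1 e0.2)) => [|q qr].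
    rewrite -mulr_suml mulf_eq0 (negPf (mono_neq0 _ _)) orbF -rmorph_sum fmorph_eq0 => /eqP.
    move=> S0; rewrite -[RHS]S0 big_seq_cond [RHS]big_seq; apply: eq_bigl => q; case qr: (q \in r) => //=.
    by have := sub q.2 (map_f _ qr); rewrite inE => ->.
  by have := sub q.2 (map_f _ qr); rewrite inE => /eqP ->.
case: (eqVneq e1 e0) => [e10 | e10].
  by apply: IH sum0 => x /sub; rewrite e10 !inE => /or3P[] -> //; rewrite ?orbT.
(* Scaling by 2 in a variable where e1 and e0 differ separates their eigenvalues. *)
have [a [b [a0 b0 ab]]] : exists a b : k, [/\ a != 0, b != 0 &
    a ^ e1.1 * b ^ e1.2 != a ^ e0.1 * b ^ e0.2].
  have two0 : (2%:R : k) != 0 by have /pcharf0P -> := char_k.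
  case: (eqVneq e1.1 e0.1) => E1; last first.
    by exists 2%:R, 1; rewrite !exp1rz !mulr1 oner_neq0 (inj_eq twoX_inj).
  exists 1, 2%:R; rewrite !exp1rz !mul1r oner_neq0 (inj_eq twoX_inj); split=> //.
  by apply: contra e10 => /eqP E2; rewrite -pair_eqE /= E1 E2 !eqxx.
pose mu (e : int * int) := a ^ e.1 * b ^ e.2.
(* The twisted relation minus mu(e1) times the original one loses all terms of exponent e1 and
   multiplies those of exponent e0 by a nonzero factor. *)
pose r' := [seq (q.1 * (mu q.2 - mu e1), q.2) | q <- r & q.2 != e1].
have sub' : {subset [seq q.2 | q <- r'] <= e0 :: L}.
  move=> x /mapP[q' /mapP[q]]; rewrite mem_filter => /andP[qe1 qr] -> -> /=.
  by have := sub q.2 (map_f _ qr); rewrite !inE (negPf qe1).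
have tw : \sum_(q <- r) iota (q.1 * mu q.2) * mono q.2.1 q.2.2 = 0.
  have := congr1 (tf_twist T a b) sum0; rewrite rmorph0 rmorph_sum => tw0.
  rewrite -[RHS]tw0; apply: eq_bigr => q _; rewrite [RHS]rmorphM twist_mono // tf_twist_const //.
  by rewrite mulrA -rmorphM.
have sum' : \sum_(q <- r') iota q.1 * mono q.2.1 q.2.2 = 0.
  rewrite big_map big_filter /=.
  transitivity (\sum_(q <- r) iota (q.1 * (mu q.2 - mu e1)) * mono q.2.1 q.2.2).
    rewrite [RHS](bigID (fun q => q.2 == e1)) /= [X in _ = X + _]big1 ?add0r // => q /eqP ->.
    by rewrite subrr mulr0 rmorph0 mul0r.
  transitivity (\sum_(q <- r) iota (q.1 * mu q.2) * mono q.2.1 q.2.2 -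
      iota (mu e1) * \sum_(q <- r) iota q.1 * mono q.2.1 q.2.2).
    rewrite mulr_sumr -sumrB; apply: eq_bigr => q _; rewrite mulrA -rmorphM -mulrBl -rmorphB.
    by rewrite mulrBr [mu e1 * _]mulrC.
  by rewrite tw sum0 mulr0 subr0.
have := IH r' sub' sum'; rewrite big_map big_filter_cond /=.
have -> : \sum_(q <- r | (q.2 != e1) && (q.2 == e0)) q.1 * (mu q.2 - mu e1) =
   (\sum_(q <- r | q.2 == e0) q.1) * (mu e0 - mu e1).
  rewrite mulr_suml; apply: eq_big => [q | q /andP[_ /eqP ->] //].
  by case: (eqVneq q.2 e0) => [-> | _]; rewrite ?andbF // eq_sym e10.
move/eqP; rewrite mulf_eq0 subr_eq0 [mu e0 == _]eq_sym (negPf ab) orbF.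
by move/eqP.
Qed.

End Monomials.

(** * The grading defined by a pair of commuting conjugations *)

Section Grading.
Variables (k : fieldType) (N n : nat) (theta : k) (A B : 'M[k]_N.+1).
Implicit Types X Y : 'M[k]_N.+1.

(* The degree-(c, d) component of the (Z/n)^2-grading for which A ^+ i * B ^+ j has
   degree (i, j). *)
Definition homog (c d : int) X :=
  A *m X = theta ^ d *: (X *m A) /\ B *m X = theta ^ (- c) *: (X *m B).

(** The pair need not generate the matrix algebra: it is instantiated with the block-scalar matrices
    [bigA] and [bigB], so a graded component may have dimension greater than 1. *)
Record twisted_pair : Prop := TwistedPair {
  tp_prim : n.-primitive_root theta;
  tp_comm : A *m B = theta *: (B *m A);
  tp_A : A ^+ n = 1;
  tp_B : B ^+ n = 1
}.

Lemma homog_lin c d a X Y : homog c d X -> homog c d Y -> homog c d (a *: X + Y).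
Proof.
move=> [AX BX] [AY BY]; split; rewrite mulmxDr -scalemxAr (AX, BX) (AY, BY).
  by rewrite mulmxDl -scalemxAl scalerDr !scalerA mulrC.
by rewrite mulmxDl -scalemxAl scalerDr !scalerA mulrC.
Qed.

Lemma homog0 c d : homog c d 0.
Proof. by split; rewrite mulmx0 mul0mx scaler0. Qed.

Hypothesis AB : twisted_pair.
Hypothesis char_k : [pchar k] =i pred0.

Lemma tp_gt0 : (0 < n)%N. Proof. exact: prim_order_gt0 (tp_prim AB). Qed.

Lemma theta_neq0 : theta != 0.
Proof.
apply/eqP => th0; have := prim_expr_order (tp_prim AB).
by rewrite th0 expr0n eqn0Ngt tp_gt0 => /esym/eqP; rewrite oner_eq0.
Qed.

Lemma theta_expz_eq1 z : theta ^ z = 1 -> exists z', z = n%:Z * z'.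
Proof.
have pos (m : nat) : theta ^+ m = 1 -> exists z', m%:Z = n%:Z * z'.
  move/eqP; rewrite -(prim_order_dvd (tp_prim AB)) => /dvdnP[q ->].
  by exists q%:Z; rewrite PoszM mulrC.
case: z => m; first exact: pos.
rewrite NegzE -invr_expz => /(congr1 (fun z => z^-1)); rewrite invrK invr1.
by move=> /pos[z' ->]; exists (- z'); rewrite mulrN.
Qed.

Lemma theta_expzM z : theta ^ (n%:Z * z) = 1.
Proof. by rewrite -exprz_exp -exprnP (prim_expr_order (tp_prim AB)) exp1rz. Qed.

Lemma unitA : A \is a GRing.unit.
Proof. by rewrite -(unitrX_pos _ tp_gt0) (tp_A AB) unitr1. Qed.

Lemma unitB : B \is a GRing.unit.
Proof. by rewrite -(unitrX_pos _ tp_gt0) (tp_B AB) unitr1. Qed.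

Lemma homogM c d c' d' X Y : homog c d X -> homog c' d' Y -> homog (c + c') (d + d') (X *m Y).
Proof.
have th0 := theta_neq0.
move=> [AX BX] [AY BY]; split; rewrite mulmxA (AX, BX) -scalemxAl -mulmxA (AY, BY).
  by rewrite -scalemxAr scalerA mulmxA expfzDr.
by rewrite -scalemxAr scalerA mulmxA opprD expfzDr.
Qed.

Lemma homog_mxbr c d c' d' X Y :
  homog c d X -> homog c' d' Y -> homog (c + c') (d + d') (mxbr X Y).
Proof.
move=> hX hY; rewrite /mxbr [_ - _]addrC -scaleN1r; apply: homog_lin.
  by rewrite [c + _]addrC [d + _]addrC; apply: homogM.
exact: homogM.
Qed.

Lemma homog_congr c d c' d' X :
  theta ^ c = theta ^ c' -> theta ^ d = theta ^ d' -> homog c d X -> homog c' d' X.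
Proof. by rewrite /homog -!invr_expz => -> ->. Qed.

Lemma homog_uniq c d c' d' X : X != 0 -> homog c d X -> homog c' d' X ->
  theta ^ c = theta ^ c' /\ theta ^ d = theta ^ d'.
Proof.
have inj (u v : k) (Y : 'M[k]_N.+1) : Y \is a GRing.unit -> X != 0 ->
    u *: (X *m Y) = v *: (X *m Y) -> u = v.
  move=> uY X0 /eqP; rewrite -subr_eq0 -scalerBl scaler_eq0 subr_eq0 => /orP[/eqP //|/eqP XY].
  by move: X0; rewrite -[X](mulrK uY) -[X * Y]/(X *m Y) XY mul0r eqxx.
move=> X0 [AX BX] [AX' BX']; split; last by apply: (inj _ _ A) => //; [exact: unitA | rewrite -AX].
apply: invr_inj; rewrite !invr_expz.
by apply: (inj _ _ B) => //; [exact: unitB | rewrite -BX].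
Qed.

End Grading.

(** * Projections onto eigenspaces of a conjugation by averaging *)

Section EigenProjection.
Variables (k : fieldType) (N n : nat).
Hypotheses (n0 : n%:R != 0 :> k).
Implicit Types (C D X Y : 'M[k]_N.+1) (w : k).

(** The average of the cyclic group of conjugations by C against the character i -> w^i; it projects
    onto the X with C X C^-1 = w^-1 X. *)
Definition eigproj C w X :=
  n%:R^-1 *: \sum_(i < n) w ^+ i *: (C ^+ i *m X *m C ^- i).

Lemma eigproj_lin C w a X Y : eigproj C w (a *: X + Y) = a *: eigproj C w X + eigproj C w Y.
Proof.
rewrite /eigproj [a *: (_ *: _)]scalerA [a * _]mulrC -scalerA -scalerDr; congr (_ *: _).
rewrite scaler_sumr -big_split /=; apply: eq_bigr => i _ /=; rewrite mulmxDr mulmxDl -scalemxAr -scalemxAl scalerDr !scalerA.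
by rewrite [a * _]mulrC.
Qed.

Lemma sum_unity_root w : w ^+ n = 1 -> \sum_(i < n) w ^+ i = n%:R * (w == 1)%:R.
Proof.
move=> wn; case: eqP => [-> | /eqP w1].
  by rewrite mulr1 (eq_bigr (fun=> 1)) => [|i _]; rewrite ?expr1n // sumr_const card_ord.
rewrite mulr0; apply/eqP; have := subrX1 w n; rewrite wn subrr => /esym/eqP.
by rewrite mulf_eq0 subr_eq0 (negPf w1).
Qed.

Lemma eigproj_trace C w X : C \is a GRing.unit -> \tr X = 0 -> \tr (eigproj C w X) = 0.
Proof.
move=> uC trX; rewrite /eigproj linearZ /= raddf_sum big1 ?mulr0 //= => i _.
rewrite linearZ /= mxtrace_mulC mulmxA -[C ^- i *m C ^+ i]/(C ^- i * C ^+ i).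
by rewrite mulVr ?unitrX // -[1 *m X]/(1 * X) mul1r trX mulr0.
Qed.

Lemma eigproj_eigen C w X : C \is a GRing.unit -> C ^+ n = 1 -> w ^+ n = 1 ->
  C *m eigproj C w X = w^-1 *: (eigproj C w X *m C).
Proof.
move=> uC Cn wn; have w0 : w != 0.
  apply/eqP => w0; have := n0; case: n wn => [|m]; first by rewrite eqxx.
  by rewrite w0 expr0n => /esym/eqP; rewrite oner_eq0.
rewrite /eigproj -scalemxAr -scalemxAl scalerA mulrC -scalerA; congr (_ *: _).
pose F i := w ^+ i *: (C ^+ i *m X *m C ^- i).
(* The term of index n equals the term of index 0, so the sum is cyclic and conjugation by C merely
   shifts it. *)
have shiftF : \sum_(i < n) F i.+1 = \sum_(i < n) F i.
  have : \sum_(i < n) F i + F n = F 0 + \sum_(i < n) F i.+1.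
    by transitivity (\sum_(i < n.+1) F i); [rewrite big_ord_recr | rewrite big_ord_recl].
  have -> : F n = F 0 by rewrite /F Cn wn !expr0.
  by rewrite addrC => /addrI.
rewrite -/(F _) -[in RHS]shiftF mulmx_suml mulmx_sumr scaler_sumr; apply: eq_bigr => i _.
rewrite /F !mulmxE -scalerAr -scalerAl scalerA exprS mulKf //; congr (_ *: _).
by rewrite exprS invrM ?unitrX // !mulrA mulrVK.
Qed.

Lemma conj_eigen C X mu i : C \is a GRing.unit -> C *m X = mu *: (X *m C) ->
  C ^+ i *m X *m C ^- i = mu ^+ i *: X.
Proof.
rewrite !mulmxE => uC CX; suff H : C ^+ i * X = mu ^+ i *: (X * C ^+ i).
  by rewrite H -scalerAl mulrK ?unitrX.
elim: i => [|i IH]; first by rewrite !expr0 scale1r mul1r mulr1.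
by rewrite !exprSr -(mulrA _ C X) CX -scalerAr (mulrA (C ^+ i)) IH -scalerAl scalerA mulrC mulrA.
Qed.

Lemma eigproj_of_eigen C w X mu : C \is a GRing.unit -> (w * mu) ^+ n = 1 ->
  C *m X = mu *: (X *m C) -> eigproj C w X = (w * mu == 1)%:R *: X.
Proof.
move=> uC wmu CX; rewrite /eigproj (eq_bigr (fun i : 'I_n => (w * mu) ^+ i *: X)).
  by rewrite -scaler_suml sum_unity_root // scalerA mulKf.
by move=> i _; rewrite (conj_eigen _ uC CX) scalerA exprMn.
Qed.

Lemma eigproj_sum C w X : n.-primitive_root w -> \sum_(z < n) eigproj C (w ^+ z) X = X.
Proof.
move=> prim; rewrite -scaler_sumr exchange_big /=.
have n_gt0 := prim_order_gt0 prim.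
rewrite (bigD1 (Ordinal n_gt0)) //= [X in _ + X]big1 => [|i i0].
  rewrite addr0 expr0 invr1 (eq_bigr (fun=> X)) => [|z _].
    by rewrite sumr_const card_ord -scaler_nat scalerA mulVf // scale1r.
  by rewrite expr0 scale1r !mulmxE mul1r mulr1.
rewrite -scaler_suml (eq_bigr (fun z : 'I_n => (w ^+ i) ^+ z)) => [|z _]; last first.
  by rewrite -!exprM mulnC.
rewrite sum_unity_root; last by rewrite -exprM mulnC exprM (prim_expr_order prim) expr1n.
rewrite -(prim_order_dvd prim) gtnNdvd ?mulr0 ?scale0r //.
by rewrite lt0n; apply: contra i0 => /eqP i0; apply/eqP/val_inj.
Qed.

(** The factors nu^i and nu^-i from moving D past C^i and C^-i cancel in each summand, so the
    projection for C respects eigenvectors of D. *)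
Lemma eigproj_comm C D w X mu nu : C \is a GRing.unit -> nu != 0 ->
  D *m C = nu *: (C *m D) -> D *m X = mu *: (X *m D) ->
  D *m eigproj C w X = mu *: (eigproj C w X *m D).
Proof.
move=> uC nu0 DC DX.
rewrite !mulmxE in DC DX *.
have DCi i : D * C ^+ i = nu ^+ i *: (C ^+ i * D).
  elim: i => [|i IH]; first by rewrite !expr0 scale1r mulr1 mul1r.
  by rewrite !exprS (mulrA D) DC -scalerAl -(mulrA C D) IH -scalerAr scalerA (mulrA C).
have DCVi i : D * C ^- i = (nu ^+ i)^-1 *: (C ^- i * D).
  have uCi := unitrX i uC.
  apply: (scalerI (expf_neq0 i nu0)); rewrite scalerA mulfV ?expf_neq0 // scale1r.
  by apply: (mulrI uCi); rewrite mulVKr // -scalerAr mulrA scalerAl -DCi mulrK.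
rewrite /eigproj -scalerAr -scalerAl scalerA mulrC -scalerA; congr (_ *: _).
rewrite mulr_suml mulr_sumr scaler_sumr; apply: eq_bigr => i _.
rewrite -scalerAr -scalerAl scalerA mulrC -scalerA; congr (_ *: _); rewrite !mulmxE.
rewrite !mulrA DCi -!scalerAl -(mulrA _ D X) DX -scalerAr -!scalerAl !mulrA -(mulrA _ D) DCVi.
by rewrite -scalerAr !scalerA !mulrA mulrAC mulfV ?expf_neq0 // mul1r.
Qed.

End EigenProjection.

(** * Homogeneous components and the loop algebra *)

Section Loop.
Variables (k : fieldType) (T : torus_field k) (N n : nat) (theta : k) (A B : 'M[k]_N.+1).
Hypotheses (char_k : [pchar k] =i pred0) (AB : twisted_pair n theta A B).
Local Notation iota := (tf_const T).
Local Notation mono := (@mono k T).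
Local Notation homog := (homog theta A B).
Implicit Types X : 'M[k]_N.+1.

Let n0 : n%:R != 0 :> k.
Proof. by have /pcharf0P -> := char_k; rewrite -lt0n (tp_gt0 AB). Qed.
Let th0 := theta_neq0 AB.
Let uA := unitA AB.
Let uB := unitB AB.

(** The weights theta^(-d) and theta^c are the inverses of the eigenvalues in [homog], in accordance
    with [eigproj_eigen]. *)
Definition gproj (c d : int) X := eigproj n A (theta ^ (- d)) (eigproj n B (theta ^ c) X).

Lemma gproj_lin c d a X Y : gproj c d (a *: X + Y) = a *: gproj c d X + gproj c d Y.
Proof. by rewrite /gproj !eigproj_lin. Qed.

Lemma gproj_trace c d X : \tr X = 0 -> \tr (gproj c d X) = 0.
Proof. by move=> trX; rewrite !eigproj_trace. Qed.

Let expzn z : (theta ^ z) ^+ n = 1.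
Proof. by rewrite exprnP exprz_exp mulrC (theta_expzM AB). Qed.

Lemma gproj_homog c d X : homog c d (gproj c d X).
Proof.
split; first by rewrite eigproj_eigen ?(tp_A AB) // invr_expz opprK.
apply: (@eigproj_comm _ _ _ _ _ _ _ _ theta^-1) => //; first by rewrite invr_eq0.
  by rewrite (tp_comm AB) scalerA mulVf // scale1r.
by rewrite eigproj_eigen ?(tp_B AB) // invr_expz.
Qed.

Lemma gproj_of_homog c d c' d' X : homog c d X ->
  gproj c' d' X = ((theta ^ c == theta ^ c') && (theta ^ d == theta ^ d'))%:R *: X.
Proof.
move=> [AX BX]; rewrite /gproj (eigproj_of_eigen n0 _ _ BX) //; last first.
  by rewrite -expfzDr // expzn.
have div1 (u v : k) : v != 0 -> (u / v == 1) = (u == v).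
  by move=> v0; rewrite -(inj_eq (mulIf v0)) divfK // mul1r.
rewrite -[theta ^ (- c)]invr_expz div1 ?expfz_neq0 // [_ == theta ^ c]eq_sym; case: eqP => _ /=; rewrite ?scale1r.
  rewrite (eigproj_of_eigen n0 _ _ AX) //; last by rewrite -expfzDr // expzn.
  by rewrite mulrC -[theta ^ (- d')]invr_expz div1 ?expfz_neq0.
have AX0 : A *m (0%:R *: X) = 1 *: (0%:R *: X *m A) by rewrite !scale0r mul0mx mulmx0 scaler0.
by rewrite (eigproj_of_eigen n0 _ _ AX0) ?mulr1 ?expzn // !scale0r scaler0.
Qed.

Lemma gproj_sum X : \sum_(c < n) \sum_(d < n) gproj c d X = X.
Proof.
have primV : n.-primitive_root theta^-1.
  have -> : theta^-1 = theta ^+ n.-1.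
    apply: (mulfI th0); rewrite mulfV // -exprS prednK ?(tp_gt0 AB) //.
    by rewrite (prim_expr_order (tp_prim AB)).
  by rewrite prim_root_exp_coprime ?(tp_prim AB) // coprimePn // (tp_gt0 AB).
rewrite -[RHS](eigproj_sum n0 B X (tp_prim AB)); apply: eq_bigr => c _.
rewrite -[RHS](eigproj_sum n0 A _ primV); apply: eq_bigr => d _.
by rewrite /gproj exprnP exprz_inv.
Qed.

Lemma homog_ind (P : 'M[k]_N.+1 -> Prop) :
  P 0 -> (forall X Y, P X -> P Y -> P (X + Y)) ->
  (forall c d X, homog c d X -> \tr X = 0 -> P X) -> forall X, \tr X = 0 -> P X.
Proof.
move=> P0 PD Ph X trX; rewrite -[X]gproj_sum.
apply: big_ind => // c _; apply: big_ind => // d _.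
by apply: Ph (gproj_homog c d X) _; apply: gproj_trace.
Qed.

Variable m : nat.

Definition loop (Y : 'M[T]_N.+1) := exists r : seq ('M[k]_N.+1 * (int * int)),
  (forall q, q \in r -> homog q.2.1 q.2.2 q.1 /\ \tr q.1 = 0) /\
  Y = \sum_(q <- r) mono (m%:Z * q.2.1) (m%:Z * q.2.2) *: map_mx iota q.1.

Lemma loop_ind (P : 'M[T]_N.+1 -> Prop) :
  P 0 -> (forall c d X Y, homog c d X -> \tr X = 0 -> P Y ->
     P (mono (m%:Z * c) (m%:Z * d) *: map_mx iota X + Y)) ->
  forall Y, loop Y -> P Y.
Proof.
move=> P0 Pc Y [r [hr ->]]; elim: r hr => [|q r IH] hr; first by rewrite big_nil.
rewrite big_cons; have [hq trq] := hr q (mem_head _ _); apply: Pc => //.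
by apply: IH => q' qr; apply: hr; rewrite inE qr orbT.
Qed.

Lemma loop0 : loop 0.
Proof. by exists [::]; rewrite big_nil. Qed.

Lemma loopD Y Z : loop Y -> loop Z -> loop (Y + Z).
Proof.
move=> [r [hr ->]] [r' [hr' ->]]; exists (r ++ r'); rewrite big_cat; split=> // q.
by rewrite mem_cat => /orP[/hr | /hr'].
Qed.

Lemma loop_mono c d X : homog c d X -> \tr X = 0 ->
  loop (mono (m%:Z * c) (m%:Z * d) *: map_mx iota X).
Proof.
move=> hX trX; exists [:: (X, (c, d))]; rewrite big_seq1; split=> // q.
by rewrite inE => /eqP ->.
Qed.

Lemma loopZ a Y : loop Y -> loop (iota a *: Y).
Proof.
elim/loop_ind => [|c d X Z hX trX IH]; first by rewrite scaler0; apply: loop0.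
rewrite scalerDr; apply: loopD => //; rewrite scalerA mulrC -scalerA -map_mxZ.
apply: loop_mono; first by rewrite -[_ *: X]addr0; apply: homog_lin => //; apply: homog0.
by rewrite mxtraceZ trX mulr0.
Qed.

(** The degree moves by a multiple of n, which the grading does not see. These multiplications are
    the centroid elements used later. *)
Lemma loop_shift i j Y : loop Y ->
  loop (mono (m%:Z * (n%:Z * i)) (m%:Z * (n%:Z * j)) *: Y).
Proof.
elim/loop_ind => [|c d X Z hX trX IH]; first by rewrite scaler0; apply: loop0.
rewrite scalerDr; apply: loopD => //; rewrite scalerA -monoD -!mulrDr.
apply: loop_mono => //; apply: homog_congr hX; by rewrite expfzDr // (theta_expzM AB) mul1r.
Qed.

Lemma loop_laurent Y i j : loop Y -> laurent iota (tf_s T) (tf_t T) (Y i j).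
Proof.
move=> [r [_ ->]]; exists [seq (q.1 i j, (m%:Z * q.2.1, m%:Z * q.2.2)) | q : 'M[k]_N.+1 * (int * int) <- r].
by rewrite big_map summxE; apply: eq_bigr => q _; rewrite !mxE mulrC.
Qed.

Lemma loop_trace Y : loop Y -> \tr Y = 0.
Proof.
elim/loop_ind => [|c d X Z hX trX IH]; first exact: mxtrace0.
by rewrite linearD linearZ /= IH trace_map_mx trX rmorph0 mulr0 addr0.
Qed.

(** Independence of monomials singles out the terms with exponent (x, y). They add up to X, so there
    is at least one, and for m > 0 the exponent determines their degree. *)
Lemma loop_monomial x y X : (0 < m)%N -> X != 0 -> loop (mono x y *: map_mx iota X) ->
  exists c d, [/\ x = m%:Z * c, y = m%:Z * d & homog c d X].
Proof.
move=> m_gt0 X0 [r [hr Hr]].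
pose sel (q : 'M[k]_N.+1 * (int * int)) := (m%:Z * q.2.1, m%:Z * q.2.2) == (x, y).
have XE : X = \sum_(q <- r | sel q) q.1.
  apply/matrixP => i j; rewrite summxE.
  pose r' := (- X i j, (x, y)) :: [seq (q.1 i j, (m%:Z * q.2.1, m%:Z * q.2.2)) | q : 'M[k]_N.+1 * (int * int) <- r].
  have : \sum_(q <- r') iota q.1 * mono q.2.1 q.2.2 = 0.
    rewrite /r' big_cons big_map /= rmorphN mulNr addrC; apply/eqP; rewrite subr_eq0; apply/eqP.
    move/matrixP/(_ i j): Hr; rewrite !mxE mulrC summxE => ->; apply: eq_bigr => q _.
    by rewrite !mxE mulrC.
  move=> H; have := @mono_coef k T char_k (x, y) _ H; rewrite /r' big_cons big_map /= eqxx => /eqP.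
  by rewrite addrC subr_eq0 => /eqP <-.
have [q qr qsel] : exists2 q, q \in r & sel q.
  apply/hasP; apply: contraNT X0 => /hasPn nsel; rewrite XE big_seq_cond big1 //.
  by move=> q /andP[/nsel /negPf ->].
case: q qr qsel => [X' [c d]] qr /eqP[xE yE]; exists c, d; split=> //.
rewrite XE big_seq_cond; apply: big_ind => [|Y Z hY hZ|q /andP[/hr [hq _] /eqP[]]].
- exact: homog0.
- by rewrite -[Y]scale1r; apply: homog_lin.
have m0 : m%:Z != 0 by rewrite -lt0n.
by rewrite -xE -yE => /(mulfI m0) <- /(mulfI m0) <-.
Qed.

End Loop.

(** * Intertwiners under substitutions *)

Section Intertwiner.
Variables (k : fieldType) (T : torus_field k) (N : nat).
Hypothesis char_k : [pchar k] =i pred0.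
Local Notation iota := (tf_const T).
Local Notation "X ^i" := (map_mx iota X) (at level 2, format "X ^i").

Lemma comm_traceless_scalar (F : fieldType) (W : 'M[F]_N.+1) :
  (forall Z, \tr Z = 0 -> W *m Z = Z *m W) -> exists c, W = c%:M.
Proof.
move=> comW; exists (W 0 0).
have tr_delta (a b : 'I_N.+1) : a != b -> \tr (delta_mx a b : 'M[F]_N.+1) = 0.
  move=> ab; rewrite /mxtrace big1 // => l _; rewrite mxE.
  by case: eqP => //= ->; rewrite (negPf ab).
have E (i j a b : 'I_N.+1) : i != j -> W a i * (b == j)%:R = (a == i)%:R * W j b.
  move=> ij; have := congr1 (fun M : 'M_N.+1 => M a b) (comW _ (tr_delta _ _ ij)).
  rewrite !mxE (bigD1 i) //= big1 => [|l li]; last by rewrite mxE (negPf li) mulr0.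
  rewrite (bigD1 j) //= [X in _ = _ + X]big1 => [|l lj]; last by rewrite mxE (negPf lj) andbF mul0r.
  by rewrite !mxE !eqxx !addr0 andbT.
apply/matrixP => a b; rewrite !mxE; case: (eqVneq a b) => [<- | ab].
  rewrite mulr1n; case: (eqVneq a 0) => [-> // | a0].
  by have := E a 0 a 0 a0; rewrite !eqxx mulr1 mul1r.
by have := E b a a a; rewrite eq_sym eqxx (negPf ab) mul0r mulr1 mulr0n => ->.
Qed.

Lemma twist_const_mx a b p q (X : 'M[k]_(p, q)) : a != 0 -> b != 0 ->
  map_mx (tf_twist T a b) X^i = X^i.
Proof. by move=> a0 b0; apply/matrixP => i j; rewrite !mxE tf_twist_const. Qed.

Section OneTwist.
Variables (Psi : 'M[k]_N.+1 -> 'M[T]_N.+1) (C : 'M[T]_N.+1).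
Hypothesis uC : C \in unitmx.
Hypothesis PsiC : forall X, \tr X = 0 -> Psi X *m C = C *m X^i.
Variables (a b : k) (R D : 'M[k]_N.+1).
Hypotheses (a0 : a != 0) (b0 : b != 0) (uR : R \in unitmx) (uD : D \in unitmx).
Local Notation g := (map_mx (tf_twist T a b)).
Hypothesis Psi_twist : forall X, \tr X = 0 ->
  R^i *m g (Psi X) = Psi (D *m X *m invmx D) *m R^i.

(** Passing the equivariance of [Psi] through C shows that C^-1 R g(C) D^-1 commutes with every
    constant traceless matrix, because g fixes constants; hence it is scalar. *)
Lemma intertwiner_scalar : exists c, R^i *m g C = c *: (C *m D^i).
Proof.
have trD X : \tr X = 0 -> \tr (D *m X *m invmx D) = 0.
  by move=> trX; rewrite mxtrace_mulC mulmxA mulVmx // mul1mx.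
have H X : \tr X = 0 -> (invmx C *m R^i *m g C *m invmx D^i) *m X^i =
    X^i *m (invmx C *m R^i *m g C *m invmx D^i).
  move=> trX; pose Y := invmx D *m X *m D.
  have trY : \tr Y = 0 by rewrite mxtrace_mulC mulmxA mulmxV // mul1mx.
  have DYD : D *m Y *m invmx D = X by rewrite /Y !mulmxA mulmxV // mul1mx mulmxK.
  have DX : invmx D^i *m X^i = Y^i *m invmx D^i.
    by rewrite -map_invmx -!map_mxM /Y mulmxK.
  rewrite -(mulmxA _ _ X^i) DX mulmxA -(mulmxA _ (g C)).
  have -> : g C *m Y^i = g (Psi Y) *m g C by rewrite -map_mxM PsiC // map_mxM twist_const_mx.
  rewrite mulmxA -(mulmxA _ R^i) Psi_twist // DYD !mulmxA; congr (_ *m _ *m _ *m _).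
  have := PsiC trX; move/(congr1 (mulmx (invmx C))); rewrite (mulmxA _ C) mulVmx // mul1mx.
  by move/(congr1 (mulmx^~ (invmx C))); rewrite -!mulmxA mulmxV // mulmx1.
set W := invmx C *m R^i *m g C *m invmx D^i in H.
have comW Z : \tr Z = 0 -> W *m Z = Z *m W.
  move: Z; apply: traceless_ind => [x X Y HX HY | | i j ij | i].
  - by rewrite mulmxDr mulmxDl -scalemxAr -scalemxAl HX HY.
  - by rewrite mulmx0 mul0mx.
  - have := H (delta_mx i j); rewrite map_delta_mx; apply.
    by rewrite /mxtrace big1 // => l _; rewrite mxE; case: eqP => //= ->; rewrite (negPf ij).
  have := H (delta_mx i i - delta_mx 0 0); rewrite map_mxB !map_delta_mx; apply.
  have := mxbr_trace (delta_mx i 0 : 'M[k]_N.+1) (delta_mx 0 i).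
  by rewrite mxbr_delta !eqxx.
have [c Hc] := comm_traceless_scalar comW.
exists c; have uDi : D^i \in unitmx by rewrite map_unitmx.
move/(congr1 (mulmx C)): Hc; rewrite /W !mulmxA mulmxV // mul1mx.
move/(congr1 (mulmx^~ D^i)); rewrite -mulmxA mulVmx // mulmx1 => ->.
by rewrite mul_mx_scalar -scalemxAl.
Qed.

(** In the determinants, R and D contribute degree 0 and g preserves the degree of det C, so the
    degree of c times the size of the matrices is 0. *)
Lemma intertwiner_degree c : R^i *m g C = c *: (C *m D^i) ->
  [/\ c != 0, tf_ds c = 0 & tf_dt c = 0].
Proof.
move/(congr1 determinant); rewrite det_mulmx det_map_mx /= detZ det_mulmx !det_map_mx => E.
have R0 : \det R != 0 by rewrite -unitfE.
have D0 : \det D != 0 by rewrite -unitfE.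
have C0 : \det C != 0 by rewrite -unitfE.
have iR : iota (\det R) != 0 by rewrite fmorph_eq0.
have iD : iota (\det D) != 0 by rewrite fmorph_eq0.
have gC : tf_twist T a b (\det C) != 0 by rewrite fmorph_eq0.
have c0 : c != 0.
  apply: contraTneq isT => c0; move/eqP: E.
  by rewrite c0 expr0n /= mul0r mulf_eq0 (negPf iR) (negPf gC).
have degX (deg : T -> int) m : (forall x y, x != 0 -> y != 0 -> deg (x * y) = deg x + deg y) ->
    deg (c ^+ m.+1) = deg c *+ m.+1.
  move=> degM; elim: m => [|m IH]; first by rewrite expr1.
  by rewrite exprS degM ?expf_neq0 // IH [RHS]mulrS.
split=> //.
  move/(congr1 (@tf_ds _ T)): E.
  rewrite !tf_dsM ?mulf_neq0 ?expf_neq0 // tf_ds_twist // !tf_ds_const // degX; last exact: tf_dsM.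
  by rewrite add0r addr0 -[LHS]add0r => /addIr /esym/eqP; rewrite mulrn_eq0 => /eqP.
move/(congr1 (@tf_dt _ T)): E.
rewrite !tf_dtM ?mulf_neq0 ?expf_neq0 // tf_dt_twist // !tf_dt_const // degX; last exact: tf_dtM.
by rewrite add0r addr0 -[LHS]add0r => /addIr /esym/eqP; rewrite mulrn_eq0 => /eqP.
Qed.

End OneTwist.

(* The leading coefficient is invariant under the twists on elements of degree 0,
   so the cocycle condition for the two commuting twists compares u and v. *)
Lemma twisted_intertwiner (Psi : 'M[k]_N.+1 -> 'M[T]_N.+1) (C : 'M[T]_N.+1)
    (a b a' b' u v : k) (R S D D' : 'M[k]_N.+1) :
  C \in unitmx -> (forall X, \tr X = 0 -> Psi X *m C = C *m X^i) ->
  a != 0 -> b != 0 -> a' != 0 -> b' != 0 ->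
  R \in unitmx -> S \in unitmx -> D \in unitmx -> D' \in unitmx ->
  (forall X, \tr X = 0 -> R^i *m map_mx (tf_twist T a b) (Psi X) =
     Psi (D *m X *m invmx D) *m R^i) ->
  (forall X, \tr X = 0 -> S^i *m map_mx (tf_twist T a' b') (Psi X) =
     Psi (D' *m X *m invmx D') *m S^i) ->
  R *m S = u *: (S *m R) -> D *m D' = v *: (D' *m D) -> u = v.
Proof.
move=> uC PsiC a0 b0 a'0 b'0 uR uS uD uD' tw tw' RS DD'.
have [c Hc] := intertwiner_scalar uC PsiC a0 b0 uD tw.
have [c' Hc'] := intertwiner_scalar uC PsiC a'0 b'0 uD' tw'.
have [c0 dsc dtc] := intertwiner_degree uC a0 b0 uR uD Hc.
have [c'0 dsc' dtc'] := intertwiner_degree uC a'0 b'0 uS uD' Hc'.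
set g := map_mx (tf_twist T a b) in Hc *; set g' := map_mx (tf_twist T a' b') in Hc' *.
pose ga := tf_twist T a b; pose ga' := tf_twist T a' b'.
have gg' X : g (g' X) = g' (g X) by apply/matrixP => i j; rewrite !mxE tf_twistC.
have E : S^i *m R^i *m g' (g C) = (ga' c * c') *: (C *m (D' *m D)^i).
  have -> : S^i *m R^i *m g' (g C) = S^i *m g' (R^i *m g C).
    by rewrite /g' map_mxM twist_const_mx // mulmxA.
  rewrite Hc /g' map_mxZ map_mxM twist_const_mx // -scalemxAr mulmxA Hc'.
  by rewrite -scalemxAl scalerA -mulmxA -map_mxM.
have E' : R^i *m S^i *m g' (g C) = (ga c' * c) *: (C *m (D *m D')^i).
  have -> : R^i *m S^i *m g' (g C) = R^i *m g (S^i *m g' C).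
    by rewrite -gg' /g map_mxM twist_const_mx // mulmxA.
  rewrite Hc' /g map_mxZ map_mxM twist_const_mx // -scalemxAr mulmxA Hc.
  by rewrite -scalemxAl scalerA -mulmxA -map_mxM.
have {E'} : iota u *: (S^i *m R^i *m g' (g C)) =
    (iota v * (ga c' * c)) *: (C *m (D' *m D)^i).
  rewrite scalemxAl -map_mxM -map_mxZ -RS map_mxM E' DD' map_mxZ -scalemxAr scalerA.
  by rewrite [_ * iota v]mulrC.
rewrite E scalerA => /eqP; rewrite -subr_eq0 -scalerBl scaler_eq0 => /orP[]; last first.
  move=> /eqP CD; have : \det (C *m (D' *m D)^i) = 0 by rewrite CD det0.
  rewrite det_mulmx det_map_mx det_mulmx => /eqP; rewrite mulf_eq0 fmorph_eq0 mulf_eq0.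
  by move: uC uD uD'; rewrite !unitmxE !unitfE => /negPf -> /negPf -> /negPf ->.
rewrite subr_eq0 => /eqP /(congr1 (@tf_lc _ T)); rewrite !tf_lcM !tf_lc_const !tf_lc_twist //.
rewrite dsc dtc dsc' dtc' !expr0z !mul1r mulrC [RHS]mulrC [tf_lc c' * _]mulrC.
by apply: mulfI; rewrite mulf_neq0 ?tf_lc_neq0.
Qed.

End Intertwiner.

Section LoopMore.
Variables (k : fieldType) (T : torus_field k) (N n : nat) (theta : k) (A B : 'M[k]_N.+1).
Hypotheses (char_k : [pchar k] =i pred0) (AB : twisted_pair n theta A B).
Variable m : nat.
Local Notation iota := (tf_const T).
Local Notation "X ^i" := (map_mx iota X) (at level 2, format "X ^i").
Local Notation loop := (@loop k T N theta A B m).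
Local Notation mono := (@mono k T).
Local Notation homog := (homog theta A B).

(** Monomials are invertible in the field, so each homogeneous constant matrix is a multiple of an
    element of the loop algebra. *)
Lemma loop_span (P : 'M[T]_N.+1 -> Prop) : P 0 ->
  (forall e Y Z, loop Y -> P Z -> P (e *: Y + Z)) -> forall Z, \tr Z = 0 -> P Z.
Proof.
(* [P] is only known to absorb multiples of loop elements; [Q W], saying that it absorbs multiples
   of W, is linear in W and hence fit for induction. *)
move=> P0 Pl; pose Q W := forall a Z, P Z -> P (a *: W + Z).
have Qlin b X Y : Q X -> Q Y -> Q (b *: X + Y).
  by move=> QX QY a Z PZ; rewrite scalerDr scalerA -addrA; apply/QX/QY.
have Q0 : Q 0 by move=> a Z; rewrite scaler0 add0r.
suff QT W : \tr W = 0 -> Q W.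
  by move=> Z trZ; rewrite -[Z]addr0 -[Z]scale1r; apply: QT.
have Qk X : \tr X = 0 -> Q X^i.
  move: X; apply: (homog_ind char_k AB (P := fun X => Q X^i)) => [|Y Z QY QZ|c d Y hY trY a Z PZ].
  - by rewrite map_mx0.
  - by rewrite map_mxD -[Y^i]scale1r; apply: Qlin.
  have -> : a *: Y^i = (a / mono (m%:Z * c) (m%:Z * d)) *: (mono (m%:Z * c) (m%:Z * d) *: Y^i).
    by rewrite scalerA divfK // mono_neq0.
  by apply: Pl => //; apply: loop_mono.
move: W; apply: traceless_ind => // [i j ij | i].
  rewrite -(map_delta_mx iota); apply: Qk.
  by rewrite /mxtrace big1 // => l _; rewrite mxE; case: eqP => //= ->; rewrite (negPf ij).
rewrite -[delta_mx i i](map_delta_mx iota) -[delta_mx 0 0](map_delta_mx iota) -map_mxB.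
apply: Qk; have := mxbr_trace (delta_mx i 0 : 'M[k]_N.+1) (delta_mx 0 i).
by rewrite mxbr_delta !eqxx.
Qed.

Lemma homog_powA i c d X : homog c d X -> A ^+ i *m X = theta ^ (d * i%:Z) *: (X *m A ^+ i).
Proof.
move=> [AX _]; rewrite !mulmxE in AX *; elim: i => [|i IH].
  by rewrite !expr0 mulr0 expr0z scale1r mul1r mulr1.
rewrite !exprSr -(mulrA _ A X) AX -scalerAr (mulrA (A ^+ i)) IH -scalerAl scalerA mulrA.
by rewrite intS mulrDr mulr1 expfzDr ?(theta_neq0 AB).
Qed.

Lemma homog_powB i c d X : homog c d X -> B ^+ i *m X = theta ^ (- c * i%:Z) *: (X *m B ^+ i).
Proof.
move=> [_ BX]; rewrite !mulmxE in BX *; elim: i => [|i IH].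
  by rewrite !expr0 mulr0 expr0z scale1r mul1r mulr1.
rewrite !exprSr -(mulrA _ B X) BX -scalerAr (mulrA (B ^+ i)) IH -scalerAl scalerA mulrA.
by rewrite intS mulrDr mulr1 expfzDr ?(theta_neq0 AB).
Qed.

(** On the term of degree (c, d) the substitution s -> eta s gives eta^(m c) = theta^(q c), the
    inverse of the factor theta^(-c q) from conjugation by B^q. For A the eigenvalue has the
    opposite sign in the exponent, whence t -> t / eta in the companion lemma. *)
Lemma loop_twistB eta q Y : eta != 0 -> eta ^+ m = theta ^+ q -> loop Y ->
  (B ^+ q)^i *m map_mx (tf_twist T eta 1) Y = Y *m (B ^+ q)^i.
Proof.
move=> eta0 etaq; elim/loop_ind => [|c d X Z hX trX IH].
  by rewrite map_mx0 mulmx0 mul0mx.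
rewrite map_mxD mulmxDr mulmxDl IH; congr (_ + _).
rewrite map_mxZ /= twist_mono ?oner_neq0 // twist_const_mx ?oner_neq0 // -scalemxAr -map_mxM.
rewrite (homog_powB q hX) map_mxZ map_mxM scalerA -scalemxAl; congr (_ *: _).
rewrite mulrAC -rmorphM exp1rz mulr1 -exprz_exp -exprnP etaq exprnP exprz_exp.
by rewrite -expfzDr ?(theta_neq0 AB) // mulNr [c * _]mulrC subrr expr0z rmorph1 mul1r.
Qed.

Lemma loop_twistA eta q Y : eta != 0 -> eta ^+ m = theta ^+ q -> loop Y ->
  (A ^+ q)^i *m map_mx (tf_twist T 1 eta^-1) Y = Y *m (A ^+ q)^i.
Proof.
move=> eta0 etaq; have etaV0 : eta^-1 != 0 by rewrite invr_eq0.
elim/loop_ind => [|c d X Z hX trX IH]; first by rewrite map_mx0 mulmx0 mul0mx.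
rewrite map_mxD mulmxDr mulmxDl IH; congr (_ + _).
rewrite map_mxZ /= twist_mono ?oner_neq0 // twist_const_mx ?oner_neq0 // -scalemxAr -map_mxM.
rewrite (homog_powA q hX) map_mxZ map_mxM scalerA -scalemxAl; congr (_ *: _).
rewrite mulrAC -rmorphM exp1rz mul1r exprz_inv -mulrN -(exprz_exp eta).
rewrite -[eta ^ m%:Z]exprnP etaq [theta ^+ q]exprnP exprz_exp.
by rewrite -expfzDr ?(theta_neq0 AB) // mulrN [d * _]mulrC addNr expr0z rmorph1 mul1r.
Qed.

Lemma homog_nonzero : (0 < N)%N ->
  exists c d X, [/\ homog c d X, \tr X = 0 & X != 0].
Proof.
move=> N_gt0; apply: contrapT => nex; pose j : 'I_N.+1 := inord 1.
have j0 : 0 != j by rewrite eq_sym -val_eqE /= inordK.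
have : delta_mx 0 j = 0 :> 'M[k]_N.+1.
  apply: (homog_ind char_k AB (P := fun X => X = 0)) => // [X Y -> -> | c d X hX trX |].
  - by rewrite addr0.
  - by apply/eqP/negPn/negP => X0; apply: nex; exists c, d, X.
  by rewrite /mxtrace big1 // => l _; rewrite mxE; case: eqP => //= ->; rewrite (negPf j0).
by move/matrixP/(_ 0 j); rewrite !mxE !eqxx => /eqP; rewrite oner_eq0.
Qed.

End LoopMore.

(** An isomorphism of L onto a loop algebra, as a predicate on [rho]; the comparison of two Lie
    algebras sees nothing else of them. *)
Record loop_rep (k : fieldType) (L : lieAlgType k) (T : torus_field k) (N : nat) (theta : k)
    (A B : 'M[k]_N.+1) (m : nat) (rho : L -> 'M[T]_N.+1) : Prop := LoopRep {
  lr_lin : forall a x y, rho (a *: x + y) = tf_const T a *: rho x + rho y;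
  lr_lie : forall x y, rho (lie x y) = mxbr (rho x) (rho y);
  lr_inj : injective rho;
  lr_loop : forall x, loop theta A B m (rho x);
  lr_surj : forall Y, loop theta A B m Y -> exists x, rho x = Y
}.

(** * The centroid of a twisted loop algebra *)

Section LoopRepTheory.
Variables (k : fieldType) (L : lieAlgType k) (T : torus_field k) (N n : nat) (theta : k).
Variables (A B : 'M[k]_N.+1) (m : nat) (rho : L -> 'M[T]_N.+1).
Hypotheses (char_k : [pchar k] =i pred0) (AB : twisted_pair n theta A B).
Hypothesis rep : loop_rep theta A B m rho.
Local Notation iota := (tf_const T).
Local Notation mono := (@mono k T).
Local Notation loop := (@loop k T N theta A B m).

Lemma lr0 : rho 0 = 0.
Proof.
have /eqP := lr_lin rep 1 0 0; rewrite scale1r addr0 rmorph1 scale1r.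
by rewrite -subr_eq0 opprD addNKr oppr_eq0 => /eqP.
Qed.

Lemma lrD x y : rho (x + y) = rho x + rho y.
Proof. by rewrite -[x]scale1r (lr_lin rep) rmorph1 !scale1r. Qed.

Lemma lrZ a x : rho (a *: x) = iota a *: rho x.
Proof. by rewrite -[_ *: x]addr0 (lr_lin rep) lr0 addr0. Qed.

Lemma lr_eq0 x : rho x = 0 -> x = 0.
Proof. by move=> E; apply: (lr_inj rep); rewrite lr0. Qed.

Lemma lr_trace x : \tr (rho x) = 0.
Proof. exact: loop_trace (lr_loop rep x). Qed.

Lemma lr_span (P : 'M[T]_N.+1 -> Prop) : P 0 ->
  (forall e x Z, P Z -> P (e *: rho x + Z)) -> forall Z, \tr Z = 0 -> P Z.
Proof.
move=> P0 Pl; apply: (loop_span char_k AB (m := m)) => // e Y Z /(lr_surj rep)[x <-].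
exact: Pl.
Qed.

Hypothesis N_gt0 : (0 < N)%N.

Let charT j : (j%:R == 0 :> T) = (j == 0%N).
Proof. by have /pcharf0P <- := char_k; rewrite -(rmorph_nat iota) fmorph_eq0. Qed.

Lemma traceless_center (W : 'M[T]_N.+1) : \tr W = 0 ->
  (forall x, mxbr W (rho x) = 0) -> W = 0.
Proof.
move=> trW Wx; have [c Wc] : exists c, W = c%:M.
  apply: comm_traceless_scalar; apply: lr_span => [|e x Z IH].
    by rewrite mulmx0 mul0mx.
  rewrite mulmxDr mulmxDl IH -scalemxAr -scalemxAl; congr (_ *: _ + _).
  by apply/eqP; rewrite -subr_eq0; apply/eqP/Wx.
move/eqP: trW; rewrite Wc mxtrace_scalar -mulr_natr mulf_eq0 charT orbF => /eqP ->.
by rewrite raddf0.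
Qed.

(** The extension of [chi] to combinations over k(s, t) is the relation [G]. It is single-valued
    because sl has trivial center, and [traceless_schur] then makes it a scalar. *)
Lemma centroid_scalar (chi : L -> L) :
  (forall x, chi (- x) = - chi x) -> (forall x y, chi (lie x y) = lie (chi x) y) ->
  exists c, forall x, rho (chi x) = c *: rho x.
Proof.
move=> chiN chi_lie.
have lieC (x y : L) : lie x y = - lie y x.
  apply: (lr_inj rep); rewrite -scaleN1r lrZ rmorphN rmorph1 scaleN1r !(lr_lie rep).
  by rewrite mxbrC.
have chi_lier (x y : L) : chi (lie x y) = lie x (chi y).
  by rewrite lieC chiN chi_lie -lieC.
pose G X X' := exists r : seq (T * L),
  X = \sum_(q <- r) q.1 *: rho q.2 /\ X' = \sum_(q <- r) q.1 *: rho (chi q.2).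
have Gx x : G (rho x) (rho (chi x)).
  by exists [:: (1, x)]; rewrite !big_seq1 !scale1r.
have Glin a X X' Y Y' : G X X' -> G Y Y' -> G (a *: X + Y) (a *: X' + Y').
  move=> [r [-> ->]] [r' [-> ->]]; exists ([seq (a * q.1, q.2) | q <- r] ++ r').
  rewrite !big_cat !big_map !scaler_sumr.
  by split; congr (_ + _); apply: eq_bigr => q _; rewrite scalerA.
have G00 : G 0 0 by exists [::]; rewrite !big_nil.
have mxbr_suml (r : seq (T * L)) (f : L -> 'M[T]_N.+1) Y :
    mxbr (\sum_(q <- r) q.1 *: f q.2) Y = \sum_(q <- r) q.1 *: mxbr (f q.2) Y.
  elim: r => [|q r IH]; first by rewrite !big_nil /mxbr mul0mx mulmx0 subrr.
  by rewrite !big_cons mxbr_linl IH.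
have mxbr2_suml (r : seq (T * L)) (f : L -> 'M[T]_N.+1) Y Z :
    mxbr (mxbr (\sum_(q <- r) q.1 *: f q.2) Y) Z = \sum_(q <- r) q.1 *: mxbr (mxbr (f q.2) Y) Z.
  rewrite mxbr_suml; elim: r => [|q r IH]; first by rewrite !big_nil /mxbr mul0mx mulmx0 subrr.
  by rewrite !big_cons mxbr_linl IH.
have Gtr X X' : G X X' -> \tr X' = 0.
  move=> [r [_ ->]]; rewrite raddf_sum big1 //= => q _.
  by rewrite linearZ /= lr_trace mulr0.
have [|||||c Hc] := @traceless_schur T N G 0 (inord 1) _ _ Glin.
- by apply/pcharf0P.
- by rewrite eq_sym -val_eqE /= inordK.
- move=> X' GX'; have [r [r0 X'E]] := GX'.
  (* In a double bracket [chi] can be moved from the first argument to the last, where it acts on a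
     combination equal to 0. *)
  have Htriple y z : mxbr (mxbr X' (rho y)) (rho z) = 0.
    have -> : mxbr (mxbr X' (rho y)) (rho z) = mxbr (mxbr 0 (rho y)) (rho (chi z)).
      rewrite r0 X'E (mxbr2_suml r (rho \o chi)) (mxbr2_suml r rho) /=.
      apply: eq_bigr => q _; rewrite -!(lr_lie rep); congr (_ *: rho _).
      by rewrite -!chi_lie chi_lier.
    by rewrite /mxbr !mul0mx !mulmx0 !subr0 mul0mx mulmx0 subrr.
  apply: traceless_center; first exact: Gtr GX'.
  by move=> y; apply: traceless_center => //; apply: mxbr_trace.
- move=> X X' Y GX trY; move: Y trY X X' GX; apply: lr_span => [X X' _ | e y Z IH X X' GX].
    by rewrite /mxbr !mul0mx !mulmx0 !subrr.
  rewrite !mxbr_linr; apply: Glin (IH _ _ GX); have [r [-> ->]] := GX.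
  exists [seq (q.1, lie q.2 y) | q <- r]; rewrite !big_map (mxbr_suml r rho) (mxbr_suml r (rho \o chi)) /=.
  by split; apply: eq_bigr => q _; rewrite ?chi_lie (lr_lie rep).
- apply: lr_span => [|e x Z [Z' GZ]]; first by exists 0.
  by exists (e *: rho (chi x) + Z'); apply: Glin.
by exists c => x; apply: Hc (Gx x); apply: lr_trace.
Qed.

End LoopRepTheory.

(** * Comparison of two twisted loop algebras *)

Section Transport.
Variables (k : fieldType) (T : torus_field k) (L1 L2 : lieAlgType k).
Variables (N1 n1 m1 : nat) (theta1 : k) (A1 B1 : 'M[k]_N1.+1) (rho1 : L1 -> 'M[T]_N1.+1).
Variables (N2 n2 m2 : nat) (theta2 : k) (A2 B2 : 'M[k]_N2.+1) (rho2 : L2 -> 'M[T]_N2.+1).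
Hypothesis char_k : [pchar k] =i pred0.
Hypotheses (AB1 : twisted_pair n1 theta1 A1 B1) (rep1 : loop_rep theta1 A1 B1 m1 rho1).
Hypotheses (AB2 : twisted_pair n2 theta2 A2 B2) (rep2 : loop_rep theta2 A2 B2 m2 rho2).
Variable D : nat.
Hypotheses (D1 : (m1 * n1)%N = D) (D2 : (m2 * n2)%N = D) (m2_gt0 : (0 < m2)%N).
Hypothesis N2_gt0 : (0 < N2)%N.
Variables (phi : {linear L1 -> L2}) (phi' : L2 -> L1).
Hypotheses (phi_lie : {morph phi : x y / lie x y}).
Hypotheses (phiK : cancel phi phi') (phiK' : cancel phi' phi).
Local Notation iota := (tf_const T).
Local Notation mono := (@mono k T).

(** With D = m1 n1 = m2 n2, these monomials act on both loop algebras. *)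
Definition cmono i j := mono (D%:Z * i) (D%:Z * j).

Lemma cmonoD i j i' j' : cmono (i + i') (j + j') = cmono i j * cmono i' j'.
Proof. by rewrite /cmono !mulrDr monoD. Qed.

Lemma shift_exists i j x : exists x', rho1 x' = cmono i j *: rho1 x.
Proof.
apply: (lr_surj rep1); have := loop_shift AB1 i j (lr_loop rep1 x).
by rewrite /cmono !mulrA -PoszM D1.
Qed.

(* v is the image under phi of the centroid element s^(D i) t^(D j). *)
Definition transport i j v := forall x x',
  rho1 x' = cmono i j *: rho1 x -> rho2 (phi x') = v *: rho2 (phi x).

(** Multiplication by a centroid monomial, conjugated by [phi], commutes with the brackets of [L2],
    so it is a scalar there. *)
Lemma transport_scalar i j : exists v, transport i j v.
Proof.
pose sh x := sval (cid (shift_exists i j x)).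
have shE x : rho1 (sh x) = cmono i j *: rho1 x by rewrite /sh; case: cid.
have phi'_lie y z : phi' (lie y z) = lie (phi' y) (phi' z).
  by rewrite -{1}[y]phiK' -{1}[z]phiK' -phi_lie phiK.
have phi'N y : phi' (- y) = - phi' y by rewrite -{1}[y]phiK' -raddfN phiK.
pose chi y := phi (sh (phi' y)).
have rN x : rho1 (- x) = - rho1 x by rewrite -scaleN1r (lrZ rep1) rmorphN rmorph1 scaleN1r.
have [||v Hv] := @centroid_scalar _ _ _ _ _ _ _ _ _ _ char_k AB2 rep2 N2_gt0 chi.
- move=> y; rewrite /chi phi'N -raddfN; congr (phi _); apply: (lr_inj rep1).
  by rewrite shE !rN shE scalerN.
- move=> y z; rewrite /chi phi'_lie -{2}[z]phiK' -phi_lie; congr (phi _); apply: (lr_inj rep1).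
  by rewrite shE !(lr_lie rep1) shE /mxbr -scalemxAl -scalemxAr scalerBr.
exists v => x x' E; have -> : x' = sh x by apply: (lr_inj rep1); rewrite E shE.
by have := Hv (phi x); rewrite /chi phiK.
Qed.

(** A test vector: its image is a single nonzero monomial matrix, on which scalars can be compared
    and their exponents read off. *)
Lemma transport_nonzero : exists c d X y, [/\ homog theta2 A2 B2 c d X, X != 0 &
  rho2 (phi y) = mono (m2%:Z * c) (m2%:Z * d) *: map_mx iota X].
Proof.
have [c [d [X [hX trX X0]]]] := homog_nonzero char_k AB2 N2_gt0.
have [y Hy] := lr_surj rep2 (loop_mono T m2 hX trX).
by exists c, d, X, (phi' y); rewrite phiK'.
Qed.

Lemma transport_uniq i j v v' : transport i j v -> transport i j v' -> v = v'.
Proof.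
move=> tv tv'; have [c [d [X [y [hX X0 Hy]]]]] := transport_nonzero.
have [x' Hx'] := shift_exists i j y.
have /eqP := tv _ _ Hx'; rewrite (tv' _ _ Hx') -subr_eq0 -scalerBl scaler_eq0.
rewrite Hy scaler_eq0 (negPf (mono_neq0 _ _ _)) map_mx_eq0 (negPf X0) orbF.
by rewrite orbF subr_eq0 => /eqP ->.
Qed.

Lemma transport_mul i j i' j' v v' :
  transport i j v -> transport i' j' v' -> transport (i + i') (j + j') (v * v').
Proof.
move=> tv tv' x x' E; have [x1 Hx1] := shift_exists i j x.
rewrite (tv' x1 x'); first by rewrite (tv _ _ Hx1) scalerA mulrC.
by rewrite E Hx1 scalerA cmonoD mulrC.
Qed.

Lemma transport_00 : transport 0 0 1.
Proof.
move=> x x'; rewrite /cmono mulr0 mono0 !scale1r => /(lr_inj rep1) -> //.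
Qed.

Lemma transport_opp i j v : transport i j v -> v != 0 /\ transport (- i) (- j) v^-1.
Proof.
move=> tv; have [v' tv'] := transport_scalar (- i) (- j).
have := transport_mul tv tv'; rewrite !subrr => /(transport_uniq transport_00) E.
have v0 : v != 0 by apply: contraTneq isT => v0; move/eqP: E; rewrite v0 mul0r oner_eq0.
by split=> //; rewrite -[v^-1]mulr1 E mulrA mulVf // mul1r.
Qed.

Lemma transport_expz i j v z : transport i j v -> transport (i * z) (j * z) (v ^ z).
Proof.
move=> tv; have pos (m : nat) : transport (i * m%:Z) (j * m%:Z) (v ^+ m).
  elim: m => [|m IH]; first by rewrite !mulr0; apply: transport_00.
  by rewrite intS !mulrDr !mulr1 exprS; apply: transport_mul.
case: z => m; first exact: pos.
by rewrite NegzE !mulrN -exprnN; have [] := transport_opp (pos m.+1).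
Qed.

Lemma laurent_scale v c i j : c != 0 ->
  laurent iota (tf_s T) (tf_t T) (v * (mono i j * iota c)) -> laurent iota (tf_s T) (tf_t T) v.
Proof.
move=> c0 [r Hr]; exists [seq (q.1 / c, (q.2.1 - i, q.2.2 - j)) | q <- r].
have m0 : mono i j * iota c != 0 by rewrite mulf_neq0 ?mono_neq0 // fmorph_eq0.
apply: (mulIf m0); rewrite Hr big_map mulr_suml; apply: eq_bigr => q _ /=.
rewrite -!/(mono _ _) [mono (_ - _) _]monoD -monoV rmorphM fmorphV.
have ic0 : iota c != 0 by rewrite fmorph_eq0.
by field; rewrite mono_neq0 ic0.
Qed.

Lemma transport_laurent i j v : transport i j v -> laurent iota (tf_s T) (tf_t T) v.
Proof.
move=> tv; have [c [d [X [y [hX X0 Hy]]]]] := transport_nonzero.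
have [x' Hx'] := shift_exists i j y.
have /matrix0Pn[a [b Xab]] := X0.
have := loop_laurent a b (lr_loop rep2 (phi x')).
by rewrite (tv _ _ Hx') Hy !mxE; apply: laurent_scale.
Qed.

(** Both v and its inverse are Laurent polynomials, so v is a monomial up to a constant. It keeps
    the test vector inside the second loop algebra without changing its matrix direction, so its
    exponents are m2 times multiples of n2. *)
Lemma transport_mono i j : exists c a b, c != 0 /\ transport i j (iota c * cmono a b).
Proof.
have [v tv] := transport_scalar i j; have [v0 tV] := transport_opp tv.
have [|c [x [y [c0 vE]]]] :=
  tf_laurent_unit (transport_laurent tv) (transport_laurent tV) _; first by rewrite mulfV.
have [e [d [X [z [hX X0 Hz]]]]] := transport_nonzero.
have [z' Hz'] := shift_exists i j z.
have cX0 : c *: X != 0 by rewrite scaler_eq0 negb_or c0.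
have : loop theta2 A2 B2 m2 (mono (x + m2%:Z * e) (y + m2%:Z * d) *: map_mx iota (c *: X)).
  have := lr_loop rep2 (phi z'); rewrite (tv _ _ Hz') Hz vE -/(mono x y) map_mxZ !scalerA.
  by rewrite monoD -mulrA mulrC.
move=> /(loop_monomial char_k m2_gt0 cX0) [e' [d' [xE yE hX']]].
have hcX : homog theta2 A2 B2 e d (c *: X).
  by rewrite -[_ *: X]addr0; apply: homog_lin => //; apply: homog0.
have [te td] := homog_uniq AB2 cX0 hX' hcX.
have th0 := theta_neq0 AB2.
have sub1 u u' : theta2 ^ u = theta2 ^ u' -> theta2 ^ (u - u') = 1.
  by move=> E; rewrite expfzDr // E -invr_expz mulfV ?expfz_neq0.
have [a aE] := theta_expz_eq1 AB2 (sub1 _ _ te).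
have [b bE] := theta_expz_eq1 AB2 (sub1 _ _ td).
exists c, a, b; split=> //; suff <- : v = iota c * cmono a b by [].
rewrite vE /cmono -D2 PoszM -!mulrA -aE -bE !mulrBr -xE -yE.
by rewrite !addrK.
Qed.

End Transport.

Section PowerEigen.
Variables (k : fieldType) (N : nat).
Implicit Types C X : 'M[k]_N.+1.

Lemma exprz_eigen C X mu z : C \is a GRing.unit -> mu != 0 ->
  C *m X = mu *: (X *m C) -> C ^ z *m X = mu ^ z *: (X *m C ^ z).
Proof.
move=> uC mu0; rewrite !mulmxE => CX.
have pos (i : nat) : C ^+ i * X = mu ^+ i *: (X * C ^+ i).
  elim: i => [|i IH]; first by rewrite !expr0 scale1r mul1r mulr1.
  by rewrite !exprSr -(mulrA _ C X) CX -scalerAr (mulrA (C ^+ i)) IH -scalerAl scalerA mulrC mulrA.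
case: z => i; first by rewrite -!exprnP.
rewrite NegzE -!exprnN; have uCi := unitrX i.+1 uC.
apply: (mulrI uCi); rewrite mulVKr // -scalerAr mulrA pos -scalerAl scalerA mulVf ?expf_neq0 //.
by rewrite scale1r mulrK.
Qed.

Variables (n : nat) (theta : k) (A B : 'M[k]_N.+1).
Hypothesis AB : twisted_pair n theta A B.

Lemma homog_monomial i j : homog theta A B i j (A ^ i *m B ^ j).
Proof.
have th0 := theta_neq0 AB; have uA := unitA AB; have uB := unitB AB.
have AA (C : 'M[k]_N.+1) z : C \is a GRing.unit -> C *m C ^ z = 1 *: (C ^ z *m C).
  by move=> uC; rewrite !mulmxE scale1r -{1 4}[C]expr1z -!exprzDr // addrC.
have hA : homog theta A B i 0 (A ^ i).
  split; first by rewrite AA.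
  have := exprz_eigen i uA th0 (tp_comm AB) => ->.
  by rewrite scalerA -expfzDr // addNr scale1r.
have hB : homog theta A B 0 j (B ^ j).
  split; last by rewrite oppr0 AA.
  have BA : B *m A = theta^-1 *: (A *m B) by rewrite (tp_comm AB) scalerA mulVf ?scale1r.
  have thV0 : theta^-1 != 0 by rewrite invr_eq0.
  have := exprz_eigen j uB thV0 BA => ->.
  by rewrite scalerA exprz_inv -expfzDr // subrr scale1r.
by have := homogM AB hA hB; rewrite addr0 add0r.
Qed.

(** Commutation is governed by the alternating form d i - c j on exponents; through it the
    determinant of the substitution enters. *)
Lemma monomial_eigen i j c d X : homog theta A B c d X ->
  (A ^ i *m B ^ j) *m X = theta ^ (d * i - c * j) *: (X *m (A ^ i *m B ^ j)).
Proof.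
have th0 := theta_neq0 AB; move=> [AX BX].
have := exprz_eigen i (unitA AB) (expfz_neq0 d th0) AX.
have := exprz_eigen j (unitB AB) (expfz_neq0 (- c) th0) BX.
rewrite !exprz_exp mulNr => BjX AiX.
rewrite -mulmxA BjX -scalemxAr mulmxA AiX -scalemxAl scalerA -mulmxA -expfzDr //.
by rewrite addrC.
Qed.

End PowerEigen.

(** * Untwisting an isomorphism of loop algebras *)

Section Untwist.
Variables (k : fieldType) (T : torus_field k) (L1 L2 : lieAlgType k).
Variables (N1 n1 m1 : nat) (theta1 : k) (A1 B1 : 'M[k]_N1.+1) (rho1 : L1 -> 'M[T]_N1.+1).
Variables (N2 n2 m2 : nat) (theta2 : k) (A2 B2 : 'M[k]_N2.+1) (rho2 : L2 -> 'M[T]_N2.+1).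
Hypothesis char_k : [pchar k] =i pred0.
Hypotheses (AB1 : twisted_pair n1 theta1 A1 B1) (rep1 : loop_rep theta1 A1 B1 m1 rho1).
Hypotheses (AB2 : twisted_pair n2 theta2 A2 B2) (rep2 : loop_rep theta2 A2 B2 m2 rho2).
Variable D : nat.
Hypotheses (D1 : (m1 * n1)%N = D) (N1_gt0 : (0 < N1)%N) (N2_gt0 : (0 < N2)%N).
Variables (phi : {linear L1 -> L2}) (phi' : L2 -> L1).
Hypotheses (phi_lie : {morph phi : x y / lie x y}).
Hypotheses (phiK : cancel phi phi') (phiK' : cancel phi' phi).
Local Notation iota := (tf_const T).
Local Notation mono := (@mono k T).
Local Notation transport := (transport rho1 rho2 D phi).
Local Notation homog := (homog theta1 A1 B1).
Local Notation "X ^i" := (map_mx iota X) (at level 2, format "X ^i").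
Variables (a b c d : int) (k1 k2 : k).
Hypotheses (k1_neq0 : k1 != 0) (k2_neq0 : k2 != 0).
Hypothesis tr10 : transport 1 0 (iota (k1 ^+ n1) * cmono T D a b).
Hypothesis tr01 : transport 0 1 (iota (k2 ^+ n1) * cmono T D c d).

(* An extension of the transport character from n1 Z x n1 Z to Z x Z, which is where the n1-th
   roots k1 and k2 of the two constants are needed. *)
Definition psi (x y : int) : T :=
  iota (k1 ^ x * k2 ^ y) * mono (m1%:Z * (a * x + c * y)) (m1%:Z * (b * x + d * y)).

Lemma psi_neq0 x y : psi x y != 0.
Proof. by rewrite mulf_neq0 ?mono_neq0 // fmorph_eq0 mulf_neq0 // expfz_neq0. Qed.

Lemma psiD x y x' y' : psi (x + x') (y + y') = psi x y * psi x' y'.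
Proof.
rewrite /psi mulrACA -rmorphM -monoD; congr (iota _ * mono _ _); first last.
- by ring.
- by ring.
by rewrite !expfzDr // mulrACA.
Qed.

Lemma psi_transport i j : transport i j (psi (n1%:Z * i) (n1%:Z * j)).
Proof.
have texp := transport_expz char_k AB1 rep1 AB2 rep2 D1 N2_gt0 phi_lie phiK phiK'.
have := transport_mul AB1 rep1 D1 (texp _ _ _ i tr10) (texp _ _ _ j tr01).
rewrite !mul1r !mul0r addr0 add0r; congr (transport _ _ _).
rewrite /psi /cmono (expfzMl (iota (k1 ^+ n1))) (expfzMl (iota (k2 ^+ n1))) !monoX mulrACA -!fmorphXz -rmorphM -monoD.
by rewrite -D1 PoszM !exprnP !exprz_exp; congr (iota _ * mono _ _); ring.
Qed.

(* The value is 0 when the monomial matrix is not in the image of rho1. *)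
Definition lift x y (X : 'M[k]_N1.+1) : L1 :=
  match pselect (exists l, rho1 l = mono (m1%:Z * x) (m1%:Z * y) *: X^i) with
  | left h => sval (cid h)
  | right _ => 0
  end.

Lemma liftE x y X : homog x y X -> \tr X = 0 ->
  rho1 (lift x y X) = mono (m1%:Z * x) (m1%:Z * y) *: X^i.
Proof.
move=> hX trX; rewrite /lift; case: pselect => [h | []]; first by case: cid.
exact: lr_surj rep1 _ (loop_mono T m1 hX trX).
Qed.

Definition comp x y X := (psi x y)^-1 *: rho2 (phi (lift x y X)).

Lemma comp_lin x y al X Y : homog x y X -> \tr X = 0 -> homog x y Y -> \tr Y = 0 ->
  comp x y (al *: X + Y) = iota al *: comp x y X + comp x y Y.
Proof.
move=> hX trX hY trY; have hXY := homog_lin al hX hY.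
have trXY : \tr (al *: X + Y) = 0 by rewrite linearD linearZ /= trX trY mulr0 addr0.
have -> : comp x y (al *: X + Y) = (psi x y)^-1 *: rho2 (phi (al *: lift x y X + lift x y Y)).
  congr (_ *: rho2 (phi _)); apply: (lr_inj rep1).
  rewrite liftE // (lr_lin rep1) !liftE // map_mxD map_mxZ scalerDr !scalerA.
  by rewrite [iota al * _]mulrC.
rewrite linearP (lr_lin rep2) scalerDr !scalerA /comp; congr (_ *: _ + _).
by rewrite mulrC.
Qed.

Lemma comp_mxbr x y x' y' X Y : homog x y X -> \tr X = 0 -> homog x' y' Y -> \tr Y = 0 ->
  mxbr (comp x y X) (comp x' y' Y) = comp (x + x') (y + y') (mxbr X Y).
Proof.
move=> hX trX hY trY; rewrite /comp psiD (invfM (psi x y)).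
have hXY := homog_mxbr AB1 hX hY.
have -> : lift (x + x') (y + y') (mxbr X Y) = lie (lift x y X) (lift x' y' Y).
  apply: (lr_inj rep1); rewrite (lr_lie rep1) !liftE ?mxbr_trace //.
  rewrite !mulrDr monoD /mxbr -!scalemxAl -!scalemxAr !scalerA map_mxB !map_mxM.
  by rewrite scalerBr [mono (m1%:Z * x') _ * _]mulrC.
rewrite phi_lie (lr_lie rep2) /mxbr -!scalemxAl -!scalemxAr !scalerA scalerBr.
by rewrite [(psi x' y')^-1 * _]mulrC.
Qed.

Lemma lift0 x y X : X = 0 -> rho1 (lift x y X) = 0.
Proof.
by move=> ->; rewrite liftE ?map_mx0 ?scaler0 //; [exact: homog0 | exact: mxtrace0].
Qed.

(** The two degrees differ by a multiple of n1, so the lifts differ by a centroid monomial, whose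
    transport is exactly the ratio of the two values of [psi]. *)
Lemma comp_eq x y x' y' X : homog x y X -> homog x' y' X -> \tr X = 0 ->
  comp x y X = comp x' y' X.
Proof.
move=> hX hX' trX; case: (eqVneq X 0) => [X0 | X0].
  rewrite /comp (lr_eq0 rep1 (lift0 x y X0)) (lr_eq0 rep1 (lift0 x' y' X0)).
  by rewrite linear0 (lr0 rep2) !scaler0.
have th0 := theta_neq0 AB1.
have sub1 u u' : theta1 ^ u = theta1 ^ u' -> theta1 ^ (u' - u) = 1.
  by move=> E; rewrite expfzDr // -E -invr_expz mulfV ?expfz_neq0.
have [tx ty] := homog_uniq AB1 X0 hX hX'.
have [i iE] := theta_expz_eq1 AB1 (sub1 _ _ tx).
have [j jE] := theta_expz_eq1 AB1 (sub1 _ _ ty).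
have xE : x' = n1%:Z * i + x by rewrite -iE subrK.
have yE : y' = n1%:Z * j + y by rewrite -jE subrK.
have invK (u w : T) : u != 0 -> (u * w)^-1 * u = w^-1.
  by move=> u0; rewrite invfM mulrAC mulVf // mul1r.
rewrite /comp xE yE psiD.
rewrite (@psi_transport i j (lift x y X) (lift (n1%:Z * i + x) (n1%:Z * j + y) X)).
  by rewrite scalerA invK ?psi_neq0.
rewrite -xE -yE !liftE // xE yE !mulrDr monoD scalerA /cmono -D1 PoszM.
by rewrite !mulrA.
Qed.

Let charF j : (j%:R == 0 :> k) = (j == 0%N).
Proof. by have /pcharf0P -> := char_k. Qed.

Definition dev (X : 'M[k]_N1.+1) := X - (\tr X / N1.+1%:R)%:M.

Lemma dev_trace X : \tr (dev X) = 0.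
Proof.
by rewrite raddfB /= mxtrace_scalar -[(_ / _) *+ _]mulr_natr divfK ?subrr // charF.
Qed.

Lemma dev_id X : \tr X = 0 -> dev X = X.
Proof. by move=> trX; rewrite /dev trX mul0r raddf0 subr0. Qed.

Lemma dev_lin al X Y : dev (al *: X + Y) = al *: dev X + dev Y.
Proof.
rewrite /dev linearD linearZ /= mulrDl raddfD /= scalerBr -mulrA scale_scalar_mx.
by rewrite opprD addrACA.
Qed.

Lemma dev_mxbr X Y : mxbr (dev X) (dev Y) = mxbr X Y.
Proof.
rewrite /dev -[X - _]addrC -[Y - _]addrC -scaleN1r -(scaleN1r (_%:M)).
have mxbrZ (C : 'M[k]_N1.+1) al : mxbr al%:M C = 0.
  by rewrite /mxbr scalar_mxC subrr.
have mxbrZr (C : 'M[k]_N1.+1) al : mxbr C al%:M = 0 by rewrite mxbrC mxbrZ oppr0.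
rewrite mxbr_linl !mxbr_linr.
by rewrite !mxbrZ mxbrZr !(scaler0, add0r).
Qed.

(* The values of comp depend only on the class of (x, y) modulo n1 (comp_eq), so they glue to a
   Lie homomorphism; dev makes it defined on all matrices. *)
Definition untw X := \sum_(x < n1) \sum_(y < n1) comp x y (gproj n1 theta1 A1 B1 x y (dev X)).

(** Every projection of X is a multiple of X, so by [comp_eq] all summands can be computed in degree
    (x, y), where [comp] is additive. *)
Lemma untw_homog x y X : homog x y X -> \tr X = 0 -> untw X = comp x y X.
Proof.
move=> hX trX; rewrite /untw dev_id //.
have hg i j : homog x y (gproj n1 theta1 A1 B1 i j X).
  rewrite (gproj_of_homog char_k AB1 _ _ hX) -[_ *: X]addr0.
  by apply: homog_lin => //; apply: homog0.
have trg i j : \tr (gproj n1 theta1 A1 B1 i j X) = 0 by apply: (gproj_trace AB1).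
have compD Y Z : homog x y Y -> \tr Y = 0 -> homog x y Z -> \tr Z = 0 ->
    comp x y (Y + Z) = comp x y Y + comp x y Z.
  by move=> hY trY hZ trZ; rewrite -[Y]scale1r comp_lin // rmorph1 !scale1r.
have comp0 : comp x y 0 = 0.
  by rewrite /comp (lr_eq0 rep1 (lift0 x y erefl)) linear0 (lr0 rep2) scaler0.
pose good Y := homog x y Y /\ \tr Y = 0.
have sum_comp (f : 'I_n1 -> 'M[k]_N1.+1) : (forall i, good (f i)) ->
    good (\sum_i f i) /\ \sum_i comp x y (f i) = comp x y (\sum_i f i).
  move=> gf; apply: (big_rec2 (fun U V => good V /\ U = comp x y V)).
    by split; [split; [exact: homog0 | exact: mxtrace0] | rewrite comp0].
  move=> i U V _ [[hV trV] ->]; have [hi tri] := gf i; split; last by rewrite compD.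
  split; last by rewrite linearD /= tri trV addr0.
  by rewrite -[f i]scale1r; apply: homog_lin.
rewrite -[in RHS](gproj_sum char_k AB1 X).
have gsum (i : 'I_n1) := sum_comp (fun j : 'I_n1 => gproj n1 theta1 A1 B1 i j X)
  (fun j => conj (hg i j) (trg i j)).
rewrite -(sum_comp (fun i : 'I_n1 => \sum_(j < n1) gproj n1 theta1 A1 B1 i j X)
  (fun i => (gsum i).1)).2.
apply: eq_bigr => i _; rewrite -(gsum i).2; apply: eq_bigr => j _.
by apply: comp_eq => //; apply: (gproj_homog char_k AB1).
Qed.

Lemma untw_lin al X Y : untw (al *: X + Y) = iota al *: untw X + untw Y.
Proof.
rewrite /untw dev_lin scaler_sumr -big_split /=; apply: eq_bigr => i _.
rewrite scaler_sumr -big_split /=; apply: eq_bigr => j _; rewrite gproj_lin.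
by apply: comp_lin; (apply: (gproj_homog char_k AB1) || apply: (gproj_trace AB1) => //); apply: dev_trace.
Qed.

Lemma untw_mxbr X Y : untw (mxbr X Y) = mxbr (untw X) (untw Y).
Proof.
have devdev Z : dev (dev Z) = dev Z by rewrite dev_id // dev_trace.
have untwdev Z : untw Z = untw (dev Z) by rewrite /untw devdev.
rewrite -dev_mxbr (untwdev X) (untwdev Y); move: (dev_trace X) (dev_trace Y).
have untwD Z W : untw (Z + W) = untw Z + untw W.
  by rewrite -[Z]scale1r untw_lin rmorph1 !scale1r.
have untw0 : untw 0 = 0 by apply: (Phi0 untw_lin).
have mxbrDl (R : comPzRingType) p (Z W V : 'M[R]_p) : mxbr (Z + W) V = mxbr Z V + mxbr W V.
  by rewrite -[Z]scale1r mxbr_linl !scale1r.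
have mxbrDr (R : comPzRingType) p (Z W V : 'M[R]_p) : mxbr V (Z + W) = mxbr V Z + mxbr V W.
  by rewrite -[Z]scale1r mxbr_linr !scale1r.
have mxbr0l (R : comPzRingType) p (V : 'M[R]_p) : mxbr 0 V = 0.
  by rewrite /mxbr mul0mx mulmx0 subrr.
have mxbr0r (R : comPzRingType) p (V : 'M[R]_p) : mxbr V 0 = 0.
  by rewrite /mxbr mul0mx mulmx0 subrr.
move: (dev X) (dev Y) => {}X {}Y trX trY; move: X trX.
apply: (homog_ind char_k AB1 (P := fun X => untw (mxbr X Y) = mxbr (untw X) (untw Y))).
- by rewrite mxbr0l untw0 mxbr0l.
- by move=> Z W HZ HW; rewrite mxbrDl (untwD (mxbr Z Y)) (untwD Z W) HZ HW mxbrDl.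
move=> x y X hX trX; move: Y trY.
apply: (homog_ind char_k AB1 (P := fun Y => untw (mxbr X Y) = mxbr (untw X) (untw Y))).
- by rewrite mxbr0r untw0 mxbr0r.
- by move=> Z W HZ HW; rewrite mxbrDr (untwD (mxbr X Z)) (untwD Z W) HZ HW mxbrDr.
move=> x' y' Y hY trY; rewrite (untw_homog hX trX) (untw_homog hY trY) comp_mxbr //.
by apply: untw_homog (homog_mxbr AB1 hX hY) (mxbr_trace _ _).
Qed.

(** On a homogeneous lift, [rho2 (phi l)] is [untw X] times the invertible factor [psi]; so the span
    contains the image of [rho2], which spans all traceless matrices. *)
Lemma untw_span (P : 'M[T]_N2.+1 -> Prop) :
  (forall e X Y, P Y -> P (e *: untw X + Y)) -> P 0 -> forall Z, \tr Z = 0 -> P Z.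
Proof.
move=> Pl P0; apply: (lr_span char_k AB2 rep2) => // e y Z PZ.
rewrite -[y]phiK'; move: (phi' y) => l.
suff H W : loop theta1 A1 B1 m1 W -> forall l, rho1 l = W -> forall Z, P Z ->
    P (e *: rho2 (phi l) + Z).
  exact: (H _ (lr_loop rep1 l) l erefl Z PZ).
elim/loop_ind => [l' E V PV | u v X W' hX trX IH l' E V PV].
  by rewrite (lr_eq0 rep1 E) linear0 (lr0 rep2) scaler0 add0r.
have -> : l' = lift u v X + (l' - lift u v X) by rewrite addrC subrK.
rewrite linearD /= (lrD rep2) scalerDr -addrA.
have -> : e *: rho2 (phi (lift u v X)) = (e * psi u v) *: untw X.
  by rewrite (untw_homog hX trX) /comp scalerA mulfK // psi_neq0.
apply/Pl/IH => //; rewrite (lrD rep1) -scaleN1r (lrZ rep1) rmorphN rmorph1 scaleN1r E liftE //.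
by rewrite addrC addKr.
Qed.

Lemma untw_neq0 : exists X, \tr X = 0 /\ untw X != 0.
Proof.
have [u [v [X [hX trX X0]]]] := homog_nonzero char_k AB1 N1_gt0.
exists X; split=> //; rewrite (untw_homog hX trX) /comp scaler_eq0 invr_eq0 (negPf (psi_neq0 _ _)) /=.
apply/eqP => /(lr_eq0 rep2) E; have := congr1 phi' E; rewrite phiK -(linear0 phi) phiK => E'.
have := liftE hX trX; rewrite E' (lr0 rep1) => /esym/eqP.
by rewrite scaler_eq0 (negPf (mono_neq0 _ _ _)) map_mx_eq0 (negPf X0).
Qed.

Lemma untw_classification :
  exists (C : 'M[T]_(N2.+1, N1.+1)) (W : 'M[T]_(N1.+1, N2.+1)), W *m C = 1%:M /\
   ((forall X, \tr X = 0 -> untw X *m C = C *m X^i) \/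
    (forall X, \tr X = 0 -> - (untw X)^T *m C = C *m X^i)).
Proof. exact: Lie_hom_classification char_k untw_lin untw_mxbr untw_span untw_neq0 N1_gt0. Qed.

Section UntwistTwist.
Variables (eta : k) (q : nat).
Hypotheses (eta_neq0 : eta != 0) (eta1 : eta ^+ m1 = theta1) (eta2 : eta ^+ m2 = theta2 ^+ q).

Lemma twist_comp (al be : k) (R : 'M[k]_N2.+1) x y X :
  al != 0 -> be != 0 ->
  (forall Y, loop theta2 A2 B2 m2 Y -> R^i *m map_mx (tf_twist T al be) Y = Y *m R^i) ->
  R^i *m map_mx (tf_twist T al be) (comp x y X) =
  (iota (al ^ (m1%:Z * (a * x + c * y)) * be ^ (m1%:Z * (b * x + d * y))))^-1 *:
     (comp x y X *m R^i).
Proof.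
move=> al0 be0 HR; have HY := lr_loop rep2 (phi (lift x y X)).
rewrite /comp map_mxZ -scalemxAr (HR _ HY).
rewrite fmorphV /psi rmorphM tf_twist_const // twist_mono //.
by rewrite -scalemxAl scalerA -invfM mulrCA.
Qed.

(** R implements the substitution on the image of [rho2]; the only defect is the character by which
    the substitution acts on [psi]. Conjugation by [Dm] realises the inverse of this character on
    degrees and absorbs the defect. *)
Lemma untw_twist (al be : k) (R : 'M[k]_N2.+1) (Dm : 'M[k]_N1.+1) :
  al != 0 -> be != 0 -> Dm \in unitmx ->
  (forall Y, loop theta2 A2 B2 m2 Y -> R^i *m map_mx (tf_twist T al be) Y = Y *m R^i) ->
  (forall x y X, homog x y X -> Dm *m X =
     (al ^ (m1%:Z * (a * x + c * y)) * be ^ (m1%:Z * (b * x + d * y)))^-1 *: (X *m Dm)) ->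
  forall X, \tr X = 0 ->
  R^i *m map_mx (tf_twist T al be) (untw X) = untw (Dm *m X *m invmx Dm) *m R^i.
Proof.
move=> al0 be0 uD HR HD.
have untwD Z W : untw (Z + W) = untw Z + untw W.
  by rewrite -[Z]scale1r untw_lin rmorph1 !scale1r.
apply: (homog_ind char_k AB1 (P := fun X =>
  R^i *m map_mx (tf_twist T al be) (untw X) = untw (Dm *m X *m invmx Dm) *m R^i)).
- by rewrite mulmx0 mul0mx (Phi0 untw_lin) map_mx0 mulmx0 mul0mx.
- move=> Z W HZ HW; rewrite mulmxDr mulmxDl (untwD Z W) (untwD (Dm *m Z *m _)).
  move: (untw Z) (untw W) (untw _) (untw _) HZ HW => U V U' V' HU HV.
  by rewrite map_mxD mulmxDr mulmxDl HU HV.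
move=> x y X hX trX; rewrite (HD _ _ _ hX) -scalemxAl mulmxK // (PhiZ untw_lin).
by rewrite (untw_homog hX trX) twist_comp // fmorphV scalemxAl.
Qed.

(** The substitution s -> eta s multiplies [psi x y] by theta1^(a x + c y). By [monomial_eigen],
    conjugation by A1^(-c) B1^a multiplies degree (x, y) by the inverse; the exponents d, -b below
    arise in the same way. *)
Lemma untw_twistB X : \tr X = 0 ->
  (B2 ^+ q)^i *m map_mx (tf_twist T eta 1) (untw X) =
  untw ((A1 ^ (- c) *m B1 ^ a) *m X *m invmx (A1 ^ (- c) *m B1 ^ a)) *m (B2 ^+ q)^i.
Proof.
have uD : A1 ^ (- c) *m B1 ^ a \in unitmx.
  by rewrite unitmx_mul; apply/andP; split; apply: unitrXz; [exact: unitA AB1 | exact: unitB AB1].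
apply: untw_twist => //; first exact: oner_neq0.
  by move=> Y; apply: (loop_twistB AB2).
move=> x y Y hY; rewrite (monomial_eigen AB1 _ _ hY) exp1rz mulr1 -exprz_exp -exprnP eta1.
by rewrite invr_expz; congr (_ ^ _ *: _); ring.
Qed.

Lemma untw_twistA X : \tr X = 0 ->
  (A2 ^+ q)^i *m map_mx (tf_twist T 1 eta^-1) (untw X) =
  untw ((A1 ^ d *m B1 ^ (- b)) *m X *m invmx (A1 ^ d *m B1 ^ (- b))) *m (A2 ^+ q)^i.
Proof.
have uD : A1 ^ d *m B1 ^ (- b) \in unitmx.
  by rewrite unitmx_mul; apply/andP; split; apply: unitrXz; [exact: unitA AB1 | exact: unitB AB1].
apply: untw_twist => //; first exact: oner_neq0.
- by rewrite invr_eq0.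
- by move=> Y; apply: (loop_twistA AB2).
move=> x y Y hY; rewrite (monomial_eigen AB1 _ _ hY) exp1rz mul1r exprz_inv invr_expz opprK.
by rewrite -exprz_exp -exprnP eta1; congr (_ ^ _ *: _); ring.
Qed.

End UntwistTwist.
End Untwist.

Lemma mono_inj (k : fieldType) (T : torus_field k) (c c' : k) (i j i' j' : int) :
  [pchar k] =i pred0 -> c != 0 ->
  tf_const T c * mono T i j = tf_const T c' * mono T i' j' -> i = i' /\ j = j'.
Proof.
move=> char_k c0 E; pose r := [:: (c, (i, j)); (- c', (i', j'))].
have r0 : \sum_(q <- r) tf_const T q.1 * mono T q.2.1 q.2.2 = 0.
  by rewrite !big_cons big_nil /= addr0 rmorphN mulNr E subrr.
have := mono_coef char_k (i, j) r0; rewrite !big_cons big_nil /= eqxx addr0.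
case: eqP => [[-> ->] // | _ /eqP]; by rewrite addr0 (negPf c0).
Qed.

Lemma transport_comb (k : fieldType) (T : torus_field k) (L1 L2 : lieAlgType k)
    (N1 n1 m1 : nat) (theta1 : k) (A1 B1 : 'M[k]_N1.+1) (rho1 : L1 -> 'M[T]_N1.+1)
    (N2 n2 m2 : nat) (theta2 : k) (A2 B2 : 'M[k]_N2.+1) (rho2 : L2 -> 'M[T]_N2.+1)
    (D : nat) (phi : {linear L1 -> L2}) (phi' : L2 -> L1) (a b c d : int) (ka kb : k) :
  [pchar k] =i pred0 ->
  twisted_pair n1 theta1 A1 B1 -> loop_rep theta1 A1 B1 m1 rho1 ->
  twisted_pair n2 theta2 A2 B2 -> loop_rep theta2 A2 B2 m2 rho2 ->
  (m1 * n1)%N = D -> (0 < N2)%N ->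
  {morph phi : x y / lie x y} -> cancel phi phi' -> cancel phi' phi ->
  transport rho1 rho2 D phi 1 0 (tf_const T ka * cmono T D a b) ->
  transport rho1 rho2 D phi 0 1 (tf_const T kb * cmono T D c d) ->
  forall i j, transport rho1 rho2 D phi i j
    (tf_const T (ka ^ i * kb ^ j) * cmono T D (a * i + c * j) (b * i + d * j)).
Proof.
move=> char_k AB1 rep1 AB2 rep2 D1 N2_gt0 phi_lie phiK phiK' tr10 tr01 i j.
have texp := transport_expz char_k AB1 rep1 AB2 rep2 D1 N2_gt0 phi_lie phiK phiK'.
have := transport_mul AB1 rep1 D1 (texp _ _ _ i tr10) (texp _ _ _ j tr01).
rewrite !mul1r !mul0r addr0 add0r; congr (transport _ _ _ _ _ _ _).
rewrite /cmono (expfzMl (tf_const T ka)) (expfzMl (tf_const T kb)) !monoX mulrACA.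
by rewrite -!fmorphXz -rmorphM -monoD; congr (_ * mono _ _ _); ring.
Qed.

(** A centroid monomial carried over by [phi] and back by [phi'] returns to itself up to a constant,
    and independence of monomials identifies the exponents. *)
Lemma transport_inverse (k : fieldType) (T : torus_field k) (L1 L2 : lieAlgType k)
    (N1 n1 m1 : nat) (theta1 : k) (A1 B1 : 'M[k]_N1.+1) (rho1 : L1 -> 'M[T]_N1.+1)
    (N2 m2 : nat) (theta2 : k) (A2 B2 : 'M[k]_N2.+1) (rho2 : L2 -> 'M[T]_N2.+1)
    (D : nat) (phi : {linear L1 -> L2}) (phi' : {linear L2 -> L1})
    (i j a b a' b' : int) (ka kb : k) :
  [pchar k] =i pred0 -> (0 < D)%N -> ka != 0 ->
  twisted_pair n1 theta1 A1 B1 -> loop_rep theta1 A1 B1 m1 rho1 ->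
  loop_rep theta2 A2 B2 m2 rho2 ->
  (m1 * n1)%N = D -> (0 < N1)%N -> cancel phi phi' ->
  transport rho1 rho2 D phi i j (tf_const T ka * cmono T D a b) ->
  transport rho2 rho1 D phi' a b (tf_const T kb * cmono T D a' b') ->
  a' = i /\ b' = j.
Proof.
move=> char_k D_gt0 ka0 AB1 rep1 rep2 D1 N1_gt0 phiK t t'.
have [u [v [X [hX trX X0]]]] := homog_nonzero char_k AB1 N1_gt0.
have [x Hx] := lr_surj rep1 (loop_mono T m1 hX trX).
have [x' Hx'] := shift_exists AB1 rep1 D1 i j x.
have E := t _ _ Hx'.
have E' : rho2 (phi (ka^-1 *: x')) = cmono T D a b *: rho2 (phi x).
  rewrite linearZ /= (lrZ rep2) E scalerA mulrA -rmorphM mulVf // rmorph1 mul1r.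
  by [].
have := t' _ _ E'; rewrite !phiK (lrZ rep1) Hx' scalerA => /eqP.
rewrite -subr_eq0 -scalerBl scaler_eq0 subr_eq0 => /orP[/eqP /esym H|]; last first.
  by rewrite Hx scaler_eq0 (negPf (mono_neq0 _ _ _)) map_mx_eq0 (negPf X0).
have Dn0 : D%:Z != 0 by rewrite -lt0n.
have kaV0 : ka^-1 != 0 by rewrite invr_eq0.
by have [/(mulfI Dn0) -> /(mulfI Dn0) ->] := mono_inj char_k kaV0 (esym H).
Qed.

Lemma closed_root (k : closedFieldType) (x : k) (n : nat) : (0 < n)%N -> exists y, y ^+ n = x.
Proof.
case: n => // n _; have [y yE] := GRing.solve_monicpoly n.+1 (fun i => if i == 0 then x else 0) (ltn0Sn n).
exists y; rewrite yE big_ord_recl /= expr0 mulr1 big1 ?addr0 // => i _.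
by rewrite mul0r.
Qed.

Lemma intz_unit_or (x y : int) : x * y = 1 -> x = 1 \/ x = -1.
Proof.
move=> xy; have : x \is a GRing.unit by apply/unitrP; exists y; rewrite mulrC xy.
by rewrite qualifE => /orP[] /eqP ->; [left | right].
Qed.

(** The contragredient of an equivariance relation; it adapts the argument to the alternative X ->
    -X^T. *)
Lemma trmx_inv_twist (k : fieldType) (T : torus_field k) (N : nat) (al be : k)
    (R : 'M[k]_N.+1) (Y Z : 'M[T]_N.+1) : R \in unitmx ->
  map_mx (tf_const T) R *m map_mx (tf_twist T al be) Y = Z *m map_mx (tf_const T) R ->
  map_mx (tf_const T) (invmx R)^T *m map_mx (tf_twist T al be) (- Y^T) =
  - Z^T *m map_mx (tf_const T) (invmx R)^T.
Proof.
move=> uR E; rewrite -map_trmx map_invmx map_mxN -map_trmx; set Ri := map_mx _ R in E *.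
have uRi : Ri \in unitmx by rewrite map_unitmx.
rewrite mulNmx mulmxN -!trmx_mul; congr (- _^T).
by apply: (can_inj (mulKmx uRi)); rewrite mulmxA E mulmxK // mulKVmx.
Qed.

(* The exponents n2 and n1 are exchanged so that both centroids are spanned by the monomials
   in s^(n1 n2) and t^(n1 n2). *)
Theorem loop_compare (k : closedFieldType) (T : torus_field k) (L1 L2 : lieAlgType k)
    (N1 n1 : nat) (theta1 : k) (A1 B1 : 'M[k]_N1.+1) (rho1 : L1 -> 'M[T]_N1.+1)
    (N2 n2 : nat) (theta2 : k) (A2 B2 : 'M[k]_N2.+1) (rho2 : L2 -> 'M[T]_N2.+1)
    (phi : {linear L1 -> L2}) (phi' : {linear L2 -> L1}) :
  [pchar k] =i pred0 ->
  twisted_pair n1 theta1 A1 B1 -> loop_rep theta1 A1 B1 n2 rho1 ->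
  twisted_pair n2 theta2 A2 B2 -> loop_rep theta2 A2 B2 n1 rho2 ->
  (0 < N1)%N -> (0 < N2)%N ->
  {morph phi : x y / lie x y} -> {morph phi' : x y / lie x y} ->
  cancel phi phi' -> cancel phi' phi ->
  (N1 <= N2)%N /\ (N1 = N2 -> exists eta q, [/\ eta ^+ n2 = theta1, eta ^+ n1 = theta2 ^+ q &
    theta2 ^+ (q * q) = theta1 \/ theta2 ^+ (q * q) = theta1^-1]).
Proof.
move=> char_k AB1 rep1 AB2 rep2 N1_gt0 N2_gt0 phi_lie phi'_lie phiK phiK'.
have n1_gt0 := tp_gt0 AB1; have n2_gt0 := tp_gt0 AB2.
pose D := (n2 * n1)%N; have D1 : (n2 * n1)%N = D by [].
have D2 : (n1 * n2)%N = D by rewrite mulnC.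
have D_gt0 : (0 < D)%N by rewrite muln_gt0 n1_gt0 n2_gt0.
have tm := transport_mono char_k AB1 rep1 AB2 rep2 D1 D2 n1_gt0 N2_gt0 phi_lie phiK phiK'.
have tm' := transport_mono char_k AB2 rep2 AB1 rep1 D2 D1 n2_gt0 N1_gt0 phi'_lie phiK' phiK.
have [ka [a [b [ka0 ta]]]] := tm 1 0; have [kb [c [d [kb0 tb]]]] := tm 0 1.
have [ka' [a' [b' [ka'0 ta']]]] := tm' 1 0; have [kb' [c' [d' [kb'0 tb']]]] := tm' 0 1.
have tc := transport_comb char_k AB2 rep2 AB1 rep1 D2 N1_gt0 phi'_lie phiK' phiK ta' tb'.
have [aa ab] := transport_inverse char_k D_gt0 ka0 AB1 rep1 rep2 D1 N1_gt0 phiK ta (tc a b).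
have [ba bb] := transport_inverse char_k D_gt0 kb0 AB1 rep1 rep2 D1 N1_gt0 phiK tb (tc c d).
(* The product of the exponent matrices of [phi'] and [phi] is the identity, so their integer
   determinants multiply to 1. *)
have det1 : a * d - b * c = 1 \/ a * d - b * c = -1.
  apply: (@intz_unit_or _ (a' * d' - b' * c')).
  transitivity ((a' * a + c' * b) * (b' * c + d' * d) - (a' * c + c' * d) * (b' * a + d' * b)).
    by ring.
  by rewrite aa ab ba bb.
have [k1 k1E] := closed_root ka n1_gt0; have [k2 k2E] := closed_root kb n1_gt0.
have k10 : k1 != 0 by apply: contraNneq ka0 => E; rewrite -k1E E expr0n eqn0Ngt n1_gt0.
have k20 : k2 != 0 by apply: contraNneq kb0 => E; rewrite -k2E E expr0n eqn0Ngt n1_gt0.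
rewrite -k1E in ta; rewrite -k2E in tb.
have [C [W [WC PsiC]]] := untw_classification char_k AB1 rep1 AB2 rep2 D1 N1_gt0 N2_gt0
  phi_lie phiK phiK' k10 k20 ta tb.
split=> [|eqN]; first exact: mulmx1_min WC.
have [eta etaE] := closed_root theta1 n2_gt0.
have eta0 : eta != 0.
  by apply: contraNneq (theta_neq0 AB1) => E; rewrite -etaE E expr0n eqn0Ngt n2_gt0.
(* The n2-th power of eta^n1 is theta1^n1 = 1, so eta^n1 is a power of the primitive root theta2. *)
have [q qE] : {q : 'I_n2 | eta ^+ n1 = theta2 ^+ q}.
  by apply: (prim_rootP (tp_prim AB2)); rewrite exprAC etaE (prim_expr_order (tp_prim AB1)).
exists eta, q; split=> //; move: (q : nat) qE => {}q qE.
have tB := untw_twistB char_k AB1 rep1 AB2 rep2 D1 N2_gt0 phi_lie phiK phiK' k10 k20 ta tb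
  eta0 etaE qE.
have tA := untw_twistA char_k AB1 rep1 AB2 rep2 D1 N2_gt0 phi_lie phiK phiK' k10 k20 ta tb
  eta0 etaE qE.
have eta'0 : eta^-1 != 0 by rewrite invr_eq0.
have one0 := oner_neq0 k.
have uD x y : A1 ^ x *m B1 ^ y \in unitmx.
  by rewrite unitmx_mul; apply/andP; split; apply: unitrXz; [exact: unitA AB1 | exact: unitB AB1].
have uR : B2 ^+ q \in unitmx by apply: unitrX; exact: unitB AB2.
have uS : A2 ^+ q \in unitmx by apply: unitrX; exact: unitA AB2.
have RS : B2 ^+ q *m A2 ^+ q = theta2 ^ (- q%:Z * q%:Z) *: (A2 ^+ q *m B2 ^+ q).
  have := homog_monomial AB2 q 0; rewrite expr0z mulmxE mulr1 -exprnP => h.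
  exact: (homog_powB AB2 q h).
(* The second monomial has degree (d, -b), so the commutation constant is theta1^(b c - a d). *)
have DD := monomial_eigen AB1 (- c) a (homog_monomial AB1 d (- b)).
have th20 := theta_neq0 AB2; have th10 := theta_neq0 AB1.
have concl (e : int) : e = 1 \/ e = -1 -> theta2 ^+ (q * q) = theta1 ^ e ->
    theta2 ^+ (q * q) = theta1 \/ theta2 ^+ (q * q) = theta1^-1.
  by case=> -> ->; [left | right].
subst N2; have [_ uC] := mulmx1_unit WC; case: PsiC => PsiC.
  have E := twisted_intertwiner uC PsiC eta0 one0 one0 eta'0 uR uS (uD _ _) (uD _ _)
    tB tA RS DD.
  apply: (concl (a * d - b * c)) => //; apply: invr_inj; rewrite exprnP !invr_expz PoszM -mulNr E.
  by congr (_ ^ _); ring.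
(* Inverse transposes have the inverse commutation constant, so this case changes only the sign of
   an exponent. *)
have tB' X (trX : \tr X = 0) := trmx_inv_twist uR (tB X trX).
have tA' X (trX : \tr X = 0) := trmx_inv_twist uS (tA X trX).
have uR' : (invmx (B2 ^+ q))^T \in unitmx by rewrite unitmx_tr unitmx_inv.
have uS' : (invmx (A2 ^+ q))^T \in unitmx by rewrite unitmx_tr unitmx_inv.
have RS' : (invmx (B2 ^+ q))^T *m (invmx (A2 ^+ q))^T =
    theta2 ^ (q%:Z * q%:Z) *: ((invmx (A2 ^+ q))^T *m (invmx (B2 ^+ q))^T).
  rewrite -!trmx_mul -linearZ /=; congr (_^T).
  apply: (can_inj (mulKmx uS)); rewrite mulKVmx // -scalemxAr.
  apply: (can_inj (mulKmx uR)); rewrite mulmxV // -scalemxAr !mulmxA RS.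
  rewrite -scalemxAl -scalemxAl scalerA -expfzDr // mulNr subrr expr0z scale1r.
  by rewrite mulmxK // mulmxV.
have E := twisted_intertwiner uC PsiC eta0 one0 one0 eta'0 uR' uS' (uD _ _) (uD _ _)
  tB' tA' RS' DD.
apply: (concl (b * c - a * d)); first by case: det1 => H; [right | left]; rewrite -opprB H ?opprK.
by rewrite exprnP PoszM E; congr (_ ^ _); ring.
Qed.

(** * The quantum torus *)

Section UniversalProperty.
Variables (k : fieldType) (theta : k) (h : theta != 0) (R : pzRingType) (sc : {rmorphism k -> R}).
Hypothesis sc_central : forall c r, sc c * r = r * sc c.
Variables u u' v v' : R.

Fixpoint qeval (t : qterm k) : R :=
  match t with
  | QX1 => u
  | QX2 => v
  | QX1inv => u'
  | QX2inv => v'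
  | QZero => 0
  | QOne => 1
  | QOpp t => - qeval t
  | QAdd t w => qeval t + qeval w
  | QMul t w => qeval t * qeval w
  | QScale c t => sc c * qeval t
  end.

Definition qmap (x : qtorus h) : R := qeval (qrepr x).

Hypotheses (uu' : u * u' = 1) (u'u : u' * u = 1) (vv' : v * v' = 1) (v'v : v' * v = 1).
Hypothesis uv : u * v = sc theta * (v * u).

Lemma qeval_rel t w : qrel theta t w -> qeval t = qeval w.
Proof.
elim=> {t w} //=.
- by move=> w t z _ -> _ ->.
- by move=> t t' _ ->.
- by move=> t t' w w' _ -> _ ->.
- by move=> t t' w w' _ -> _ ->.
- by move=> c t t' _ ->.
- by move=> t w z; rewrite addrA.
- by move=> t w; rewrite addrC.
- by move=> t; rewrite add0r.
- by move=> t; rewrite addNr.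
- by move=> t w z; rewrite mulrA.
- by move=> t; rewrite mul1r.
- by move=> t; rewrite mulr1.
- by move=> t w z; rewrite mulrDl.
- by move=> t w z; rewrite mulrDr.
- by move=> a b t; rewrite rmorphM mulrA.
- by move=> t; rewrite rmorph1 mul1r.
- by move=> a t w; rewrite mulrDr.
- by move=> a b t; rewrite rmorphD mulrDl.
- by move=> a t w; rewrite mulrA.
- by move=> a t w; rewrite !mulrA sc_central.
Qed.

Lemma qmapE t : qmap (qclass h t) = qeval t.
Proof. exact/qeval_rel/qreprP. Qed.

Lemma qmapD x y : qmap (x + y) = qmap x + qmap y.
Proof.
elim/qclass_ind: x => t; elim/qclass_ind: y => w.
by rewrite [qclass h t + _]qaddE !qmapE.
Qed.

Lemma qmapM x y : qmap (x * y) = qmap x * qmap y.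
Proof.
elim/qclass_ind: x => t; elim/qclass_ind: y => w.
by rewrite [qclass h t * _]qmulE !qmapE.
Qed.

Lemma qmap1 : qmap 1 = 1.
Proof. exact: qmapE. Qed.

Lemma qmapZ c x : qmap (c *: x) = sc c * qmap x.
Proof. by elim/qclass_ind: x => t; rewrite [c *: _]qscaleE !qmapE. Qed.

End UniversalProperty.

(** * Spanning of the quantum torus by Laurent monomials *)

Section NormalForm.
Variables (k : fieldType) (theta : k) (h : theta != 0).
Local Notation Q := (qtorus h).
Local Notation X1 := (qclass h (QX1 k)).
Local Notation X2 := (qclass h (QX2 k)).
Local Notation X1' := (qclass h (QX1inv k)).
Local Notation X2' := (qclass h (QX2inv k)).

Lemma qX1V : X1 * X1' = 1. Proof. by rewrite [X1 * _]qmulE; apply/qclassP/qrel_X1V. Qed.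
Lemma qVX1 : X1' * X1 = 1. Proof. by rewrite [X1' * _]qmulE; apply/qclassP/qrel_VX1. Qed.
Lemma qX2V : X2 * X2' = 1. Proof. by rewrite [X2 * _]qmulE; apply/qclassP/qrel_X2V. Qed.
Lemma qVX2 : X2' * X2 = 1. Proof. by rewrite [X2' * _]qmulE; apply/qclassP/qrel_VX2. Qed.
Lemma qX1X2 : X1 * X2 = theta *: (X2 * X1).
Proof.
by rewrite [X1 * _]qmulE [X2 * _]qmulE [theta *: _]qscaleE; apply/qclassP/qrel_comm.
Qed.

(** Integer powers with respect to a prescribed inverse x', so that no unit-ring structure on the
    quantum torus is involved. *)
Definition ipow (R : pzRingType) (x x' : R) (z : int) :=
  match z with Posz i => x ^+ i | Negz i => x' ^+ i.+1 end.

Lemma ipowS (R : pzRingType) (x x' : R) z : x * x' = 1 -> x * ipow x x' z = ipow x x' (1 + z).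
Proof.
move=> xx'; case: z => [i | [|i]] /=; first by rewrite -exprS.
  by rewrite expr1.
by rewrite exprS mulrA xx' mul1r subSS subn0.
Qed.

Lemma ipowP (R : pzRingType) (x x' : R) z : x' * x = 1 -> x' * ipow x x' z = ipow x x' (-1 + z).
Proof.
move=> x'x; case: z => [[|i] | i] /=; first by rewrite expr0 mulr1 expr1.
  by rewrite exprS mulrA x'x mul1r subSS subn0.
by rewrite -exprS add0n.
Qed.

Definition qmon (e : int * int) : Q := ipow X1 X1' e.1 * ipow X2 X2' e.2.

Lemma ipow_comm (y : Q) (x x' : Q) nu z : x * x' = 1 -> x' * x = 1 -> nu != 0 ->
  y * x = nu *: (x * y) -> y * ipow x x' z = nu ^ z *: (ipow x x' z * y).
Proof.
move=> xx' x'x nu0 yx.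
have pos (w : Q) (mu : k) i : y * w = mu *: (w * y) -> y * w ^+ i = mu ^+ i *: (w ^+ i * y).
  move=> yw; elim: i => [|i IH]; first by rewrite !expr0 scale1r mul1r mulr1.
  by rewrite !exprS mulrA yw -scalerAl -(mulrA w y) IH -scalerAr scalerA mulrA.
case: z => i /=; first exact: pos.
have yx' : y * x' = nu^-1 *: (x' * y).
  have -> : x' * y = x' * (y * x) * x' by rewrite -!mulrA xx' mulr1.
  by rewrite yx -scalerAr mulrA x'x mul1r -scalerAl scalerA mulVf // scale1r.
by rewrite (pos _ _ _ yx') NegzE -exprnN exprVn.
Qed.

Lemma qmon_X1 e : X1 * qmon e = qmon (1 + e.1, e.2).
Proof. by rewrite /qmon mulrA ipowS // qX1V. Qed.

Lemma qmon_X1V e : X1' * qmon e = qmon (-1 + e.1, e.2).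
Proof. by rewrite /qmon mulrA ipowP // qVX1. Qed.

Lemma qX2X1 : X2 * X1 = theta^-1 *: (X1 * X2).
Proof. by rewrite qX1X2 scalerA mulVf // scale1r. Qed.

Lemma qmon_X2 e : X2 * qmon e = theta^-1 ^ e.1 *: qmon (e.1, 1 + e.2).
Proof.
rewrite /qmon mulrA (ipow_comm _ qX1V qVX1 _ qX2X1) ?invr_eq0 // -scalerAl -mulrA.
by rewrite ipowS // qX2V.
Qed.

Lemma qmon_X2V e : X2' * qmon e = theta ^ e.1 *: qmon (e.1, -1 + e.2).
Proof.
have qX2VX1 : X2' * X1 = theta *: (X1 * X2').
  have -> : X1 * X2' = X2' * (X2 * X1) * X2' by rewrite mulrA qVX2 mul1r.
  rewrite qX2X1 -scalerAr -scalerAl scalerA mulfV // scale1r.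
  by rewrite -!mulrA qX2V mulr1.
rewrite /qmon mulrA (ipow_comm _ qX1V qVX1 _ qX2VX1) // -scalerAl -mulrA.
by rewrite ipowP // qVX2.
Qed.

Definition qsum (r : seq (k * (int * int))) : Q := \sum_(q <- r) q.1 *: qmon q.2.

(** Sums of monomials are stable under left multiplication by the generators, hence by the class of
    any expression; this is applied to 1. Keeping the right factor arbitrary lets the induction pass
    through products. *)
Lemma qsum_span (x : Q) : exists r, x = qsum r.
Proof.
pose S (x : Q) := exists r, x = qsum r.
have S0 : S 0 by exists [::]; rewrite /qsum big_nil.
have SD y z : S y -> S z -> S (y + z).
  by move=> [r ->] [r' ->]; exists (r ++ r'); rewrite /qsum big_cat.
have SZ c y : S y -> S (c *: y).
  move=> [r ->]; exists [seq (c * q.1, q.2) | q <- r].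
  by rewrite /qsum big_map scaler_sumr; apply: eq_bigr => q _; rewrite scalerA.
have Sm e : S (qmon e) by exists [:: (1, e)]; rewrite /qsum big_seq1 scale1r.
have Sgen (y : Q) : (forall e, S (y * qmon e)) -> forall z, S z -> S (y * z).
  move=> Sy z [r ->]; rewrite /qsum mulr_sumr; apply: big_ind => // q _.
  by rewrite -scalerAr; apply: SZ.
suff Sl t : forall z, S z -> S (qclass h t * z).
  elim/qclass_ind: x => t; rewrite -[qclass h t]mulr1; apply: Sl.
  by have := Sm (0, 0); rewrite /qmon /= !expr0 mulr1.
elim: t => [||||||t IH|t IHt w IHw|t IHt w IHw|c t IH] z Sz.
- by apply: Sgen Sz => e; rewrite qmon_X1.
- by apply: Sgen Sz => e; rewrite qmon_X2; apply: SZ.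
- by apply: Sgen Sz => e; rewrite qmon_X1V.
- by apply: Sgen Sz => e; rewrite qmon_X2V; apply: SZ.
- by rewrite -[qclass h (QZero k)]/(0 : Q) mul0r.
- by rewrite -[qclass h (QOne k)]/(1 : Q) mul1r.
- have -> : qclass h (QOpp t) = - qclass h t by symmetry; apply: qoppE.
  by rewrite mulNr -scaleN1r; apply/SZ/IH.
- have -> : qclass h (QAdd t w) = qclass h t + qclass h w by symmetry; apply: qaddE.
  by rewrite mulrDl; apply: SD; [apply: IHt | apply: IHw].
- have -> : qclass h (QMul t w) = qclass h t * qclass h w by symmetry; apply: qmulE.
  by rewrite -mulrA; apply/IHt/IHw.
have -> : qclass h (QScale c t) = c *: qclass h t by symmetry; apply: qscaleE.
by rewrite -scalerAl; apply/SZ/IH.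
Qed.

(** Terms are removed one exponent at a time. Coefficients will be read off in a representation, and
    this turns their vanishing into vanishing in the quantum torus. *)
Lemma qsum_eq0 r : (forall e, \sum_(q <- r | q.2 == e) q.1 = 0) -> qsum r = 0.
Proof.
have [n] := ubnP (size r); elim: n r => // n IH [|[c e] r] le_r H.
  by rewrite /qsum big_nil.
rewrite /qsum (bigID (fun q => q.2 == e)) /= (eq_bigr (fun q => q.1 *: qmon e)) => [|q /eqP -> //].
rewrite -scaler_suml H scale0r add0r -big_filter; apply: IH => [|e'].
  rewrite /= eqxx /=; apply: leq_ltn_trans (size_subseq (filter_subseq _ _)) _.
  by move: le_r => /=.
rewrite big_filter_cond; case: (eqVneq e' e) => [-> | ee'].
  by rewrite big1 // => q /andP[/negPf ->].
rewrite -[RHS](H e'); apply: eq_bigl => q; case: (eqVneq q.2 e') => [-> | _]; last by rewrite andbF.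
by rewrite ee'.
Qed.

End NormalForm.

(** * Clock and shift matrices *)

Section ClockShift.
Variables (k : fieldType) (n : nat) (theta : k).
Hypothesis prim : n.+1.-primitive_root theta.

Definition clock : 'M[k]_n.+1 := \matrix_(i, j) ((i == j)%:R * theta ^+ i).
Definition shift : 'M[k]_n.+1 := \matrix_(i, j) ((i : nat) == j.+1 %% n.+1)%N%:R.

Lemma clockX m : clock ^+ m = \matrix_(i, j) ((i == j)%:R * theta ^+ (i * m)).
Proof.
elim: m => [|m IH]; first by apply/matrixP => i j; rewrite !mxE muln0 expr0 mulr1.
rewrite exprS IH -mulmxE; apply/matrixP => i j; rewrite !mxE (bigD1 i) //= big1.
  by rewrite !mxE eqxx mul1r addr0 mulrCA -exprD mulnS.
by move=> l li; rewrite !mxE eq_sym (negPf li) !mul0r.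
Qed.

Lemma shiftX m : shift ^+ m = \matrix_(i, j) ((i : nat) == (j + m) %% n.+1)%N%:R.
Proof.
elim: m => [|m IH].
  by apply/matrixP => i j; rewrite !mxE addn0 modn_small.
rewrite exprS IH -mulmxE; apply/matrixP => i j; rewrite !mxE.
rewrite (bigD1 (inord ((j + m) %% n.+1))) //= big1 => [|l].
  by rewrite !mxE inordK ?ltn_mod // eqxx mulr1 addr0 -(addn1 (_ %% _)) modnDml addn1 addnS.
rewrite -val_eqE /= inordK ?ltn_mod // => lj.
by rewrite !mxE (negPf lj) mulr0.
Qed.

Lemma clock_shift_pair : twisted_pair n.+1 theta clock shift.
Proof.
split=> //.
- apply/matrixP => i j; rewrite !mxE (bigD1 i) //= big1 => [|l li]; last first.
    by rewrite !mxE eq_sym (negPf li) !mul0r.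
  rewrite (bigD1 j) //= big1 => [|l lj]; last by rewrite !mxE (negPf lj) mul0r mulr0.
  rewrite !mxE !eqxx !mul1r !addr0 mulrC mulrCA.
  case: eqP => [-> | _]; last by rewrite !mul0r.
  by rewrite -exprS (prim_expr_mod prim).
- apply/matrixP => i j; rewrite clockX !mxE mulnC exprM (prim_expr_order prim) expr1n mulr1.
  by [].
apply/matrixP => i j; rewrite shiftX !mxE modnDr modn_small //.
Qed.

(* The commutant of the irreducible pair is the scalars, so each graded piece is a line. *)
Lemma clock_shift_line a b Y : homog theta clock shift a b Y ->
  exists c, Y = c *: (clock ^ a *m shift ^ b).
Proof.
have CS := clock_shift_pair; have th0 := theta_neq0 CS.
have uP : clock ^ a *m shift ^ b \is a GRing.unit.
  by rewrite mulmxE unitrMl; apply: unitrXz; [exact: unitA CS | exact: unitB CS].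
move=> [AY BY]; have [AP BP] := homog_monomial CS a b.
set P := clock ^ a *m shift ^ b in uP AP BP *.
(* Dividing by the monomial of the same degree leaves Z commuting with both matrices: the clock,
   with distinct eigenvalues, makes it diagonal, and the shift makes the diagonal constant. *)
have [Z YZ] : exists Z, Y = Z * P by exists (Y / P); rewrite mulrVK.
have com (C : 'M[k]_n.+1) mu : mu != 0 -> C *m Y = mu *: (Y *m C) -> C *m P = mu *: (P *m C) ->
    C * Z = Z * C.
  rewrite !mulmxE => mu0 CY CP; apply: (mulIr uP).
  by rewrite -[LHS]mulrA -YZ CY -[RHS]mulrA CP -scalerAr mulrA -YZ.
have AZ := com _ _ (expfz_neq0 b th0) AY AP; have BZ := com _ _ (expfz_neq0 (- a) th0) BY BP.
have Zoff i j : i != j -> Z i j = 0.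
  move=> ij; have := congr1 (fun M : 'M_n.+1 => M i j) AZ; rewrite -!mulmxE !mxE.
  rewrite (bigD1 i) //= big1 => [|l li]; last by rewrite !mxE eq_sym (negPf li) !mul0r.
  rewrite (bigD1 j) //= big1 => [|l lj]; last by rewrite !mxE (negPf lj) mul0r mulr0.
  rewrite !mxE !eqxx !mul1r !addr0 mulrC => /eqP; rewrite -subr_eq0 -mulrBr mulf_eq0.
  case/orP=> [/eqP // | ]; rewrite subr_eq0 (eq_prim_root_expr prim) !modn_small // => ij'.
  by case/eqP: ij; apply: val_inj; apply/eqP.
have Zdiag (m : nat) (lm : (m < n.+1)%N) : Z (Ordinal lm) (Ordinal lm) = Z 0 0.
  elim: m lm => [|m IH] lm; first by congr (Z _ _); apply: val_inj.
  have lm' : (m < n.+1)%N by apply: ltnW.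
  rewrite -(IH lm').
  have := congr1 (fun M : 'M_n.+1 => M (Ordinal lm) (Ordinal lm')) BZ; rewrite -!mulmxE !mxE.
  rewrite (bigD1 (Ordinal lm')) //= big1 => [|l li]; last by rewrite Zoff ?mulr0.
  rewrite (bigD1 (Ordinal lm)) //= big1 => [|l lj]; last by rewrite Zoff ?mul0r // eq_sym.
  by rewrite !mxE /= modn_small // eqxx mul1r mulr1 !addr0.
exists (Z 0 0); rewrite YZ; have -> : Z = (Z 0 0)%:M.
  apply/matrixP => i j; rewrite [RHS]mxE; case: (eqVneq i j) => [<- | ij]; last exact: Zoff.
  by case: i => m lm; rewrite Zdiag mulr1n.
by rewrite -mulmxE mul_scalar_mx !mxE mulr1n.
Qed.
End ClockShift.

(** * The quantum torus as matrices of Laurent monomials *)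

Section TorusRep.
Variables (k : fieldType) (T : torus_field k) (n m : nat) (theta : k) (h : theta != 0).
Hypotheses (char_k : [pchar k] =i pred0) (prim : n.+1.-primitive_root theta) (m_gt0 : (0 < m)%N).
Local Notation Q := (qtorus h).
Local Notation iota := (tf_const T).
Local Notation "X ^i" := (map_mx iota X) (at level 2, format "X ^i").
Local Notation A := (clock n theta).
Local Notation B := (shift k n).
Let CS : twisted_pair n.+1 theta A B := clock_shift_pair prim.

Definition sc : {rmorphism k -> 'M[T]_n.+1} := (@scalar_mx T n.+1 \o iota).

Definition qgen (x : T) (C : 'M[k]_n.+1) : 'M[T]_n.+1 := x *: C^i.

Let s := tf_s T ^+ m.
Let t := tf_t T ^+ m.

Definition qrep : Q -> 'M[T]_n.+1 :=
  @qmap k theta h _ sc (qgen s A) (qgen s^-1 A^-1) (qgen t B) (qgen t^-1 B^-1).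

Lemma qgenM x y C D : qgen x C * qgen y D = qgen (x * y) (C * D).
Proof. by rewrite /qgen -scalerAl -scalerAr scalerA -!mulmxE map_mxM. Qed.

Lemma qgen1 : qgen 1 1 = 1.
Proof. by rewrite /qgen scale1r map_mx1. Qed.

Lemma qgenX x C i : qgen x C ^+ i = qgen (x ^+ i) (C ^+ i).
Proof.
elim: i => [|i IH]; first by rewrite !expr0 qgen1.
by rewrite !exprS IH qgenM.
Qed.

Lemma scE c (M : 'M[T]_n.+1) : sc c * M = iota c *: M.
Proof. by rewrite -mulmxE mul_scalar_mx. Qed.

Let s0 : s != 0. Proof. by rewrite expf_neq0 // tf_s_neq0. Qed.
Let t0 : t != 0. Proof. by rewrite expf_neq0 // tf_t_neq0. Qed.
Let uA := unitA CS.
Let uB := unitB CS.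

Let scC c (M : 'M[T]_n.+1) : sc c * M = M * sc c.
Proof. by rewrite scE -mulmxE mul_mx_scalar. Qed.
Let r1 : qgen s A * qgen s^-1 A^-1 = 1. Proof. by rewrite qgenM !mulrV ?unitfE // qgen1. Qed.
Let r2 : qgen s^-1 A^-1 * qgen s A = 1. Proof. by rewrite qgenM !mulVr ?unitfE // qgen1. Qed.
Let r3 : qgen t B * qgen t^-1 B^-1 = 1. Proof. by rewrite qgenM !mulrV ?unitfE // qgen1. Qed.
Let r4 : qgen t^-1 B^-1 * qgen t B = 1. Proof. by rewrite qgenM !mulVr ?unitfE // qgen1. Qed.
Let r5 : qgen s A * qgen t B = sc theta * (qgen t B * qgen s A).
Proof.
rewrite !qgenM scE -!mulmxE (tp_comm CS) /qgen map_mxZ !scalerA.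
by rewrite mulrC [s * t]mulrC.
Qed.

Lemma qrepD x y : qrep (x + y) = qrep x + qrep y.
Proof. exact: (qmapD scC r1 r2 r3 r4 r5). Qed.

Lemma qrepM x y : qrep (x * y) = qrep x *m qrep y.
Proof. exact: (qmapM scC r1 r2 r3 r4 r5). Qed.

Lemma qrepZ c x : qrep (c *: x) = iota c *: qrep x.
Proof. by rewrite -scE; exact: (qmapZ scC r1 r2 r3 r4 r5). Qed.

Lemma qrep0 : qrep 0 = 0.
Proof. by rewrite -(scale0r 0) qrepZ rmorph0 scale0r. Qed.

Lemma qrep_mon e : qrep (qmon h e) =
  mono T (m%:Z * e.1) (m%:Z * e.2) *: (A ^ e.1 *m B ^ e.2)^i.
Proof.
have qrep1 : qrep 1 = 1 by exact: (@qmap1 _ _ h _ _ scC _ _ _ _ r1 r2 r3 r4 r5).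
have qrepX x i : qrep (x ^+ i) = qrep x ^+ i.
  by elim: i => [|i IH]; rewrite ?expr0 // !exprS qrepM IH.
have pw x x' (C : 'M[k]_n.+1) y z : qrep x = qgen y C -> qrep x' = qgen y^-1 C^-1 ->
    qrep (ipow x x' z) = qgen (y ^ z) (C ^ z).
  move=> xE x'E; case: z => i /=; rewrite qrepX ?xE ?x'E qgenX; first by rewrite -!exprnP.
  by rewrite NegzE -!exprnN !exprVn.
have gen w : qrep (qclass h w) = qeval sc (qgen s A) (qgen s^-1 A^-1) (qgen t B) (qgen t^-1 B^-1) w.
  exact: (@qmapE _ _ h _ _ scC _ _ _ _ r1 r2 r3 r4 r5).
rewrite /qmon qrepM (pw _ _ A s) ?gen // (pw _ _ B t) ?gen // mulmxE qgenM /qgen.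
by rewrite /mono /s /t !exprnP !exprz_exp mulmxE.
Qed.

(** Products of clock and shift repeat modulo the order, but the Laurent factors keep all exponents
    apart. One nonzero entry of the invertible matrix A^e1 B^e2 suffices to read off the total
    coefficient at e. *)
Lemma qrep_inj : injective qrep.
Proof.
move=> x y E; apply/eqP; rewrite -subr_eq0; apply/eqP.
have {E} : qrep (x - y) = 0.
  by rewrite qrepD -scaleN1r qrepZ rmorphN rmorph1 scaleN1r E subrr.
move: (x - y) => {x y} x; have [r ->] := qsum_span x => E.
apply: qsum_eq0 => e.
have uP : A ^ e.1 *m B ^ e.2 \is a GRing.unit.
  by rewrite mulmxE unitrMl; apply: unitrXz.
have /matrix0Pn[i [j Pij]] : A ^ e.1 *m B ^ e.2 != 0.
  by apply: contraTneq uP => ->; rewrite unitr0.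
pose P (q : k * (int * int)) := (A ^ q.2.1 *m B ^ q.2.2) i j.
pose r' := [seq (q.1 * P q, (m%:Z * q.2.1, m%:Z * q.2.2)) | q : k * (int * int) <- r].
have r'0 : \sum_(q <- r') iota q.1 * mono T q.2.1 q.2.2 = 0.
  transitivity (qrep (qsum h r) i j); last by rewrite E mxE.
  rewrite big_map /qsum; elim: (r) => [|q r1' IH]; first by rewrite !big_nil qrep0 mxE.
  rewrite !big_cons qrepD mxE -IH; congr (_ + _).
  rewrite qrepZ qrep_mon /= rmorphM -mulrA [iota (P q) * _]mulrC.
  by rewrite [RHS]mxE [X in _ = _ * X]mxE [X in _ = _ * (_ * X)]mxE.
have := mono_coef char_k (m%:Z * e.1, m%:Z * e.2) r'0; rewrite big_map /=.
have m0 : m%:Z != 0 by rewrite -lt0n.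
rewrite (eq_bigl (fun q => q.2 == e)) => [|q]; last first.
  by rewrite !xpair_eqE !(inj_eq (mulfI m0)); case: q.2 e {Pij uP P r' r'0} => [? ?] [? ?].
rewrite (eq_bigr (fun q => q.1 * (A ^ e.1 *m B ^ e.2) i j)) => [|q /eqP qe]; last by rewrite /P qe.
by rewrite -mulr_suml => /eqP; rewrite mulf_eq0 (negPf Pij) orbF => /eqP.
Qed.


End TorusRep.

Lemma sum_mxtens (V : nmodType) p q (F : 'I_(p * q) -> V) :
  \sum_x F x = \sum_i \sum_j F (mxtens_index (i, j)).
Proof.
rewrite pair_big; rewrite (reindex (@mxtens_index p q)) /=.
  by apply: eq_bigr => -[].
by exists (@mxtens_unindex p q) => x _; rewrite (mxtens_indexK, mxtens_unindexK).
Qed.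

Lemma tensmxZr (R : comPzRingType) p q r s (X : 'M[R]_(p, q)) (Y : 'M[R]_(r, s)) c :
  X *t (c *: Y) = c *: (X *t Y).
Proof. by apply/matrixP => i j; rewrite !mxE mulrCA. Qed.

Lemma tensmx11 (R : comPzRingType) p q : 1%:M *t 1%:M = 1%:M :> 'M[R]_(p * q).
Proof.
apply/matrixP => i j; case: (mxtens_indexP i) => i0 i1; case: (mxtens_indexP j) => j0 j1.
rewrite tensmxE !mxE -natrM mulnb (inj_eq (can_inj (@mxtens_indexK p q))) xpair_eqE.
by [].
Qed.

(** * Matrices over the quantum torus as block matrices *)

Section BlockRep.
Variables (k : fieldType) (T : torus_field k) (g n m : nat) (theta : k) (h : theta != 0).
Hypotheses (char_k : [pchar k] =i pred0) (prim : n.+1.-primitive_root theta) (m_gt0 : (0 < m)%N).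
Local Notation Q := (qtorus h).
Local Notation iota := (tf_const T).
Local Notation "X ^i" := (map_mx iota X) (at level 2, format "X ^i").
Local Notation A := (clock n theta).
Local Notation B := (shift k n).
(** [N.+1] is convertible to [g.+1 * n.+1], so Kronecker products are square matrices of successor
    size, as the preceding sections require. *)
Local Notation N := (n + g * n.+1)%N.
Local Notation idx i p := (@mxtens_index g.+1 n.+1 (i, p)).
Local Notation qrep := (@qrep k T n m theta h).
Let CS : twisted_pair n.+1 theta A B := clock_shift_pair prim.

Definition bigA : 'M[k]_N.+1 := (1%:M : 'M[k]_g.+1) *t A.
Definition bigB : 'M[k]_N.+1 := (1%:M : 'M[k]_g.+1) *t B.

Lemma tensM (U V : 'M[k]_g.+1) (C D : 'M[k]_n.+1) :
  (U *t C : 'M[k]_N.+1) *m (V *t D : 'M[k]_N.+1) = ((U *m V) *t (C *m D) : 'M[k]_N.+1).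
Proof. exact: (@tensmx_mul k g.+1 g.+1 n.+1 n.+1 g.+1 n.+1 U C V D). Qed.

Lemma tensZr (U : 'M[k]_g.+1) (C : 'M[k]_n.+1) c :
  (U *t (c *: C) : 'M[k]_N.+1) = c *: (U *t C : 'M[k]_N.+1).
Proof. exact: (@tensmxZr k g.+1 g.+1 n.+1 n.+1). Qed.

Lemma big_pair : twisted_pair n.+1 theta bigA bigB.
Proof.
have tX (C : 'M[k]_n.+1) i : ((1%:M : 'M[k]_g.+1) *t C : 'M[k]_N.+1) ^+ i = (1%:M : 'M[k]_g.+1) *t (C ^+ i).
  elim: i => [|i IH]; first by rewrite !expr0; exact: (esym (@tensmx11 k g.+1 n.+1)).
  rewrite !exprS IH -!mulmxE; rewrite tensM.
  by rewrite mul1mx.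
split=> //.
- by rewrite /bigA /bigB !tensM (tp_comm CS) tensZr.
- by rewrite tX (tp_A CS); exact: (@tensmx11 k g.+1 n.+1).
by rewrite tX (tp_B CS); exact: (@tensmx11 k g.+1 n.+1).
Qed.

Definition block (X : 'M[k]_N.+1) i j : 'M[k]_n.+1 := \matrix_(p, q) X (idx i p) (idx j q).

Lemma block_mull (C : 'M[k]_n.+1) (X : 'M[k]_N.+1) i j :
  block (((1%:M : 'M[k]_g.+1) *t C : 'M[k]_N.+1) *m X) i j = C *m block X i j.
Proof.
apply/matrixP => p q; rewrite !mxE.
transitivity (\sum_(x < g.+1 * n.+1) ((1%:M : 'M[k]_g.+1) *t C) (idx i p) x * X x (idx j q)) => //.
rewrite sum_mxtens (bigD1 i) //= [X in _ + X]big1 ?addr0 => [|l li].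
  by apply: eq_bigr => r _; rewrite tensmxE !mxE eqxx mul1r.
by apply: big1 => r _; rewrite tensmxE !mxE eq_sym (negPf li) !mul0r.
Qed.

Lemma block_mulr (C : 'M[k]_n.+1) (X : 'M[k]_N.+1) i j :
  block (X *m ((1%:M : 'M[k]_g.+1) *t C : 'M[k]_N.+1)) i j = block X i j *m C.
Proof.
apply/matrixP => p q; rewrite !mxE.
transitivity (\sum_(x < g.+1 * n.+1) X (idx i p) x * ((1%:M : 'M[k]_g.+1) *t C) x (idx j q)) => //.
rewrite sum_mxtens (bigD1 j) //= [X in _ + X]big1 ?addr0 => [|l lj].
  by apply: eq_bigr => r _; rewrite tensmxE !mxE eqxx mul1r.
by apply: big1 => r _; rewrite tensmxE !mxE (negPf lj) mul0r mulr0.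
Qed.

Lemma blockZ c X i j : block (c *: X) i j = c *: block X i j.
Proof. by apply/matrixP => p q; rewrite !mxE. Qed.

Lemma block_homog a b X i j : homog theta bigA bigB a b X -> homog theta A B a b (block X i j).
Proof.
by move=> [AX BX]; split; rewrite -block_mull -block_mulr -blockZ; congr (block _ i j).
Qed.

Lemma tens_homog a b (U : 'M[k]_g.+1) :
  homog theta bigA bigB a b (U *t (A ^ a *m B ^ b) : 'M[k]_N.+1).
Proof.
have [AP BP] := homog_monomial CS a b.
by split; rewrite /bigA /bigB !tensM mul1mx mulmx1 (AP, BP) tensZr.
Qed.

Definition bmap (M : 'M[Q]_g.+1) : 'M[T]_N.+1 :=
  \matrix_(i < g.+1 * n.+1, j < g.+1 * n.+1)
    qrep (M (mxtens_unindex i).1 (mxtens_unindex j).1) (mxtens_unindex i).2 (mxtens_unindex j).2.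

Lemma bmapE M i j p q : bmap M (idx i p) (idx j q) = qrep (M i j) p q.
Proof. by rewrite mxE !mxtens_indexK. Qed.

Lemma bmapP (Y Z : 'M[T]_N.+1) :
  (forall i j p q, Y (idx i p) (idx j q) = Z (idx i p) (idx j q)) -> Y = Z.
Proof.
move=> H; apply/matrixP => x y.
by case: (mxtens_indexP (x : 'I_(g.+1 * n.+1))) => i p; case: (mxtens_indexP (y : 'I_(g.+1 * n.+1))).
Qed.

Lemma bmapD M M' : bmap (M + M') = bmap M + bmap M'.
Proof.
by apply: bmapP => i j p q; rewrite bmapE [RHS]mxE !bmapE mxE (qrepD T m prim) mxE.
Qed.

Lemma bmapM M M' : bmap (M *m M') = bmap M *m bmap M'.
Proof.
apply: bmapP => i j p q; rewrite bmapE !mxE.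
have qrep_sum (F : 'I_g.+1 -> Q) : qrep (\sum_l F l) = \sum_l qrep (F l).
  by apply: big_morph => [x y|]; [exact: (qrepD T m prim) | exact: (qrep0 T m h prim)].
rewrite qrep_sum summxE.
transitivity (\sum_(x < g.+1 * n.+1) bmap M (idx i p) x * bmap M' x (idx j q)) => //.
rewrite sum_mxtens; apply: eq_bigr => l _.
by rewrite (qrepM T m prim) mxE; apply: eq_bigr => r _; rewrite !bmapE.
Qed.

Lemma bmapZ c (M : mxalg g.+1 Q) : bmap (c *: M : mxalg g.+1 Q) = iota c *: bmap M.
Proof.
by apply: bmapP => i j p q; rewrite bmapE [RHS]mxE !bmapE mxE (qrepZ T m prim) mxE.
Qed.

Lemma bmap_inj : injective bmap.
Proof.
move=> M M' E; apply/matrixP => i j; apply: (qrep_inj (T := T) char_k prim m_gt0).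
by apply/matrixP => p q; rewrite -!bmapE E.
Qed.

Lemma bmap0 : bmap 0 = 0.
Proof. by apply: bmapP => i j p q; rewrite bmapE !mxE (qrep0 T m h prim) mxE. Qed.

(** The analogue of [loop] for gl: it receives all of [bmap], and brackets of its elements are
    traceless and so land in [loop]. *)
Definition gloop (Y : 'M[T]_N.+1) := exists r : seq ('M[k]_N.+1 * (int * int)),
  (forall q, q \in r -> homog theta bigA bigB q.2.1 q.2.2 q.1) /\
  Y = \sum_(q <- r) mono T (m%:Z * q.2.1) (m%:Z * q.2.2) *: map_mx iota q.1.

Lemma tensE (U : 'M[k]_g.+1) (C : 'M[k]_n.+1) i j p q :
  (U *t C : 'M[k]_N.+1) (idx i p) (idx j q) = U i j * C p q.
Proof. by rewrite mxE !mxtens_indexK. Qed.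

Lemma gloop_bmap M : gloop (bmap M).
Proof.
have g0 : gloop 0 by exists [::]; rewrite big_nil.
have gD Y Z : gloop Y -> gloop Z -> gloop (Y + Z).
  move=> [r [hr ->]] [r' [hr' ->]]; exists (r ++ r'); rewrite big_cat; split=> // q.
  by rewrite mem_cat => /orP[/hr | /hr'].
pose F i j x : 'M[Q]_g.+1 := \matrix_(i', j') if (i' == i) && (j' == j) then x else 0.
have FD i j x y : F i j (x + y) = F i j x + F i j y.
  by apply/matrixP => i' j'; rewrite !mxE; case: ifP; rewrite ?addr0.
have F0 i j : F i j 0 = 0 by apply/matrixP => i' j'; rewrite !mxE; case: ifP.
have bsum (I : Type) (r : seq I) (G : I -> 'M[Q]_g.+1) : (forall i, gloop (bmap (G i))) ->
    gloop (bmap (\sum_(i <- r) G i)).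
  move=> HG; elim: r => [|i r IH]; first by rewrite big_nil bmap0.
  by rewrite big_cons bmapD; apply: gD.
have -> : M = \sum_i \sum_j F i j (M i j).
  apply/matrixP => i j; rewrite summxE (bigD1 i) //= summxE (bigD1 j) //= big1 => [|l lj].
    rewrite big1 ?addr0 => [|l li]; first by rewrite mxE !eqxx.
    by rewrite summxE big1 // => l' _; rewrite mxE eq_sym (negPf li).
  by rewrite mxE [j == l]eq_sym (negPf lj) andbF.
apply: (bsum) => i; apply: (bsum) => j; have [r ->] := qsum_span (M i j).
have -> : F i j (qsum h r) = \sum_(q <- r) F i j (q.1 *: qmon h q.2).
  rewrite /qsum; elim: r => [|q r IH]; first by rewrite !big_nil F0.
  by rewrite !big_cons FD IH.
apply: bsum => -[c e]; exists [:: (delta_mx i j *t (c *: (A ^ e.1 *m B ^ e.2)), e)].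
split=> [q|].
  rewrite inE => /eqP -> /=; rewrite tensmxZr -[_ *: _]addr0.
  by apply: homog_lin; [exact: tens_homog | exact: homog0].
rewrite big_seq1 /=; apply: bmapP => i' j' p q.
rewrite bmapE [RHS]mxE [X in _ = _ * X]mxE tensE !mxE; case: ifP => _ /=.
  rewrite mulr1n mul1r (qrepZ T m prim) (qrep_mon T m h prim).
  by rewrite /= mxE [X in _ * X]mxE [X in _ * (_ * X)]mxE [X in _ * (_ * _ X)]mxE mulrCA rmorphM.
by rewrite mulr0n mul0r rmorph0 mulr0 (qrep0 T m h prim) mxE.
Qed.

(** [bigA] and [bigB] are block scalar, so every block of X is homogeneous for clock and shift,
    hence a multiple of one monomial. *)
Lemma bmap_homog a b X : homog theta bigA bigB a b X ->
  exists M, bmap M = mono T (m%:Z * a) (m%:Z * b) *: X^i.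
Proof.
move=> hX.
have : forall ij : 'I_g.+1 * 'I_g.+1, exists c, block X ij.1 ij.2 = c *: (A ^ a *m B ^ b).
  by move=> ij; apply: (clock_shift_line prim); apply: block_homog.
move=> /choice[c Hc]; exists (\matrix_(i, j) (c (i, j) *: qmon h (a, b))).
apply: bmapP => i j p q; rewrite bmapE mxE (qrepZ T m prim) (qrep_mon T m h prim) /= !mxE.
have := congr1 (fun M : 'M_n.+1 => M p q) (Hc (i, j)); rewrite !mxE /= => ->.
by rewrite rmorphM mulrCA.
Qed.

End BlockRep.

Section SpecialLinearRep.
Variables (k : fieldType) (T : torus_field k) (g n m : nat) (theta : k) (h : theta != 0).
Hypotheses (char_k : [pchar k] =i pred0) (prim : n.+1.-primitive_root theta) (m_gt0 : (0 < m)%N).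
Local Notation Q := (qtorus h).
Local Notation iota := (tf_const T).
Local Notation mono := (@mono k T).
Local Notation "X ^i" := (map_mx iota X) (at level 2, format "X ^i").
Local Notation N := (n + g * n.+1)%N.
Local Notation bigA := (bigA g n theta).
Local Notation bigB := (bigB k g n).
Local Notation homog := (homog theta bigA bigB).
Local Notation loop := (@loop k T N theta bigA bigB m).
Local Notation gloop := (@gloop k T g n m theta).
Local Notation L := (sl g.+1 Q).
Let AB : twisted_pair n.+1 theta bigA bigB := big_pair g prim.

Lemma mxbr_map (X Y : 'M[k]_N.+1) : mxbr X^i Y^i = (mxbr X Y)^i.
Proof. by rewrite /mxbr map_mxB !map_mxM. Qed.

Lemma mxbrZZ (x y : T) (X Y : 'M[T]_N.+1) : mxbr (x *: X) (y *: Y) = (x * y) *: mxbr X Y.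
Proof.
rewrite /mxbr -!scalemxAl; rewrite -!scalemxAr.
by rewrite !scalerA [y * x]mulrC -scalerBr.
Qed.

Lemma gloop_mxbr Y Z : gloop Y -> gloop Z -> loop (mxbr Y Z).
Proof.
have l0 : loop 0 := @loop0 k T N theta bigA bigB m.
have mxbr0 W : mxbr W (0 : 'M[T]_N.+1) = 0 by rewrite /mxbr mul0mx mulmx0 subrr.
move=> [r [hr ->]] [r' [hr' ->]]; elim: r hr => [|q r IH] hr.
  by rewrite big_nil mxbrC mxbr0 oppr0.
rewrite big_cons mxbr_linl; apply: loopD; last first.
  by apply: IH => q' q'r; apply: hr; rewrite inE q'r orbT.
have hq := hr q (mem_head _ _).
elim: r' hr' {IH} => [|q' r' IH'] hr'; first by rewrite big_nil mxbr0 scaler0.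
rewrite big_cons mxbr_linr scalerDr; apply: loopD; last first.
  by apply: IH' => q'' q''r; apply: hr'; rewrite inE q''r orbT.
rewrite mxbr_map scalerA -monoD -!mulrDr; apply: loop_mono; last exact: mxbr_trace.
by apply: (homog_mxbr AB hq); apply: hr'; apply: mem_head.
Qed.

Definition slrep (x : L) : 'M[T]_N.+1 := bmap T n m (derived_val x : 'M[Q]_g.+1).

Lemma bmap_lie (M M' : gl g.+1 Q) :
  bmap T n m (lie M M' : 'M[Q]_g.+1) = mxbr (bmap T n m (M : 'M[Q]_g.+1)) (bmap T n m (M' : 'M[Q]_g.+1)).
Proof.
pose bD := @bmapD k T g n m theta h prim; pose bM := @bmapM k T g n m theta h prim.
rewrite -[lie M M']/((M : mxalg _ _) *m M' + - ((M' : mxalg _ _) *m M)) bD bM; congr (_ + _).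
rewrite -bM; apply/eqP; rewrite -addr_eq0; apply/eqP.
rewrite -[LHS]bD addNr; exact: (@bmap0 k T g n m theta h prim).
Qed.

Lemma slrep_lin a x y : slrep (a *: x + y) = iota a *: slrep x + slrep y.
Proof.
rewrite -(@bmapZ k T g n m theta h prim).
exact: (@bmapD k T g n m theta h prim).
Qed.

Lemma slrep_loop x : loop (slrep x).
Proof.
case: x => M; rewrite /slrep /=; case/derived_memP => l [c [a [b ->]]].
elim/big_ind: _ => [|X Y hX hY|i _].
- by rewrite (@bmap0 k T g n m theta h prim); apply: loop0.
- by rewrite (@bmapD k T g n m theta h prim); apply: loopD.
rewrite (@bmapZ k T g n m theta h prim) bmap_lie; apply: loopZ.
by apply: gloop_mxbr; apply: gloop_bmap.
Qed.

(** A traceless X is a combination of brackets, and these are sums of brackets of homogeneous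
    matrices. Those of degree congruent to (a, b) come from commutators over the quantum torus; the
    others have no component in degree (a, b). *)
Lemma slrep_surj Y : loop Y -> exists x, slrep x = Y.
Proof.
have s0 : slrep 0 = 0 by exact: (@bmap0 k T g n m theta h prim).
elim/loop_ind => [|a b X {}Y hX trX [y <-]]; first by exists 0.
suff [x xE] : exists x, slrep x = mono (m%:Z * a) (m%:Z * b) *: X^i.
  by exists (1 *: x + y); rewrite slrep_lin xE rmorph1 scale1r.
(* Projecting to degree (a, b) makes the claim meaningful and linear for arbitrary W, in particular
   for matrix units, which are not homogeneous. *)
pose P W := exists x, slrep x = mono (m%:Z * a) (m%:Z * b) *: (gproj n.+1 theta bigA bigB a b W)^i.
suff : P X by rewrite /P (gproj_of_homog char_k AB _ _ hX) !eqxx scale1r.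
have Plin e U V : P U -> P V -> P (e *: U + V).
  move=> [x xE] [z zE]; exists (e *: x + z).
  rewrite slrep_lin xE zE gproj_lin.
  move: (gproj _ _ _ _ _ _ U) (gproj _ _ _ _ _ _ V) => U' V'.
  by rewrite map_mxD map_mxZ scalerDr !scalerA [iota e * _]mulrC.
have gp0 : gproj n.+1 theta bigA bigB a b 0 = 0.
  by have := gproj_lin n.+1 theta bigA bigB a b (-1) 0 0; rewrite scaler0 addr0 scaleN1r addNr.
have P0 : P 0 by exists 0; rewrite gp0 map_mx0 scaler0.
have Phom c d c' d' U V : homog c d U -> homog c' d' V -> P (mxbr U V).
  move=> hU hV; rewrite /P (gproj_of_homog char_k AB _ _ (homog_mxbr AB hU hV)).
  case: andP => [[/eqP Ec /eqP Ed] | _]; last by exists 0; rewrite scale0r map_mx0 scaler0.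
  have th0 := theta_neq0 AB.
  (* The degree of V matters only modulo the order; this representative makes the exponents add up
     to (a, b) exactly. *)
  have {}hV : homog (a - c) (b - d) V.
    apply: homog_congr hV; rewrite expfzDr // -(Ec, Ed) expfzDr // mulrAC -expfzDr //.
      by rewrite subrr mul1r.
    by rewrite subrr mul1r.
  have [M ME] := @bmap_homog k T g n m theta h prim _ _ _ hU; have [M' ME'] := @bmap_homog k T g n m theta h prim _ _ _ hV.
  exists (Derived (lie_derived_mem (M : gl g.+1 Q) M')).
  rewrite [LHS]bmap_lie ME ME' /= mulr1n scale1r -mxbr_map.
  by rewrite mxbrZZ -monoD -!mulrDr !subrKC.
clearbody P; have Pbr U V : P (mxbr U V).
  have PD W Z : P W -> P Z -> P (W + Z) by rewrite -{2}[W]scale1r; apply: Plin.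
  have mxbr0 W : mxbr W (0 : 'M[k]_N.+1) = 0 by rewrite /mxbr mul0mx mulmx0 subrr.
  have PDl W Z Z' : P (mxbr W Z) -> P (mxbr W Z') -> P (mxbr W (Z + Z')).
    by rewrite -{2}[Z]scale1r mxbr_linr; apply: Plin.
  have mxbrN W Z : P (mxbr W Z) -> P (mxbr Z W).
    by rewrite mxbrC -scaleN1r -[_ *: _]addr0 => /(Plin (-1) _ 0); rewrite !addr0 scalerA mulrNN mulr1 scale1r; apply.
  rewrite -[V](gproj_sum char_k AB).
  apply: (big_ind (fun V => P (mxbr U V))) => [||c _]; rewrite ?mxbr0 //; first exact: PDl.
  apply: (big_ind (fun V => P (mxbr U V))) => [||d _]; rewrite ?mxbr0 //; first exact: PDl.
  apply: mxbrN; rewrite -[U](gproj_sum char_k AB); move: (gproj_homog char_k AB c d V).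
  move: (gproj _ _ _ _ _ _ V) => W hW.
  apply: (big_ind (fun U => P (mxbr W U))) => [||c' _]; rewrite ?mxbr0 //; first exact: PDl.
  apply: (big_ind (fun U => P (mxbr W U))) => [||d' _]; rewrite ?mxbr0 //; first exact: PDl.
  by apply: Phom hW (gproj_homog char_k AB c' d' U).
move: X trX {hX}; apply: traceless_ind => // [i j ij | i].
  by have := Pbr (delta_mx i i) (delta_mx i j); rewrite mxbr_delta eqxx eq_sym (negPf ij) subr0.
by have := Pbr (delta_mx i 0) (delta_mx 0 i); rewrite mxbr_delta !eqxx.
Qed.

Lemma sl_loop_rep : loop_rep theta bigA bigB m slrep.
Proof.
split; [exact: slrep_lin | by move=> x y; apply: bmap_lie | | exact: slrep_loop | exact: slrep_surj].
by move=> x y /(bmap_inj char_k prim m_gt0) xy; apply: val_inj.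
Qed.

End SpecialLinearRep.

(** * Isomorphisms of matrix algebras and of their derived Lie algebras *)

Lemma pack_linear (K : pzRingType) (U V : lmodType K) (f : U -> V) :
  linear f -> exists phi : {linear U -> V}, phi =1 f.
Proof.
move=> flin; pose phi : {linear U -> V} := HB.pack f (GRing.isLinear.Build K U V _ f flin).
by exists phi.
Qed.

Lemma pack_rmorphism (R S : pzRingType) (f : R -> S) :
  zmod_morphism f -> monoid_morphism f -> exists phi : {rmorphism R -> S}, phi =1 f.
Proof.
move=> fadd fmul.
pose phi : {rmorphism R -> S} := HB.pack f (GRing.isZmodMorphism.Build R S f fadd)
  (GRing.isMonoidMorphism.Build R S f fmul).
by exists phi.
Qed.

Lemma lie_isomorphic_inverse (K : fieldType) (L1 L2 : lieAlgType K) : lie_isomorphic L1 L2 ->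
  exists (phi : {linear L1 -> L2}) (phi' : {linear L2 -> L1}),
    [/\ {morph phi : x y / lie x y}, {morph phi' : x y / lie x y},
        cancel phi phi' & cancel phi' phi].
Proof.
move=> [phi [phi_lie [f phiK fK]]]; have flin : linear f := can2_linear phiK fK.
have [phi' phi'E] := pack_linear flin.
exists phi, phi'; split=> // [x y | x | x]; rewrite ?phi'E ?fK ?phiK //.
by apply: (can_inj phiK); rewrite phi_lie !fK.
Qed.

Lemma mxalg_lie_isomorphic (K : fieldType) g1 g2 (A1 A2 : algType K) :
  mxalg_isomorphic g1 g2 A1 A2 -> lie_isomorphic (sl g1 A1) (sl g2 A2).
Proof.
move=> [f [fZ [f' fK f'K]]].
have f'Z : scalable f' by move=> c x; apply: (can_inj fK); rewrite fZ !f'K.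
have f'D : {morph f' : x y / x + y} by move=> x y; apply: (can_inj fK); rewrite rmorphD !f'K.
have f'B : {morph f' : x y / x - y} by move=> x y; apply: (can_inj fK); rewrite rmorphB !f'K.
have f'M : {morph f' : x y / x * y} by move=> x y; apply: (can_inj fK); rewrite rmorphM !f'K.
have f0 : f' 0 = 0 by rewrite -[0](rmorph0 f) fK.
have der a b (A : algType K) (A' : algType K) (u : mxalg a A -> mxalg b A') :
    u 0 = 0 -> {morph u : x y / x + y} -> {morph u : x y / x - y} -> {morph u : x y / x * y} ->
    scalable u -> forall x : sl a A, (u (derived_val x) : gl b A') \in @derived_mem K (gl b A').
  move=> u0 uD uB uM uZ [M /= /derived_memP[n [c [p [q ->]]]]].
  apply/derived_memP; exists n, c, (fun i => u (p i)), (fun i => u (q i)).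
  rewrite (big_morph u uD u0); apply: eq_bigr => i _; rewrite uZ; congr (_ *: _).
  by rewrite -[lie (p i) (q i)]/((p i : mxalg a A) * (q i : mxalg a A) - (q i : mxalg a A) * (p i : mxalg a A)) uB !uM.
have fD (x : sl g1 A1) : (f (derived_val x) : gl g2 A2) \in @derived_mem K (gl g2 A2).
  by apply: der => //; [exact: rmorph0 | exact: rmorphD | exact: rmorphB | exact: rmorphM].
have f'D' (x : sl g2 A2) : (f' (derived_val x) : gl g1 A1) \in @derived_mem K (gl g1 A1) by apply: der.
have lin : linear (fun x : sl g1 A1 => Derived (fD x) : sl g2 A2).
  by move=> c x y; apply: val_inj; rewrite /= rmorphD fZ.
have [phi phiE] := pack_linear lin; exists phi; split.
  by move=> x y; apply: val_inj; rewrite !phiE /= rmorphB !rmorphM.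
exists (fun x => Derived (f'D' x)) => x; apply: val_inj; rewrite ?phiE /= ?phiE //=.
Qed.

(** * The isomorphism that exchanges the generators *)

Section Swap.
Variables (k : fieldType) (theta1 theta2 : k) (h1 : theta1 != 0) (h2 : theta2 != 0).
Hypothesis theta12 : theta1 = theta2^-1.
Local Notation X1 := (qclass h2 (QX1 k)).
Local Notation X2 := (qclass h2 (QX2 k)).
Local Notation X1' := (qclass h2 (QX1inv k)).
Local Notation X2' := (qclass h2 (QX2inv k)).

Definition qswap : qtorus h1 -> qtorus h2 :=
  @qmap k theta1 h1 _ (in_alg (qtorus h2)) X2 X2' X1 X1'.

Let central c r : in_alg (qtorus h2) c * r = r * in_alg (qtorus h2) c.
Proof. by rewrite mulr_algl mulr_algr. Qed.

Let swapped : X2 * X1 = in_alg (qtorus h2) theta1 * (X1 * X2).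
Proof. by rewrite mulr_algl theta12 qX2X1. Qed.

Lemma qswapE t : qswap (qclass h1 t) = qeval (in_alg (qtorus h2)) X2 X2' X1 X1' t.
Proof. exact: (qmapE h1 central (qX2V h2) (qVX2 h2) (qX1V h2) (qVX1 h2) swapped). Qed.

Lemma qswapD : {morph qswap : x y / x + y}.
Proof. exact: (qmapD central (qX2V h2) (qVX2 h2) (qX1V h2) (qVX1 h2) swapped). Qed.

Lemma qswapM : {morph qswap : x y / x * y}.
Proof. exact: (qmapM central (qX2V h2) (qVX2 h2) (qX1V h2) (qVX1 h2) swapped). Qed.

Lemma qswapZ : scalable qswap.
Proof.
move=> c x; rewrite -[RHS]mulr_algl.
exact: (qmapZ central (qX2V h2) (qVX2 h2) (qX1V h2) (qVX1 h2) swapped).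
Qed.

Lemma qswap1 : qswap 1 = 1.
Proof. exact: (qmap1 h1 central (qX2V h2) (qVX2 h2) (qX1V h2) (qVX1 h2) swapped). Qed.

End Swap.
Arguments qswap {k theta1 theta2} h1 h2 x.

Lemma qswapK (k : fieldType) (theta1 theta2 : k) (h1 : theta1 != 0) (h2 : theta2 != 0) :
  theta1 = theta2^-1 -> cancel (qswap h1 h2) (qswap h2 h1).
Proof.
move=> E12; have E21 : theta2 = theta1^-1 by rewrite E12 invrK.
have sE := @qswapE k theta1 theta2 h1 h2 E12; have sE' := @qswapE k theta2 theta1 h2 h1 E21.
elim/qclass_ind; elim => [||||||t IH|t IHt w IHw|t IHt w IHw|c t IH].
- by rewrite sE; apply: (sE' (QX2 k)).
- by rewrite sE; apply: (sE' (QX1 k)).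
- by rewrite sE; apply: (sE' (QX2inv k)).
- by rewrite sE; apply: (sE' (QX1inv k)).
- by rewrite -[qclass h1 _](scale0r (0 : qtorus h1)) !qswapZ // !scale0r.
- by rewrite -[qclass h1 _]/(1 : qtorus h1) !qswap1.
- have -> : qclass h1 (QOpp t) = (-1) *: qclass h1 t by rewrite scaleN1r; symmetry; apply: qoppE.
  by rewrite !qswapZ // IH.
- have -> : qclass h1 (QAdd t w) = qclass h1 t + qclass h1 w by symmetry; apply: qaddE.
  by rewrite !qswapD // IHt IHw.
- have -> : qclass h1 (QMul t w) = qclass h1 t * qclass h1 w by symmetry; apply: qmulE.
  by rewrite !qswapM // IHt IHw.
have -> : qclass h1 (QScale c t) = c *: qclass h1 t by symmetry; apply: qscaleE.
by rewrite !qswapZ // IH.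
Qed.

Lemma mxalg_swap (k : fieldType) (theta1 theta2 : k) (h1 : theta1 != 0) (h2 : theta2 != 0) g :
  theta1 = theta2^-1 -> mxalg_isomorphic g g (qtorus h1) (qtorus h2).
Proof.
move=> E12; have E21 : theta2 = theta1^-1 by rewrite E12 invrK.
have s0 : qswap h1 h2 0 = 0 by rewrite -(scale0r 0) qswapZ // scale0r.
have sB : zmod_morphism (qswap h1 h2).
  by move=> x y; rewrite -scaleN1r qswapD // qswapZ // scaleN1r.
pose F (M : mxalg g (qtorus h1)) : mxalg g (qtorus h2) := map_mx (qswap h1 h2) M.
have FB : zmod_morphism F by move=> M M'; apply/matrixP => i j; rewrite !mxE sB.
have FM : monoid_morphism F.
  split; first by apply/matrixP => i j; rewrite !mxE; case: eqP => _; rewrite ?qswap1.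
  move=> M M'; apply/matrixP => i j; rewrite !mxE.
  rewrite (big_morph _ (@qswapD k theta1 theta2 h1 h2 E12) s0).
  by apply: eq_bigr => l _; rewrite !mxE qswapM.
have [phi phiE] := pack_rmorphism FB FM; exists phi; split.
  by move=> c M; rewrite !phiE; apply/matrixP => i j; rewrite !mxE qswapZ.
exists (fun M => map_mx (qswap h2 h1) M) => M; rewrite ?phiE; apply/matrixP => i j; rewrite !mxE.
  by rewrite qswapK.
by rewrite qswapK.
Qed.

(** Each parameter, up to inversion, is a power of the other, so the orders divide each other. Once
    they agree, theta1 = theta2^q1, so theta1^q1 = theta2^(q1^2) is theta1 or its inverse; with
    theta2 = theta1^r, raising to the power r gives theta1 = (theta1^q1)^r, which is theta2 or its
    inverse. *)
Lemma root_orders (k : fieldType) n1 n2 (theta1 theta2 eta1 eta2 : k) q1 q2 :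
  n1.-primitive_root theta1 -> n2.-primitive_root theta2 ->
  [/\ eta1 ^+ n2 = theta1, eta1 ^+ n1 = theta2 ^+ q1 &
      theta2 ^+ (q1 * q1) = theta1 \/ theta2 ^+ (q1 * q1) = theta1^-1] ->
  [/\ eta2 ^+ n1 = theta2, eta2 ^+ n2 = theta1 ^+ q2 &
      theta1 ^+ (q2 * q2) = theta2 \/ theta1 ^+ (q2 * q2) = theta2^-1] ->
  n1 = n2 /\ (theta1 = theta2 \/ theta1 = theta2^-1).
Proof.
move=> P1 P2 [e1 e2 Q1] [e1' e2' Q2].
have dv n n' (theta theta' : k) q : n.-primitive_root theta -> n'.-primitive_root theta' ->
    theta' ^+ (q * q) = theta \/ theta' ^+ (q * q) = theta^-1 -> (n %| n')%N.
  move=> P P' Q; rewrite (prim_order_dvd P).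
  have X1 : (theta' ^+ (q * q)) ^+ n' = 1.
    by rewrite -exprM mulnC exprM (prim_expr_order P') expr1n.
  by case: Q X1 => -> /eqP; rewrite ?exprVn ?invr_eq1.
have n12 : n1 = n2 by apply/eqP; rewrite eqn_dvd (dv _ _ _ _ _ P1 P2 Q1) (dv _ _ _ _ _ P2 P1 Q2).
split=> //; rewrite n12 in P1 e2 *; have E : theta1 = theta2 ^+ q1 by rewrite -e1 e2.
have [r rE] := prim_rootP P1 (prim_expr_order P2).
have E' : theta1 = (theta1 ^+ q1) ^+ r by rewrite -exprM mulnC exprM -rE.
have : theta1 ^+ q1 = theta1 \/ theta1 ^+ q1 = theta1^-1 by rewrite {1 3}E -exprM.
case=> Eq; rewrite Eq in E'; [left | right]; rewrite {1}E' rE //.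
by rewrite exprVn.
Qed.

(** * Recovering the size and the parameter from the Lie algebra *)

Section Main.
Variables (k : closedFieldType) (char_k : [pchar k] =i pred0).

(** Lets an isomorphism detect the degenerate case in which the block matrices have size 1. *)
Lemma sl_nonzero g n (theta : k) (h : theta != 0) : n.+1.-primitive_root theta ->
  (exists x : sl g.+1 (qtorus h), x != 0) <-> (0 < n + g * n.+1)%N.
Proof.
move=> prim; pose T := rational_torus_field k; have AB := big_pair g prim.
have rep := sl_loop_rep T g h char_k prim (m := 1) isT.
split=> [[x] | N_gt0].
  have dim0 N (M : 'M[T]_N.+1) : N = 0%N -> \tr M = 0 -> M = 0.
    by case: N M => // M _; rewrite [M]mx11_scalar mxtrace_scalar mulr1n => ->; exact: raddf0.
  apply: contraNT; rewrite -eqn0Ngt => /eqP N0; apply/eqP/(lr_eq0 rep).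
  by apply: (dim0 _ _ N0); apply: lr_trace rep x.
have [c [d [X [hX trX X0]]]] := homog_nonzero char_k AB N_gt0.
have [x xE] := lr_surj rep (loop_mono T 1 hX trX); exists x.
apply: contraNneq X0 => x0; rewrite x0 (lr0 rep) in xE.
move/esym/eqP: xE; rewrite scaler_eq0 (negPf (mono_neq0 _ _ _)) /= map_mx_eq0.
by [].
Qed.

Theorem sl_isomorphic g1 n1 (theta1 : k) (h1 : theta1 != 0) g2 n2 (theta2 : k) (h2 : theta2 != 0) :
  n1.+1.-primitive_root theta1 -> n2.+1.-primitive_root theta2 ->
  lie_isomorphic (sl g1.+1 (qtorus h1)) (sl g2.+1 (qtorus h2)) ->
  g1 = g2 /\ (theta1 = theta2 \/ theta1 = theta2^-1).
Proof.
move=> P1 P2 /lie_isomorphic_inverse[phi [phi' [phi_lie phi'_lie phiK phi'K]]].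
have nz : (0 < n1 + g1 * n1.+1)%N = (0 < n2 + g2 * n2.+1)%N.
  apply/idP/idP => [/(sl_nonzero g1 h1 P1)[x x0] | /(sl_nonzero g2 h2 P2)[x x0]].
    by apply/(sl_nonzero g2 h2 P2); exists (phi x); rewrite -(inj_eq (can_inj phi'K)) phiK raddf0.
  by apply/(sl_nonzero g1 h1 P1); exists (phi' x); rewrite -(inj_eq (can_inj phiK)) phi'K raddf0.
(* Size 1 means g = 1 and order 1, hence theta = 1, on both sides; [loop_compare] handles all other
   sizes. *)
case: (posnP (n1 + g1 * n1.+1)) => [N1_0 | N1_gt0].
  have N2_0 : (n2 + g2 * n2.+1 = 0)%N by apply/eqP; rewrite -leqn0 leqNgt -nz N1_0.
  have [? ?] : n1 = 0%N /\ g1 = 0%N by lia.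
  have [? ?] : n2 = 0%N /\ g2 = 0%N by lia.
  subst; split=> //; left.
  by rewrite -[theta1]expr1 -[theta2]expr1 (prim_expr_order P1) (prim_expr_order P2).
have N2_gt0 := N1_gt0; rewrite nz in N2_gt0.
pose T := rational_torus_field k.
have rep1 := sl_loop_rep T g1 h1 char_k P1 (m := n2.+1) isT.
have rep2 := sl_loop_rep T g2 h2 char_k P2 (m := n1.+1) isT.
have AB1 := big_pair g1 P1; have AB2 := big_pair g2 P2.
have [N12 H12] := loop_compare char_k AB1 rep1 AB2 rep2 N1_gt0 N2_gt0 phi_lie phi'_lie phiK phi'K.
have [N21 H21] := loop_compare char_k AB2 rep2 AB1 rep1 N2_gt0 N1_gt0 phi'_lie phi_lie phi'K phiK.
have NE : (n1 + g1 * n1.+1 = n2 + g2 * n2.+1)%N by apply/eqP; rewrite eqn_leq N12.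
have [eta1 [q1 Q1]] := H12 NE; have [eta2 [q2 Q2]] := H21 (esym NE).
have [[n12] theta12] := root_orders P1 P2 Q1 Q2; split=> //.
by move: NE; rewrite n12; nia.
Qed.

End Main.

Lemma finite_order_primitive (F : fieldType) (theta : F) :
  (exists n : nat, (0 < n)%N /\ theta ^+ n = 1) -> exists n, n.+1.-primitive_root theta.
Proof.
move=> [n [n_gt0 /(prim_order_exists n_gt0)[[|m] prim _]]]; last by exists m.
by have := prim_order_gt0 prim.
Qed.

Theorem theorem11p3p2 (k : closedFieldType) (hchar : [pchar k] =i pred0)
    (g1 g2 : nat) (hg1 : (0 < g1)%N) (hg2 : (0 < g2)%N)
    (theta1 theta2 : k) (h1 : theta1 != 0) (h2 : theta2 != 0)
    (hfin1 : exists n : nat, (0 < n)%N /\ theta1 ^+ n = 1)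
    (hfin2 : exists n : nat, (0 < n)%N /\ theta2 ^+ n = 1) :
  (lie_isomorphic (sl g1 (qtorus h1)) (sl g2 (qtorus h2))
     <-> g1 = g2 /\ (theta1 = theta2 \/ theta1 = theta2^-1))
  /\
  (g1 = g2 /\ (theta1 = theta2 \/ theta1 = theta2^-1)
     <-> mxalg_isomorphic g1 g2 (qtorus h1) (qtorus h2)).
Proof.
have ab : lie_isomorphic (sl g1 (qtorus h1)) (sl g2 (qtorus h2)) ->
    g1 = g2 /\ (theta1 = theta2 \/ theta1 = theta2^-1).
  have [n1 P1] := finite_order_primitive hfin1; have [n2 P2] := finite_order_primitive hfin2.
  case: g1 hg1 => // g1' _; case: g2 hg2 => // g2' _.
  by move=> /(sl_isomorphic hchar P1 P2)[-> ?].
have bc : g1 = g2 /\ (theta1 = theta2 \/ theta1 = theta2^-1) ->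
    mxalg_isomorphic g1 g2 (qtorus h1) (qtorus h2).
  case=> -> [E12 | /mxalg_swap]; last by apply.
  (* For equal parameters the two types still carry different proofs of nonvanishing, which are
     identified here. *)
  clear ab; case: _ / E12 h2 => h2'; rewrite (bool_irrelevance h2' h1).
  by exists (idfun : {rmorphism mxalg g2 (qtorus h1) -> mxalg g2 (qtorus h1)}); split=> //; exists id.
have ca := @mxalg_lie_isomorphic k g1 g2 (qtorus h1) (qtorus h2).
by split; split; auto.
Qed.
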